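(* Let $n\ge 1$, let $L$ be a real symmetric $n\times n$ matrix, let $C_1,C_2$ be real symmetric positive definite $n\times n$ matrices and let $K_1,K_2$ be real symmetric positive semidefinite $n\times n$ matrices. Then the real-valued function \[ z \;\mapsto\; \operatorname{tr}\exp\Big( L + \log(C_1 + zK_1) + \log(C_2 - zK_2)\Big), \] defined for real $z$ in a neighborhood of $0$ (where $C_1+zK_1$ and $C_2-zK_2$ are positive definite), is concave on some neighborhood of $0$.
   Context: For a real symmetric positive definite matrix $C$, $\log C$ denotes the matrix logarithm (the unique real symmetric matrix $H$ with $\exp H = C$), and $\exp$ is the matrix exponential; $\operatorname{tr}$ is the trace. *)

(* Defs.v *)
(* real n x n matrices represented as functions nat -> nat -> R,
   of which only the entries with indices < n are meaningful. *)
From Stdlib Require Import Reals Lra Lia Arith ClassicalEpsilon.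
Open Scope R_scope.

Definition Mat := nat -> nat -> R.

Fixpoint fsum (n : nat) (f : nat -> R) : R :=
  match n with
  | O => 0
  | S m => fsum m f + f m
  end.

Definition meq (n : nat) (A B : Mat) : Prop :=
  forall i j, (i < n)%nat -> (j < n)%nat -> A i j = B i j.

Definition madd (A B : Mat) : Mat := fun i j => A i j + B i j.
Definition mscale (c : R) (A : Mat) : Mat := fun i j => c * A i j.
Definition mid : Mat := fun i j => if Nat.eq_dec i j then 1 else 0.
Definition mmul (n : nat) (A B : Mat) : Mat :=
  fun i j => fsum n (fun k => A i k * B k j).

Fixpoint mpow (n : nat) (A : Mat) (k : nat) : Mat :=
  match k with
  | O => mid
  | S k' => mmul n (mpow n A k') A
  end.

Definition mtrace (n : nat) (A : Mat) : R := fsum n (fun i => A i i).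

Definition symmetric (n : nat) (A : Mat) : Prop :=
  forall i j, (i < n)%nat -> (j < n)%nat -> A i j = A j i.

Definition qform (n : nat) (A : Mat) (x : nat -> R) : R :=
  fsum n (fun i => fsum n (fun j => x i * A i j * x j)).

Definition nonzero_vec (n : nat) (x : nat -> R) : Prop :=
  exists i, (i < n)%nat /\ x i <> 0.

Definition pos_def (n : nat) (A : Mat) : Prop :=
  symmetric n A /\ forall x, nonzero_vec n x -> 0 < qform n A x.

Definition pos_semidef (n : nat) (A : Mat) : Prop :=
  symmetric n A /\ forall x, 0 <= qform n A x.

Definition exp_partial (n : nat) (A : Mat) (i j : nat) : nat -> R :=
  fun N => sum_f_R0 (fun k => mpow n A k i j / INR (fact k)) N.

Definition mexp (n : nat) (A : Mat) : Mat :=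
  fun i j => epsilon (inhabits 0) (fun l => Un_cv (exp_partial n A i j) l).

(* Matrix logarithm of a symmetric positive definite C: the (unique) real
   symmetric H with exp H = C. *)
Definition mlog (n : nat) (C : Mat) : Mat :=
  epsilon (inhabits mid) (fun H => symmetric n H /\ meq n (mexp n H) C).

Definition trexp_fun (n : nat) (L C1 C2 K1 K2 : Mat) (z : R) : R :=
  mtrace n (mexp n (madd L (madd (mlog n (madd C1 (mscale z K1)))
                                 (mlog n (madd C2 (mscale (- z) K2)))))).

(* Main.v *)
(** Epstein's method.  Put f(z) = tr exp(L + Log(C1 + z K1) + Log(C2 - z K2)), where
    Log X = ∫_0^1 (X - 1) ((1 - s) + s X)^-1 ds, for z real near 0 and for z in the upper
    half-plane.  If z = r e^(iθ) with 0 < θ < π, the imaginary part of Log(C1 + z K1) lies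
    between 0 and θ and that of Log(C2 - z K2) between θ - π and 0, in the sense of quadratic
    forms: the sign is read off the integral, and the other bound is the same statement for
    e^(-iθ)(C1 + z K1), since Log(e^(-iθ) X) = Log X - iθ.  So the eigenvalues of the exponent
    have imaginary part in [θ - π, θ], and Im (f(z) / z) <= 0.

    Hence u(z) = Im (-(f(z) - f(0)) / z) is at least -f(0) Im z / |z|^2, while u tends to 0
    at 0 because f is real on the real axis.  The minimum principle for the harmonic function u
    gives u >= 0 on the upper half-plane, and u(iy) = -y f''(0)/2 + O(y^2) then yields
    f''(0) <= 0.  Translating the pencil gives f'' <= 0 at every point of the interval.

    Analyticity is used only through second order Taylor expansions with cubic remainder. *)

Require Import Defs.
From Stdlib Require Import Reals Lra ClassicalEpsilon.
From Coquelicot Require Import Rbar Lub Hierarchy Continuity Derive RInt RInt_analysis.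
From Coquelicot Require Import Series PSeries AutoDerive ElemFct.

(** * Real calculus: a linear differential system and the integral of the logarithm *)

Section RealCalculus.
Local Open Scope R_scope.

(** For complex z the matrices C1 + z K1 and C2 - z K2 need not be normal, so the spectral theorem
    does not give their logarithms; the integral only asks that the segment from 1 to X consist of
    invertible matrices. This is read off the numerical range: one rotation brings the ranges of 1
    and X into a half-plane Re >= c > 0, which also bounds all the resolvents by a multiple of 1/c.
    The exponent need not be normal either, but its eigenvalues lie in its numerical range, where
    the bounds on the three summands add up.

    Subtracting f(0) removes the pole of f(z)/z at 0. The price is a negative lower bound for u, but
    the points where it allows u <= -η form a disc tangent to the real axis at 0. Near 0 the
    expansion of f excludes such values, so the rest of the disc stays away from the real axis and
    no boundary behaviour has to be studied elsewhere.

    Concavity is not drawn from a second derivative as a function: the bound f(x + h) <= f(x) + a h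
    + M |h|^3 at each point x, with a and M depending on x, is enough for a comparison with
    chords. *)

Lemma derive_zero_constant (f : R -> R) : (forall t, is_derive f t 0) -> f 1 = f 0.
Proof.
intros d; destruct (MVT_gen f 0 1 (fun _ => 0)) as [c [_ e]].
- intros t _; apply d.
- intros t _; apply derivable_continuous_pt, ex_derive_Reals_0; exists 0; apply d.
- lra.
Qed.

(** The system says that p + iq has derivative (a + ib)(p + iq), so its product with e^(-(a + ib)t)
    is constant; [e1] and [e2] are the real and imaginary parts of this. It evaluates the
    exponential series at a + ib without multiplying series. *)
Lemma linear_ode_spiral (p q : R -> R) (a b : R) :
  (forall t, is_derive p t (a * p t - b * q t)) ->
  (forall t, is_derive q t (a * q t + b * p t)) -> p 0 = 1 -> q 0 = 0 ->
  p 1 = exp a * cos b /\ q 1 = exp a * sin b.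
Proof.
intros dp dq p0 q0.
assert (e1 := derive_zero_constant
  (fun t => exp (- (t * a)) * (p t * cos (t * b) + q t * sin (t * b)))).
assert (e2 := derive_zero_constant
  (fun t => exp (- (t * a)) * (q t * cos (t * b) - p t * sin (t * b)))).
simpl in e1, e2; rewrite p0, q0 in e1, e2; rewrite !Rmult_0_l, !Rmult_1_l in e1, e2.
rewrite Ropp_0, exp_0, cos_0 in e1; rewrite Ropp_0, exp_0, sin_0 in e2.
assert (E1 : exp (- a) * (p 1 * cos b + q 1 * sin b) = 1).
{ rewrite e1; [ring|]; intros t; auto_derive.
  - repeat split; eexists; eauto.
  - rewrite (is_derive_unique (fun u : R => p u) t _ (dp t) : Derive (fun u : R => p u) t = _),
      (is_derive_unique (fun u : R => q u) t _ (dq t) : Derive (fun u : R => q u) t = _); ring. }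
assert (E2 : exp (- a) * (q 1 * cos b - p 1 * sin b) = 0).
{ rewrite e2; [ring|]; intros t; auto_derive.
  - repeat split; eexists; eauto.
  - rewrite (is_derive_unique (fun u : R => p u) t _ (dp t) : Derive (fun u : R => p u) t = _),
      (is_derive_unique (fun u : R => q u) t _ (dq t) : Derive (fun u : R => q u) t = _); ring. }
assert (ee : exp a * exp (- a) = 1) by (rewrite <- exp_plus, Rplus_opp_r; apply exp_0).
assert (F1 : p 1 * cos b + q 1 * sin b = exp a).
{ transitivity (exp a * exp (- a) * (p 1 * cos b + q 1 * sin b)).
  - rewrite ee; ring.
  - rewrite Rmult_assoc, E1; ring. }
assert (F2 : q 1 * cos b - p 1 * sin b = 0).
{ apply (Rmult_eq_reg_l (exp (- a))); [lra | apply Rgt_not_eq, exp_pos]. }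
assert (cs := sin2_cos2 b); unfold Rsqr in cs.
split; rewrite <- F1.
- transitivity (p 1 * (sin b * sin b + cos b * cos b)); [rewrite cs; ring|].
  replace ((p 1 * cos b + q 1 * sin b) * cos b)
    with (p 1 * (sin b * sin b + cos b * cos b) + (q 1 * cos b - p 1 * sin b) * sin b) by ring.
  rewrite F2; ring.
- transitivity (q 1 * (sin b * sin b + cos b * cos b)); [rewrite cs; ring|].
  replace ((p 1 * cos b + q 1 * sin b) * sin b)
    with (q 1 * (sin b * sin b + cos b * cos b) - (q 1 * cos b - p 1 * sin b) * cos b) by ring.
  rewrite F2; ring.
Qed.

(** The scalar case of the integral that defines the matrix logarithm; the antiderivative is ln (1 +
    s (d - 1)). *)
Lemma RInt_ln (d : R) : 0 < d -> RInt (fun s => (d - 1) / (1 + s * (d - 1))) 0 1 = ln d.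
Proof.
intros d0.
assert (pos : forall s, 0 <= s <= 1 -> 0 < 1 + s * (d - 1)).
{ intros s [s0 s1]; destruct (Rle_lt_dec 1 d); nra. }
apply is_RInt_unique.
replace (ln d) with (minus (ln (1 + 1 * (d - 1))) (ln (1 + 0 * (d - 1)))).
2: { unfold minus, plus, opp; simpl.
     replace (1 + 1 * (d - 1)) with d by ring; replace (1 + 0 * (d - 1)) with 1 by ring.
     rewrite ln_1; ring. }
apply (is_RInt_derive (fun s => ln (1 + s * (d - 1)))).
- intros s; rewrite Rmin_left, Rmax_right by lra; intros hs; specialize (pos s hs).
  auto_derive; [lra|field; lra].
- intros s; rewrite Rmin_left, Rmax_right by lra; intros hs; specialize (pos s hs).
  apply (ex_derive_continuous (fun s => (d - 1) / (1 + s * (d - 1)))); auto_derive; lra.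
Qed.

End RealCalculus.

From mathcomp Require Import all_boot all_order all_algebra.
From mathcomp Require Import sesquilinear mxred spectral complex.
From mathcomp Require Import Rstruct.
From mathcomp Require Import ring lra.
Set Implicit Arguments.
Unset Strict Implicit.
Unset Printing Implicit Defensive.
Import Order.TTheory GRing.Theory Num.Theory ComplexField ComplexField.Normc.
Local Open Scope ring_scope.
Local Open Scope complex_scope.
Local Open Scope sesquilinear_scope.

Bind Scope ring_scope with Rdefinitions.R.
Notation RR := Rdefinitions.R.
Notation CC := (complex RR).
Notation Rc := (@complex.Re RR).
Notation Ic := (@complex.Im RR).

(** * Complex numbers: real part, imaginary part and modulus *)

Section ComplexNumbers.
Implicit Types (x y z : CC) (r : RR).

Lemma Rc_add x y : Rc (x + y) = Rc x + Rc y. Proof. by case: x y => [? ?] [? ?]. Qed.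
Lemma Ic_add x y : Ic (x + y) = Ic x + Ic y. Proof. by case: x y => [? ?] [? ?]. Qed.
Lemma Rc_opp x : Rc (- x) = - Rc x. Proof. by case: x. Qed.
Lemma Ic_opp x : Ic (- x) = - Ic x. Proof. by case: x. Qed.
Lemma Rc_mul x y : Rc (x * y) = Rc x * Rc y - Ic x * Ic y.
Proof. by case: x y => [? ?] [? ?]. Qed.
Lemma Ic_mul x y : Ic (x * y) = Rc x * Ic y + Ic x * Rc y.
Proof. by case: x y => [? ?] [? ?]. Qed.
Lemma Rc_conj x : Rc x^* = Rc x. Proof. by case: x. Qed.
Lemma Ic_conj x : Ic x^* = - Ic x. Proof. by case: x. Qed.
Lemma Rc_sum I (s : seq I) (P : pred I) (F : I -> CC) :
  Rc (\sum_(i <- s | P i) F i) = \sum_(i <- s | P i) Rc (F i).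
Proof. exact: (big_morph Rc Rc_add). Qed.
Lemma Ic_sum I (s : seq I) (P : pred I) (F : I -> CC) :
  Ic (\sum_(i <- s | P i) F i) = \sum_(i <- s | P i) Ic (F i).
Proof. exact: (big_morph Ic Ic_add). Qed.
Definition ReImE := (Rc_add, Ic_add, Rc_opp, Ic_opp, Rc_mul, Ic_mul, Rc_conj, Ic_conj).

Lemma Rc_scale r x : Rc (r%:C * x) = r * Rc x.
Proof. by rewrite Rc_mul /= mul0r subr0. Qed.
Lemma Ic_scale r x : Ic (r%:C * x) = r * Ic x.
Proof. by rewrite Ic_mul /= mul0r addr0. Qed.

Lemma Rc_mul_real x y : Ic y = 0 -> Rc (x * y) = Rc x * Rc y.
Proof. by move=> y0; rewrite Rc_mul y0 mulr0 subr0. Qed.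

Lemma complex_ext x y : Rc x = Rc y -> Ic x = Ic y -> x = y.
Proof. by case: x y => [? ?] [? ?] /= -> ->. Qed.

Lemma normc_ge0 x : 0 <= normc x.
Proof. by case: x => a b; exact: sqrtr_ge0. Qed.
Lemma normc_sqr x : normc x ^+ 2 = Rc x ^+ 2 + Ic x ^+ 2.
Proof. by case: x => a b /=; rewrite sqr_sqrtr // addr_ge0 ?sqr_ge0. Qed.
Lemma normc_real r : normc r%:C = `|r|.
Proof. by rewrite /= expr0n /= addr0 sqrtr_sqr. Qed.
Lemma normcX x k : normc (x ^+ k) = normc x ^+ k.
Proof. by elim: k => [|k IH]; [exact: normc1 | rewrite !exprS normcM IH]. Qed.
Lemma normr_Rc x : `|Rc x| <= normc x.
Proof. by rewrite -ler_sqr ?nnegrE ?normc_ge0 // normc_sqr real_normK ?num_real // lerDl sqr_ge0. Qed.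
Lemma normr_Ic x : `|Ic x| <= normc x.
Proof. by rewrite -ler_sqr ?nnegrE ?normc_ge0 // normc_sqr real_normK ?num_real // lerDr sqr_ge0. Qed.
Lemma Rc_le x : Rc x <= normc x. Proof. exact: le_trans (ler_norm _) (normr_Rc x). Qed.
Lemma Ic_le x : Ic x <= normc x. Proof. exact: le_trans (ler_norm _) (normr_Ic x). Qed.
Lemma normc_le x : normc x <= `|Rc x| + `|Ic x|.
Proof.
rewrite -ler_sqr ?nnegrE ?normc_ge0 ?addr_ge0 // normc_sqr sqrrD !real_normK ?num_real //.
by rewrite addrAC lerDl mulrn_wge0 ?mulr_ge0.
Qed.
Lemma normc_conj x : normc x^* = normc x.
Proof. by case: x => a b; rewrite /= sqrrN. Qed.
Lemma normc_sum I (s : seq I) (P : pred I) (F : I -> CC) :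
  normc (\sum_(i <- s | P i) F i) <= \sum_(i <- s | P i) normc (F i).
Proof.
elim/big_rec2: _ => [|i a b _ le]; first by rewrite normc0.
exact: le_trans (le_normcD _ _) (lerD (lexx _) le).
Qed.
Lemma mulc_conj x : x^* * x = (normc x ^+ 2)%:C.
Proof. by rewrite normc_sqr; case: x => a b; apply: complex_ext => /=; ring. Qed.
Lemma normc_eq0 x : (normc x == 0) = (x == 0).
Proof. by apply/eqP/eqP => [/eq0_normc //|->]; rewrite normc0. Qed.

End ComplexNumbers.

(** * A submultiplicative matrix norm and quadratic forms *)

Section MatrixNorm.
Variable n : nat.
Implicit Types (A B : 'M[CC]_n.+1) (v : 'cV[CC]_n.+1).

(** The entrywise sum is submultiplicative and dominates every entry and the trace. The identity has
    norm [n.+1], not 1, whence the factor [mnorm 1] in bounds on powers. *)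
Definition mnorm A : RR := \sum_i \sum_j normc (A i j).

Lemma mnorm_ge0 A : 0 <= mnorm A.
Proof. by apply: sumr_ge0 => i _; apply: sumr_ge0 => j _; exact: normc_ge0. Qed.
Lemma mnormD A B : mnorm (A + B) <= mnorm A + mnorm B.
Proof.
rewrite /mnorm -big_split /=; apply: ler_sum => i _; rewrite -big_split /=.
by apply: ler_sum => j _; rewrite mxE le_normcD.
Qed.
Lemma mnormZ (a : CC) A : mnorm (a *: A) = normc a * mnorm A.
Proof.
rewrite /mnorm mulr_sumr; apply: eq_bigr => i _; rewrite mulr_sumr.
by apply: eq_bigr => j _; rewrite mxE normcM.
Qed.
Lemma mnormN A : mnorm (- A) = mnorm A.
Proof. by rewrite -scaleN1r mnormZ normcN normc1 mul1r. Qed.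
Lemma mnorm_entry A i j : normc (A i j) <= mnorm A.
Proof.
rewrite /mnorm (bigD1 i) //= (bigD1 j) //= -addrA lerDl addr_ge0 //.
  by apply: sumr_ge0 => *; exact: normc_ge0.
by apply: sumr_ge0 => *; apply: sumr_ge0 => *; exact: normc_ge0.
Qed.
Lemma mnorm_le A (b : RR) : (forall i j, normc (A i j) <= b) -> mnorm A <= n.+1%:R ^+ 2 * b.
Proof.
move=> le; have -> : n.+1%:R ^+ 2 * b = \sum_(i < n.+1) \sum_(j < n.+1) b.
  by rewrite !sumr_const card_ord -mulrnA -[RHS]mulr_natl natrM expr2.
by apply: ler_sum => i _; apply: ler_sum => j _.
Qed.
Lemma mnormM A B : mnorm (A * B) <= mnorm A * mnorm B.
Proof.
rewrite /mnorm mulr_suml; apply: ler_sum => i _.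
apply: (@le_trans _ _ (\sum_j \sum_k normc (A i k) * normc (B k j))).
  apply: ler_sum => j _; rewrite mxE; apply: le_trans (normc_sum _ _ _) _.
  by apply: ler_sum => k _; rewrite normcM.
rewrite exchange_big mulr_suml; apply: ler_sum => k _; rewrite -mulr_sumr.
apply: ler_wpM2l; first exact: normc_ge0.
rewrite [leRHS](bigD1 k) //= lerDl.
by apply: sumr_ge0 => *; apply: sumr_ge0 => *; exact: normc_ge0.
Qed.
Lemma mnorm_tr A : normc (\tr A) <= mnorm A.
Proof.
apply: le_trans (normc_sum _ _ _) _; apply: ler_sum => i _.
by rewrite [leRHS](bigD1 i) //= lerDl; apply: sumr_ge0 => *; exact: normc_ge0.
Qed.

Definition qf A v : CC := (v ^t* *m A *m v) 0 0.
(** The square of the Euclidean norm, so that it scales like [qf A v]. *)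
Definition vnorm v : RR := \sum_i normc (v i 0) ^+ 2.

Lemma vnorm_ge0 v : 0 <= vnorm v.
Proof. by apply: sumr_ge0 => *; exact: sqr_ge0. Qed.
Lemma vnorm_entry v i : normc (v i 0) ^+ 2 <= vnorm v.
Proof. by rewrite /vnorm [leRHS](bigD1 i) //= lerDl; apply: sumr_ge0 => *; exact: sqr_ge0. Qed.
Lemma vnorm_eq0 v : vnorm v <= 0 -> v = 0.
Proof.
move=> le; apply/matrixP => i j; rewrite mxE ord1; apply/eqP; rewrite -normc_eq0.
by rewrite -sqrf_eq0 eq_le sqr_ge0 (le_trans (vnorm_entry v i) le).
Qed.
Lemma dot_self v : (v ^t* *m v) 0 0 = (vnorm v)%:C.
Proof.
rewrite mxE rmorph_sum; apply: eq_bigr => i _; rewrite !mxE; exact: mulc_conj.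
Qed.
Lemma qf1 v : qf 1 v = (vnorm v)%:C.
Proof. by rewrite /qf mulmx1 dot_self. Qed.
Lemma qfD A B v : qf (A + B) v = qf A v + qf B v.
Proof. by rewrite /qf mulmxDr mulmxDl mxE. Qed.
Lemma qfZ (a : CC) A v : qf (a *: A) v = a * qf A v.
Proof. by rewrite /qf -scalemxAr -scalemxAl mxE. Qed.
Lemma qfN A v : qf (- A) v = - qf A v.
Proof. by rewrite -scaleN1r qfZ mulN1r. Qed.
Lemma qfE A v : qf A v = \sum_i \sum_j (v i 0)^* * A i j * v j 0.
Proof.
rewrite /qf -mulmxA mxE; apply: eq_bigr => i _; rewrite !mxE mulr_sumr.
by apply: eq_bigr => j _; rewrite mulrA.
Qed.
Lemma normc_qf A v : normc (qf A v) <= mnorm A * vnorm v.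
Proof.
rewrite qfE; apply: le_trans (normc_sum _ _ _) _.
rewrite /mnorm mulr_suml; apply: ler_sum => i _; apply: le_trans (normc_sum _ _ _) _.
rewrite mulr_suml; apply: ler_sum => j _; rewrite !normcM normc_conj mulrAC.
rewrite mulrC; apply: ler_wpM2l; first exact: normc_ge0.
have := vnorm_entry v i; have := vnorm_entry v j.
have := normc_ge0 (v i 0); have := normc_ge0 (v j 0); nra.
Qed.

End MatrixNorm.

(** * Numerical ranges in a half-plane and bounds on inverses *)

Section Accretive.
Variable n : nat.
Implicit Types (A B X Y : 'M[CC]_n.+1) (v : 'cV[CC]_n.+1) (w : CC) (c s : RR).

(** The numerical range of w Y, on unit vectors, lies in the half-plane Re >= c; w plays the part of
    a rotation. *)
Definition coercive c w Y :=
  [/\ 0 < c, normc w <= 1 & forall v, c * vnorm v <= Rc (w * qf Y v)].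

Lemma coercive_unit c w Y : coercive c w Y -> Y \is a GRing.unit.
Proof.
move=> [c0 w1 co]; suff: Y \in unitmx by [].
rewrite -unitmx_tr unitmxE unitfE.
apply/negP => /det0P [u u0]; move/(congr1 trmx); rewrite trmx_mul trmxK trmx0 => Yu.
have := co u^T; rewrite /qf -mulmxA Yu mulmx0 mxE mulr0 /= pmulr_rle0 // => /vnorm_eq0 ut0.
by move: u0; rewrite -(trmxK u) ut0 trmx0 eqxx.
Qed.

(** The jth column v of Y^-1 satisfies Y v = e_j, so coercivity gives c |v|^2 <= |v_j|. This bounds
    first |v_j| by 1/c and then |v|^2 by 1/c^2. *)
Lemma coercive_inv_norm c w Y : coercive c w Y -> mnorm Y^-1 <= n.+1%:R ^+ 2 / c.
Proof.
move=> cY; have uY := coercive_unit cY; case: cY => c0 w1 co.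
apply: mnorm_le => i j; pose v := col j Y^-1.
have Yv : Y *m v = delta_mx j 0.
  by rewrite /v colE mulmxA -[Y *m _]/(Y * Y^-1) mulrV // mul1mx.
have le : c * vnorm v <= normc (v j 0).
  apply: le_trans (co v) _; apply: le_trans (Rc_le _) _.
  rewrite normcM /qf -mulmxA Yv -colE 3!mxE normc_conj.
  by rewrite -[leRHS]mul1r ler_wpM2r ?normc_ge0.
have le1 k : c * normc (v k 0) ^+ 2 <= normc (v j 0).
  by apply: le_trans le; rewrite ler_pM2l // vnorm_entry.
have vE k : v k 0 = Y^-1 k j by rewrite mxE.
have bj : normc (v j 0) <= c^-1.
  rewrite -div1r ler_pdivlMr //; have [->|nz] := eqVneq (normc (v j 0)) 0; first by rewrite mul0r.
  have p : 0 < normc (v j 0) by rewrite lt_neqAle eq_sym nz normc_ge0.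
  by rewrite -(ler_pM2l p) mulr1 mulrA -expr2 mulrC le1.
rewrite -vE -ler_sqr ?nnegrE ?normc_ge0 ?invr_ge0 ?(ltW c0) //.
rewrite -(ler_pM2l c0); apply: le_trans (le1 i) _; apply: le_trans bj _.
by rewrite expr2 mulrA divff ?mul1r ?lt0r_neq0.
Qed.

Definition segment X s := (1 - s)%:C *: 1 + s%:C *: X.

(* The rotation [w] makes every matrix of the segment from 1 to [X] coercive, so
   that the resolvents in the integral defining [Log X] exist and are bounded. *)
Definition accretive c w X :=
  [/\ 0 < c, normc w <= 1, c <= Rc w & forall v, c * vnorm v <= Rc (w * qf X v)].

(** Half-planes are convex, and 1 and X both have their numerical range in Re (w .) >= c. *)
Lemma accretive_segm c w X s : accretive c w X -> 0 <= s <= 1 -> coercive c w (segment X s).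
Proof.
move=> [c0 w1 cw co] /andP[s0 s1]; split; [exact: c0|exact: w1|move=> v].
rewrite /segment qfD !qfZ qf1 mulrDr ![w * (_ * _)]mulrCA Rc_add !Rc_scale.
rewrite [w * _]mulrC Rc_scale.
have le : c * vnorm v <= Rc w * vnorm v by rewrite ler_wpM2r ?vnorm_ge0.
have := co v; move: le; move: (Rc w) (vnorm v) (Rc _) (c * _) => *; nra.
Qed.

Lemma accretive_unit c w X s : accretive c w X -> 0 <= s <= 1 -> segment X s \is a GRing.unit.
Proof. by move=> aX s01; apply: coercive_unit (accretive_segm aX s01). Qed.

Lemma accretive_inv_norm c w X s : accretive c w X -> 0 <= s <= 1 ->
  mnorm (segment X s)^-1 <= n.+1%:R ^+ 2 / c.
Proof. by move=> aX s01; apply: coercive_inv_norm (accretive_segm aX s01). Qed.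

End Accretive.

Notation in01 s := ((0 <= (s : RR)) && ((s : RR) <= 1)).

(** * Integration of Lipschitz functions on [0, 1] *)

Section RealIntegral.
Implicit Types (f g : RR -> RR).

Lemma lipschitz_continuous f (K : RR) :
  (forall x y, `|f x - f y| <= K * `|x - y|) -> forall z, continuous f z.
Proof.
move=> lip z; apply/continuity_pt_filterlim => e /RltP e0.
have K1 : 0 < `|K| + 1 by rewrite ltr_wpDl.
exists (e / (`|K| + 1)); split; first by apply/RltP; rewrite divr_gt0.
move=> x [_ /RltP]; rewrite /= /Rdist RabsE => xz.
apply/RltP; rewrite RabsE RminusE; apply: le_lt_trans (lip _ _) _.
rewrite ltr_pdivlMr // in xz; apply: le_lt_trans xz; rewrite mulrC ler_wpM2l //.
by apply: le_trans (ler_norm K) _; rewrite lerDl.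
Qed.

(** Resolvents are controlled only for parameters in [0, 1], while integrability is deduced from
    two-sided continuity, endpoints included. Composition with this retraction extends a Lipschitz
    function to the whole line. *)
Definition clamp s : RR := Num.max 0 (Num.min 1 s).

Lemma clamp_in s : in01 (clamp s).
Proof. by rewrite /clamp le_max lexx ge_max ler01 ge_min lexx. Qed.
Lemma clamp_id s : in01 s -> clamp s = s.
Proof. by rewrite /clamp => /andP[? ?]; rewrite min_r // max_r. Qed.
Lemma clamp_lip s t : `|clamp s - clamp t| <= `|s - t|.
Proof.
have clampE u : clamp u = if u <= 0 then 0 else if 1 <= u then 1 else u.
  rewrite /clamp; have [u0|u0] := leP u 0.
    by rewrite max_l // ge_min u0 orbT.
  have [u1|u1] := leP 1 u; first by rewrite max_r.
  by rewrite max_r // ltW.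
rewrite !clampE; case: (leP s 0) => ?; case: (leP t 0) => ?;
  case: (leP 1 s) => ?; case: (leP 1 t) => ?; rewrite ler_norml;
  case: (ger0P (s - t)) => ?; apply/andP; split; lra.
Qed.

Definition lipR f := exists K : RR, forall s t, in01 s -> in01 t -> `|f s - f t| <= K * `|s - t|.

Lemma lipR_ex_RInt f a b : lipR f -> in01 a -> in01 b -> ex_RInt f a b.
Proof.
move=> [K lip] a01 b01.
apply: (@ex_RInt_ext _ (fun s => f (clamp s))).
  move=> s [/RltP sa /RltP sb]; rewrite clamp_id //.
  move: sa sb; rewrite RminE RmaxE; move: a01 b01 => /andP[? ?] /andP[? ?].
  by case: (leP a b) => ? ? ?; apply/andP; split; lra.
apply: ex_RInt_continuous => z _; apply: (@lipschitz_continuous _ (`|K|)) => x y.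
apply: le_trans (lip _ _ (clamp_in _) (clamp_in _)) _.
apply: (@le_trans _ _ (`|K| * `|clamp x - clamp y|)).
  by rewrite ler_wpM2r // ler_norm.
by rewrite ler_wpM2l // clamp_lip.
Qed.

Definition rint f : RR := @RInt R_CompleteNormedModule f 0 1.

Lemma in010 : in01 0. Proof. by rewrite lexx ler01. Qed.
Lemma in011 : in01 1. Proof. by rewrite lexx ler01. Qed.

Lemma rint_lin f g a b : lipR f -> lipR g ->
  rint (fun s => a * f s + b * g s) = a * rint f + b * rint g.
Proof.
move=> lf lg; have ef := lipR_ex_RInt lf in010 in011; have eg := lipR_ex_RInt lg in010 in011.
have := @RInt_plus R_CompleteNormedModule _ _ 0 1
  (ex_RInt_scal _ _ _ a ef) (ex_RInt_scal _ _ _ b eg).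
by rewrite !RInt_scal.
Qed.

Lemma rint_ext f g : (forall s, in01 s -> f s = g s) -> rint f = rint g.
Proof.
move=> fg; apply: RInt_ext => s; rewrite RminE RmaxE => -[/RltP sa /RltP sb].
by apply: fg; move: sa sb; rewrite min_l ?max_r ?ler01 // => *; apply/andP; split; lra.
Qed.

Lemma rint_ge0 f : lipR f -> (forall s, in01 s -> 0 <= f s) -> 0 <= rint f.
Proof.
move=> lf f0; have ef := lipR_ex_RInt lf in010 in011; apply/RleP.
apply: (@RInt_ge_0 f 0 1) => //; first exact: Rle_0_1.
by move=> s [/RltP s0 /RltP s1]; apply/RleP/f0; rewrite !ltW.
Qed.

Lemma rint_abs f B : lipR f -> (forall s, in01 s -> `|f s| <= B) -> `|rint f| <= B.
Proof.
move=> lf fB; have ef := lipR_ex_RInt lf in010 in011.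
have := @abs_RInt_le_const f 0 1 B Rle_0_1 ef.
rewrite RabsE RminusE RmultE subr0 mul1r => H; apply/RleP; apply: H => s [/RleP s0 /RleP s1].
by rewrite RabsE; apply/RleP/fB; rewrite s0.
Qed.

(** Over N equal steps the increments add up to at most N B / N^2 = B / N, and N is arbitrary. This
    takes the place of a vanishing derivative, since quadratic bounds are what the resolvent
    identities produce. *)
Lemma quadratic_increment_constant (phi : RR -> RR) (B : RR) :
  (forall s t, in01 s -> in01 t -> `|phi s - phi t| <= B * (s - t) ^+ 2) -> phi 1 = phi 0.
Proof.
move=> quad; apply/eqP; rewrite -subr_eq0 -normr_le0; apply/negP => /negP; rewrite -ltNge.
set d := `|_| => d0.
have B0 : 0 <= B.
  by have := quad _ _ in011 in010; rewrite subr0 expr1n mulr1; apply: le_trans.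
have le (N : nat) : (N > 0)%N -> d <= B / N%:R.
  move=> N0; have Np : 0 < N%:R :> RR by rewrite ltr0n.
  have st k : (k <= N)%N -> `|phi (k%:R / N%:R) - phi 0| <= k%:R * (B / N%:R ^+ 2).
    elim: k => [|k IH] kN; first by rewrite !mul0r subrr normr0.
    have i01 j : (j <= N)%N -> in01 (j%:R / N%:R).
      by move=> jN; rewrite divr_ge0 ?ler0n // ler_pdivrMr // mul1r ler_nat.
    have := quad _ _ (i01 _ kN) (i01 _ (ltnW kN)); rewrite -mulrBl -natrB // subSnn.
    have := IH (ltnW kN); rewrite div1r exprVn => h1 h2.
    have -> : phi (k.+1%:R / N%:R) - phi 0 =
      (phi (k.+1%:R / N%:R) - phi (k%:R / N%:R)) + (phi (k%:R / N%:R) - phi 0) by ring.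
    apply: le_trans (ler_normD _ _) _; apply: le_trans (lerD h2 h1) _.
    by rewrite -{1}[B / _]mul1r -mulrDl -natr1 addrC.
  have := st N (leqnn N); rewrite divff ?lt0r_neq0 //.
  by have -> : N%:R * (B / N%:R ^+ 2) = B / N%:R by field; rewrite lt0r_neq0.
(* An N larger than B / d contradicts d <= B / N. *)
have := archi_boundP (divr_ge0 B0 (ltW d0)); set N := Num.bound _ => BN.
have N0 : (0 < N)%N by rewrite lt0n; apply: contraTneq BN => ->; rewrite -leNgt divr_ge0 // ltW.
have := le _ N0; rewrite ler_pdivlMr ?ltr0n // mulrC -ler_pdivlMr //.
by rewrite leNgt BN.
Qed.

(** That F has derivative g is expressed by a uniform quadratic remainder. The indefinite integral
    of g has a remainder of the same kind, with the Lipschitz constant of g, so its difference with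
    F has quadratic increments. *)
Lemma rint_FTC (F g : RR -> RR) (B : RR) : lipR g ->
  (forall s t, in01 s -> in01 t -> `|F s - F t - g t * (s - t)| <= B * (s - t) ^+ 2) ->
  rint g = F 1 - F 0.
Proof.
move=> lg quad; have [K lip] := lg.
pose phi (t : RR) : RR := @RInt R_CompleteNormedModule g 0 t - F t.
suff: phi 1 = phi 0.
  rewrite /phi RInt_point /zero /= => h; rewrite /rint.
  by move/(congr1 (fun x => x + F 1)): h; rewrite subrK => ->; rewrite sub0r addrC.
have key s t : in01 s -> in01 t -> t <= s ->
    `|RInt g 0 s - RInt g 0 t - g t * (s - t)| <= `|K| * (s - t) ^+ 2.
  move=> s01 t01 ts.
  have e1 := lipR_ex_RInt lg in010 t01; have e2 := lipR_ex_RInt lg t01 s01.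
  have <- := @RInt_Chasles R_CompleteNormedModule g 0 t s e1 e2; rewrite /plus /=.
  rewrite RplusE [X in X - _ - _]addrC addrK.
  have ec : ex_RInt (fun _ => g t : R_CompleteNormedModule) t s by apply: ex_RInt_const.
  have -> : RInt g t s - g t * (s - t) = RInt (fun u => g u - g t) t s.
    have := @RInt_minus R_CompleteNormedModule g (fun _ => g t) t s e2 ec.
    by rewrite RInt_const /minus /plus /opp /scal /= /mult /= => ->; rewrite [g t * _]mulrC.
  have em : ex_RInt (fun u => g u - g t) t s.
    exact: (@ex_RInt_minus R_CompleteNormedModule g (fun _ => g t) t s e2 ec).
  have ts' : Rle t s by apply/RleP.
  have := @abs_RInt_le_const _ t s (`|K| * (s - t)) ts' em.
  rewrite RabsE RmultE RminusE => H.
  have -> : `|K| * (s - t) ^+ 2 = (s - t) * (`|K| * (s - t)) by ring.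
  apply/RleP; apply: H => u [/RleP tu /RleP us]; rewrite RabsE; apply/RleP.
  have u01 : in01 u.
    by move: s01 t01 => /andP[? ?] /andP[? ?]; apply/andP; split; lra.
  apply: le_trans (lip _ _ u01 t01) _.
  have st : 0 <= u - t by rewrite subr_ge0.
  rewrite ger0_norm //; apply: (@le_trans _ _ (`|K| * (u - t))).
    by rewrite ler_wpM2r // ler_norm.
  by rewrite ler_wpM2l // lerD2r.
have key2 s t : in01 s -> in01 t -> t <= s -> `|phi s - phi t| <= (`|K| + B) * (s - t) ^+ 2.
  move=> s01 t01 ts.
  have -> : phi s - phi t = (RInt g 0 s - RInt g 0 t - g t * (s - t)) - (F s - F t - g t * (s - t)).
    by rewrite /phi; ring.
  by rewrite mulrDl; apply: le_trans (ler_normB _ _) _; rewrite lerD ?key ?quad.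
apply: (@quadratic_increment_constant _ (`|K| + B)) => s t s01 t01.
have [ts|/ltW st] := leP t s; first exact: key2.
by rewrite distrC -[(s - t) ^+ 2]sqrrN [- (s - t)]opprB; exact: key2.
Qed.

End RealIntegral.

(** * Componentwise integrals of complex functions *)

Section ComplexIntegral.
Implicit Types (g h : RR -> CC) (a : CC).

Definition lipC g := exists K : RR, forall s t, in01 s -> in01 t -> normc (g s - g t) <= K * `|s - t|.
Definition cint g : CC := (rint (fun s => Rc (g s))) +i* (rint (fun s => Ic (g s))).

Lemma lipC_Rc g : lipC g -> lipR (fun s => Rc (g s)).
Proof.
move=> [K lip]; exists K => s t s01 t01; apply: le_trans (lip _ _ s01 t01).
by rewrite -Rc_opp -Rc_add normr_Rc.
Qed.
Lemma lipC_Ic g : lipC g -> lipR (fun s => Ic (g s)).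
Proof.
move=> [K lip]; exists K => s t s01 t01; apply: le_trans (lip _ _ s01 t01).
by rewrite -Ic_opp -Ic_add normr_Ic.
Qed.
Lemma lipC_lin g h a : lipC g -> lipC h -> lipC (fun s => a * g s + h s).
Proof.
move=> [K lg] [L lh]; exists (normc a * K + L) => s t s01 t01.
have -> : a * g s + h s - (a * g t + h t) = a * (g s - g t) + (h s - h t) by ring.
apply: le_trans (le_normcD _ _) _; rewrite normcM mulrDl -mulrA.
by rewrite lerD ?lh // ler_wpM2l ?normc_ge0 // lg.
Qed.
Lemma lipC_cst a : lipC (fun _ => a).
Proof. by exists 0 => s t _ _; rewrite subrr normc0 mul0r. Qed.

Lemma cint_ext g h : (forall s, in01 s -> g s = h s) -> cint g = cint h.
Proof. by move=> gh; congr Complex; apply: rint_ext => s s01; rewrite gh. Qed.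

Lemma cint_lin g h a : lipC g -> lipC h -> cint (fun s => a * g s + h s) = a * cint g + cint h.
Proof.
move=> lg lh; have [l1 l2] := (lipC_Rc lg, lipC_Ic lg); have [l3 l4] := (lipC_Rc lh, lipC_Ic lh).
have [l5 l6] := (lipC_Rc (lipC_lin a lg (lipC_cst 0)), lipC_Ic (lipC_lin a lg (lipC_cst 0))).
apply: complex_ext; rewrite !ReImE /=.
- rewrite (@rint_ext _ (fun s => 1 * Rc (a * g s + 0) + 1 * Rc (h s))); last first.
    by move=> s _; rewrite !ReImE /= !mul1r addr0.
  rewrite rint_lin // !mul1r.
  rewrite (@rint_ext _ (fun s => Rc a * Rc (g s) + (- Ic a) * Ic (g s))); last first.
    by move=> s _; rewrite !ReImE /=; ring.
  by rewrite rint_lin // mulNr.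
- rewrite (@rint_ext _ (fun s => 1 * Ic (a * g s + 0) + 1 * Ic (h s))); last first.
    by move=> s _; rewrite !ReImE /= !mul1r addr0.
  rewrite rint_lin // !mul1r.
  rewrite (@rint_ext _ (fun s => Rc a * Ic (g s) + Ic a * Rc (g s))); last first.
    by move=> s _; rewrite !ReImE /=; ring.
  by rewrite rint_lin.
Qed.

Lemma cint0 : cint (fun _ => 0) = 0.
Proof. by apply: complex_ext; rewrite /= /rint RInt_const; exact: mulr0. Qed.

Lemma lipC_sum (I : Type) (r : seq I) (a : I -> CC) (g : I -> RR -> CC) :
  (forall i, lipC (g i)) -> lipC (fun s => \sum_(i <- r) a i * g i s).
Proof.
move=> lg; elim: r => [|i r IH].
  by exists 0 => s t _ _; rewrite !big_nil subrr normc0 mul0r.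
by have [K lip] := lipC_lin (a i) (lg i) IH; exists K => s t s01 t01; rewrite !big_cons; exact: lip.
Qed.

Lemma cint_sum (I : Type) (r : seq I) (a : I -> CC) (g : I -> RR -> CC) :
  (forall i, lipC (g i)) ->
  cint (fun s => \sum_(i <- r) a i * g i s) = \sum_(i <- r) a i * cint (g i).
Proof.
move=> lg; elim: r => [|i r IH].
  by rewrite big_nil -[RHS]cint0; apply: cint_ext => s _; rewrite big_nil.
rewrite big_cons -IH -cint_lin //; last exact: lipC_sum.
by apply: cint_ext => s _; rewrite big_cons.
Qed.

(** The factor 2 comes from bounding the modulus by |Re| + |Im|. *)
Lemma normc_cint g B : lipC g -> (forall s, in01 s -> normc (g s) <= B) -> normc (cint g) <= 2 * B.
Proof.
move=> lg gB; apply: le_trans (normc_le _) _; rewrite mulr2n mulrDl mul1r /=.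
apply: lerD; apply: rint_abs; rewrite ?lipC_Rc ?lipC_Ic //; try exact: lipC_Rc; try exact: lipC_Ic.
  by move=> s s01; apply: le_trans (normr_Rc _) (gB _ s01).
by move=> s s01; apply: le_trans (normr_Ic _) (gB _ s01).
Qed.

Lemma cint_FTC (F g : RR -> CC) (B : RR) : lipC g ->
  (forall s t, in01 s -> in01 t -> normc (F s - F t - g t * (s - t)%:C) <= B * (s - t) ^+ 2) ->
  cint g = F 1 - F 0.
Proof.
move=> lg quad; apply: complex_ext; rewrite !ReImE.
- apply: (@rint_FTC (fun s => Rc (F s)) _ B); first exact: lipC_Rc.
  move=> s t s01 t01; apply: le_trans (quad _ _ s01 t01); apply: le_trans (normr_Rc _).
  by rewrite !ReImE /= mulr0 subr0.
- apply: (@rint_FTC (fun s => Ic (F s)) _ B); first exact: lipC_Ic.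
  move=> s t s01 t01; apply: le_trans (quad _ _ s01 t01); apply: le_trans (normr_Ic _).
  by rewrite !ReImE /= mulr0 add0r.
Qed.

End ComplexIntegral.

(** * Entrywise integrals of matrix functions *)

Section MatrixIntegral.
Variable n : nat.
Implicit Types (A B : 'M[CC]_n.+1) (G F : RR -> 'M[CC]_n.+1).

Definition lipM G := exists K : RR, forall s t, in01 s -> in01 t -> mnorm (G s - G t) <= K * `|s - t|.
Definition mint G : 'M[CC]_n.+1 := \matrix_(i, j) cint (fun s => G s i j).

Lemma lipM_entry G i j : lipM G -> lipC (fun s => G s i j).
Proof.
move=> [K lip]; exists K => s t s01 t01; apply: le_trans (lip _ _ s01 t01).
by have := mnorm_entry (G s - G t) i j; rewrite !mxE.
Qed.
Lemma lipM_bounded G : lipM G -> exists B : RR, forall s, in01 s -> mnorm (G s) <= B.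
Proof.
move=> [K lip]; exists (mnorm (G 0) + `|K|) => s s01.
rewrite -{1}[G s](subrK (G 0)) addrC; apply: le_trans (mnormD _ _) _; rewrite lerD2l.
apply: le_trans (lip _ _ s01 in010) _; rewrite subr0.
apply: le_trans (ler_wpM2r (normr_ge0 _) (ler_norm K)) _.
by move: s01 => /andP[s0 s1]; rewrite (ger0_norm s0) ler_piMr.
Qed.
Lemma lipM_cst A : lipM (fun _ => A).
Proof. by exists 0 => s t _ _; rewrite subrr mul0r -(scale0r A) mnormZ normc0 mul0r. Qed.
Lemma lipMD F G : lipM F -> lipM G -> lipM (fun s => F s + G s).
Proof.
move=> [K lF] [L lG]; exists (K + L) => s t s01 t01.
rewrite opprD addrACA; apply: le_trans (mnormD _ _) _.
by rewrite mulrDl lerD ?lF ?lG.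
Qed.
Lemma lipMM F G : lipM F -> lipM G -> lipM (fun s => F s * G s).
Proof.
move=> lF lG; have [BF bF] := lipM_bounded lF; have [BG bG] := lipM_bounded lG.
move: lF lG => [K lF] [L lG]; exists (`|K| * BG + BF * `|L|) => s t s01 t01.
have -> : F s * G s - F t * G t = (F s - F t) * G s + F t * (G s - G t).
  by rewrite mulrBl mulrBr addrA subrK.
apply: le_trans (mnormD _ _) _; rewrite [leRHS]mulrDl; apply: lerD.
  apply: le_trans (mnormM _ _) _; rewrite mulrAC.
  apply: ler_pM; rewrite ?mnorm_ge0 ?bG //; apply: le_trans (lF _ _ s01 t01) _.
  by rewrite ler_wpM2r // ler_norm.
apply: le_trans (mnormM _ _) _; rewrite -mulrA.
apply: ler_pM; rewrite ?mnorm_ge0 ?bF //; apply: le_trans (lG _ _ s01 t01) _.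
by rewrite ler_wpM2r // ler_norm.
Qed.
Lemma lipM_id A : lipM (fun s => s%:C *: A).
Proof.
exists (mnorm A) => s t _ _; rewrite -scalerBl mnormZ -rmorphB normc_real.
by rewrite mulrC.
Qed.

Lemma lipM_ext F G : F =1 G -> lipM F -> lipM G.
Proof. by move=> FG [K lip]; exists K => s t; rewrite -!FG; exact: lip. Qed.
Lemma lipMZ (a : CC) G : lipM G -> lipM (fun s => a *: G s).
Proof.
move=> lG; apply: (@lipM_ext (fun s => (a *: 1) * G s)); last exact: lipMM (lipM_cst _) lG.
by move=> s; rewrite -scalerAl mul1r.
Qed.
Lemma lipMZid G : lipM G -> lipM (fun s => s%:C *: G s).
Proof.
move=> lG; apply: (@lipM_ext (fun s => (s%:C *: 1) * G s)); last exact: lipMM (lipM_id _) lG.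
by move=> s; rewrite -scalerAl mul1r.
Qed.

Lemma mint_ext F G : (forall s, in01 s -> F s = G s) -> mint F = mint G.
Proof. by move=> FG; apply/matrixP => i j; rewrite !mxE; apply: cint_ext => s s01; rewrite FG. Qed.

Lemma mintD F G : lipM F -> lipM G -> mint (fun s => F s + G s) = mint F + mint G.
Proof.
move=> lF lG; apply/matrixP => i j; rewrite !mxE.
rewrite -[cint (fun s => F s i j)]mul1r -cint_lin; try exact: lipM_entry.
by apply: cint_ext => s _; rewrite mxE mul1r.
Qed.

Lemma mintMl A G : lipM G -> mint (fun s => A * G s) = A * mint G.
Proof.
move=> lG; apply/matrixP => i j; rewrite !mxE.
under eq_bigr do rewrite mxE.
rewrite -cint_sum; last by move=> k; exact: lipM_entry.
by apply: cint_ext => s _; rewrite mxE.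
Qed.
Lemma mintMr A G : lipM G -> mint (fun s => G s * A) = mint G * A.
Proof.
move=> lG; apply/matrixP => i j; rewrite !mxE.
under eq_bigr do rewrite mxE mulrC.
rewrite -cint_sum; last by move=> k; exact: lipM_entry.
by apply: cint_ext => s _; rewrite mxE; under eq_bigr do rewrite mulrC.
Qed.
Lemma mintZ (a : CC) G : lipM G -> mint (fun s => a *: G s) = a *: mint G.
Proof.
move=> lG; rewrite -[a *: mint G]mul1r -scalerAr scalerAl -mintMl //.
by apply: mint_ext => s _; rewrite -scalerAl mul1r.
Qed.

Lemma mint_norm G (b : RR) : lipM G -> (forall s, in01 s -> mnorm (G s) <= b) ->
  mnorm (mint G) <= n.+1%:R ^+ 2 * (2 * b).
Proof.
move=> lG GB; apply: mnorm_le => i j; rewrite mxE; apply: normc_cint; first exact: lipM_entry.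
by move=> s s01; apply: le_trans (mnorm_entry _ _ _) (GB _ s01).
Qed.

Lemma mint_FTC (F G : RR -> 'M[CC]_n.+1) (B : RR) : lipM G ->
  (forall s t, in01 s -> in01 t -> mnorm (F s - F t - (s - t)%:C *: G t) <= B * (s - t) ^+ 2) ->
  mint G = F 1 - F 0.
Proof.
move=> lG quad; apply/matrixP => i j; rewrite !mxE.
apply: (@cint_FTC (fun s => F s i j) _ B); first exact: lipM_entry.
move=> s t s01 t01; apply: le_trans (quad _ _ s01 t01).
by have := mnorm_entry (F s - F t - (s - t)%:C *: G t) i j; rewrite !mxE mulrC.
Qed.

Lemma qf_mint G v : lipM G -> qf (mint G) v = cint (fun s => qf (G s) v).
Proof.
move=> lG; rewrite qfE.
transitivity (\sum_i \sum_j ((v i 0)^* * v j 0) * cint (fun s => G s i j)).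
  by apply: eq_bigr => i _; apply: eq_bigr => j _; rewrite mxE mulrAC.
rewrite pair_big -cint_sum /=; last by move=> [i j]; exact: lipM_entry.
by apply: cint_ext => s _; rewrite qfE pair_big; apply: eq_bigr => -[i j] _ /=; rewrite mulrAC.
Qed.

Lemma lipC_qf G v : lipM G -> lipC (fun s => qf (G s) v).
Proof.
move=> [K lip]; exists (K * vnorm v) => s t s01 t01.
rewrite -qfN -qfD mulrAC; apply: le_trans (normc_qf _ _) _.
by rewrite ler_wpM2r ?vnorm_ge0 ?lip.
Qed.

Lemma mint_Im_ge0 G v : lipM G -> (forall s, in01 s -> 0 <= Ic (qf (G s) v)) -> 0 <= Ic (qf (mint G) v).
Proof.
by move=> lG pos; rewrite qf_mint //; apply: rint_ge0 => //; apply: lipC_Ic; apply: lipC_qf.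
Qed.

End MatrixIntegral.

(** * Resolvent identities in an algebra *)

Section AlgebraIdentities.
Variables (F : comNzRingType) (A : algType F).
Implicit Types (s h : F) (a b p y z : A).

(** Here y = (1 + s a)^-1 and z = (1 + s b)^-1, each given by the equation that it solves so that no
    inverse occurs; a y and b z are the integrands of the logarithms of 1 + a and 1 + b. *)
Lemma resolvent_increment s a b y z : y = 1 - s *: (a * y) -> z = 1 - s *: (b * z) ->
  GRing.comm a y -> b * z - a * y = y * (b - a) * z.
Proof.
move=> ey ez ay; rewrite mulrBr mulrBl -ay.
have -> : y * b * z = b * z - s *: (a * y * (b * z)).
  by rewrite {1}ey -mulrA mulrBl mul1r -scalerAl.
have -> : a * y * z = a * y - s *: (a * y * (b * z)).
  by rewrite {1}ez mulrBr mulr1 -scalerAr.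
by rewrite opprB addrA subrK.
Qed.

(** The equation for z is substituted into itself twice. In its use y and z are the resolvents of X
    and X + h K and p = y K, so that p z is the integrand of (Log (X + h K) - Log X) / h. *)
Lemma resolvent_taylor s h p y z : z = y - (s * h) *: (p * z) ->
  p * z = p * y + (h *: (-1 *: (s *: (p * p * y))) + h ^+ 2 *: (s *: (s *: (p * p * p * z)))).
Proof.
move=> e.
have e1 : p * z = p * y - (s * h) *: (p * p * z) by rewrite {1}e mulrBr -scalerAr mulrA.
have e2 : p * p * z = p * p * y - (s * h) *: (p * p * p * z).
  by rewrite {1}e mulrBr -scalerAr !mulrA.
rewrite e1 e2 scalerBr opprB !scalerA; congr (_ + _); rewrite addrC; congr (_ + _).
  by rewrite mulrN1 mulNr scaleNr mulrC.
by congr (_ *: _); ring.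
Qed.

End AlgebraIdentities.

(** * The matrix logarithm and its second order expansion *)

Section Logarithm.
Variable n : nat.
Implicit Types (A B X K : 'M[CC]_n.+1) (v : 'cV[CC]_n.+1) (c s t : RR) (h w : CC).

Definition resolvent X s : 'M[CC]_n.+1 := (segment X s)^-1.
Definition Log X : 'M[CC]_n.+1 := mint (fun s => (X - 1) * resolvent X s).

Lemma segmentE X s : segment X s = 1 + s%:C *: (X - 1).
Proof. by rewrite /segment rmorphB /= scalerBl scale1r scalerBr addrAC addrA. Qed.
Lemma segment1 X : segment X 1 = X.
Proof. by rewrite segmentE scale1r addrCA subrr addr0. Qed.

Lemma segment_sub X s t : segment X s - segment X t = (s - t)%:C *: (X - 1).
Proof. by rewrite !segmentE opprD addrACA subrr add0r -scalerBl -rmorphB. Qed.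

Lemma invr_sub A B : A \is a GRing.unit -> B \is a GRing.unit ->
  A^-1 - B^-1 = A^-1 * (B - A) * B^-1.
Proof. by move=> uA uB; rewrite mulrBr mulrBl mulrK // mulVr // mul1r. Qed.

Lemma invr_sub_scale (a b : CC) A B : A \is a GRing.unit -> B \is a GRing.unit ->
  a *: A^-1 - b *: B^-1 = A^-1 * (a *: B - b *: A) * B^-1.
Proof.
move=> uA uB; rewrite mulrBr mulrBl -!scalerAr -!scalerAl (mulrK uB) (mulVr uA).
by rewrite mul1r.
Qed.

Lemma resolvent_eq X s : segment X s \is a GRing.unit -> resolvent X s = 1 - s%:C *: ((X - 1) * resolvent X s).
Proof.
move=> uY; have e : segment X s * resolvent X s = 1 by exact: mulrV.
by rewrite -[X in _ = X - _]e segmentE mulrDl mul1r -scalerAl addrK.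
Qed.

Lemma resolvent_comm X s : GRing.comm (X - 1) (resolvent X s).
Proof.
apply: commrV; rewrite segmentE; apply: commrD; first exact: commr1.
by rewrite /GRing.comm -scalerAr -scalerAl.
Qed.

Section OneMatrix.
Variables (c : RR) (w : CC) (X : 'M[CC]_n.+1).
Hypothesis aX : accretive c w X.
Let b : RR := n.+1%:R ^+ 2 / c.

Lemma resolvent_norm s : in01 s -> mnorm (resolvent X s) <= b.
Proof. exact: accretive_inv_norm aX. Qed.
Lemma segment_unit s : in01 s -> segment X s \is a GRing.unit.
Proof. exact: accretive_unit aX. Qed.

Lemma resolvent_lip s t : in01 s -> in01 t ->
  mnorm (resolvent X s - resolvent X t) <= b * mnorm (X - 1) * b * `|s - t|.
Proof.
move=> s01 t01; rewrite [resolvent X s - _]invr_sub ?segment_unit // segment_sub -scalerAr -scalerAl.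
rewrite mnormZ normc_real distrC mulrC ler_wpM2r //.
apply: le_trans (mnormM _ _) _; apply: ler_pM; rewrite ?mnorm_ge0 ?resolvent_norm //.
by apply: le_trans (mnormM _ _) _; rewrite ler_wpM2r ?mnorm_ge0 ?resolvent_norm.
Qed.
Lemma lipM_resolvent : lipM (resolvent X).
Proof. by exists (b * mnorm (X - 1) * b) => s t; exact: resolvent_lip. Qed.

(** The antiderivative is s (1 + s (X - 1))^-1, which is 0 at s = 0 and X^-1 at s = 1; its
    difference quotient between s and t is exactly the product of the two resolvents. *)
Lemma mint_resolvent_sqr : mint (fun s => resolvent X s * resolvent X s) = X^-1.
Proof.
have -> : X^-1 = 1%:C *: resolvent X 1 - 0%:C *: resolvent X 0.
  by rewrite scale1r scale0r subr0 /resolvent segment1.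
apply: (@mint_FTC _ (fun s => s%:C *: resolvent X s) _ (b * mnorm (X - 1) * b * b)).
  by apply: lipMM; exact: lipM_resolvent.
move=> s t s01 t01.
have uS := segment_unit s01; have uT := segment_unit t01.
have -> : s%:C *: resolvent X s - t%:C *: resolvent X t = (s - t)%:C *: (resolvent X s * resolvent X t).
  have -> : (s - t)%:C *: (resolvent X s * resolvent X t) =
            resolvent X s * (s%:C *: segment X t - t%:C *: segment X s) * resolvent X t.
    rewrite scalerAl; congr (_ * _); rewrite -[resolvent X s in LHS]mulr1 scalerAr; congr (_ * _).
    rewrite !segmentE !scalerDr !scalerA opprD addrACA [t%:C * _]mulrC subrr addr0 -scalerBl.
    by rewrite -rmorphB.
  exact: invr_sub_scale.
rewrite -scalerBr -mulrBl mnormZ normc_real.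
apply: (@le_trans _ _ (`|s - t| * ((b * mnorm (X - 1) * b * `|s - t|) * b))).
  rewrite ler_wpM2l //; apply: le_trans (mnormM _ _) _.
  by apply: ler_pM; rewrite ?mnorm_ge0 ?resolvent_norm ?resolvent_lip.
by rewrite -[(s - t) ^+ 2]real_normK ?num_real // le_eqVlt; apply/orP; left; apply/eqP; ring.
Qed.

(** This integral is the derivative of [Log] at X in the direction X; its value 1 is the
    infinitesimal form of Log (a X) = Log X + log a. *)
Lemma mint_resolvent_sandwich : mint (fun s => resolvent X s * X * resolvent X s) = 1.
Proof.
have uX : X \is a GRing.unit by rewrite -(segment1 X) segment_unit ?in011.
rewrite -(mulrV uX) -mint_resolvent_sqr -mintMl; last by apply: lipMM; exact: lipM_resolvent.
apply: mint_ext => s _; rewrite mulrA; congr (_ * _).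
by have := resolvent_comm X s; rewrite /GRing.comm mulrBl mulrBr mul1r mulr1 => /addIr.
Qed.

Lemma lipM_Log : lipM (fun s => (X - 1) * resolvent X s).
Proof. by apply: lipMM; [exact: lipM_cst | exact: lipM_resolvent]. Qed.

(* With u = resolvent X s v one has
   v^* (X - 1) (resolvent X s) v = u^* (X - 1) u + s |(X - 1) u|^2. *)
Lemma Log_Im_ge0 (sg : RR) : (forall v, 0 <= sg * Ic (qf X v)) ->
  forall v, 0 <= sg * Ic (qf (Log X) v).
Proof.
move=> pos v; rewrite /Log -Ic_scale -qfZ -mintZ; last exact: lipM_Log.
apply: mint_Im_ge0 => [|s s01].
  exact: lipMZ lipM_Log.
rewrite qfZ Ic_scale; pose u := resolvent X s *m v.
have vE : v = segment X s *m u by rewrite mulmxA -[segment X s *m _]/(_ * _) mulrV ?segment_unit // mul1mx.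
have -> : qf ((X - 1) * resolvent X s) v = qf (X - 1) u + s%:C * (vnorm ((X - 1) *m u))%:C.
  rewrite {1}/qf -[(X - 1) * _]/(_ *m _) -!mulmxA -/u {1}vE segmentE.
  rewrite mulmxDl mul1mx -scalemxAl.
  have -> : (u + s%:C *: ((X - 1) *m u))^t* = u^t* + s%:C *: ((X - 1) *m u)^t*.
    by apply/matrixP => i j; rewrite !mxE rmorphD rmorphM; congr (_ + _ * _); exact: conjc_real.
  by rewrite mulmxDl mxE -scalemxAl [X in _ + X]mxE dot_self /qf mulmxA.
rewrite qfD qfN qf1 !ReImE /= mulr0 mul0r oppr0 !addr0.
exact: pos.
Qed.

End OneMatrix.

(** An exact formula, valid also when X and X' do not commute or need different rotations;
    expansions of [Log] follow by inserting [resolvent_diff] into it. *)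
Lemma Log_diff c w X c' w' X' : accretive c w X -> accretive c' w' X' ->
  Log X' - Log X = mint (fun s => resolvent X s * (X' - X) * resolvent X' s).
Proof.
move=> aX aX'; rewrite /Log -[X in _ + X]scaleN1r -mintZ; last exact: (lipM_Log aX).
rewrite -mintD; [|exact: (lipM_Log aX')|exact: lipMZ (lipM_Log aX)].
apply: mint_ext => s s01; rewrite scaleN1r.
have e := resolvent_eq (segment_unit aX s01); have e' := resolvent_eq (segment_unit aX' s01).
have -> : X' - X = (X' - 1) - (X - 1) by rewrite opprB addrA subrK.
exact: resolvent_increment e e' (resolvent_comm X s).
Qed.

Lemma resolvent_diff c w X c' w' X' s : accretive c w X -> accretive c' w' X' -> in01 s ->
  resolvent X' s = resolvent X s - s%:C *: (resolvent X s * (X' - X) * resolvent X' s).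
Proof.
move=> aX aX' s01; have e := invr_sub (segment_unit aX' s01) (segment_unit aX s01).
have e2 := invr_sub (segment_unit aX s01) (segment_unit aX' s01).
rewrite -/(resolvent X s) -/(resolvent X' s) in e2.
have : segment X' s - segment X s = s%:C *: (X' - X).
  by rewrite !segmentE opprD addrACA subrr add0r -scalerBr opprB addrA subrK.
by move=> d; rewrite d -scalerAr -scalerAl in e2; rewrite -e2 opprB addrC subrK.
Qed.

(** The perturbed resolvent in [Log_diff] is expanded twice. The remainder still contains the
    resolvent of X + h K, which is bounded uniformly because c does not depend on h. *)
Lemma Log_taylor c w X K (rho : RR) : 0 <= rho ->
  (forall h, normc h <= rho -> accretive c w (X + h *: K)) ->
  exists A1 A2 (M : RR), forall h, normc h <= rho -> exists2 R, mnorm R <= M &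
    Log (X + h *: K) = Log X + h *: A1 + h ^+ 2 *: A2 + h ^+ 3 *: R.
Proof.
move=> rho0 aXh; have aX : accretive c w X.
  by have := aXh 0; rewrite scale0r addr0 normc0 => /(_ rho0).
pose b : RR := n.+1%:R ^+ 2 / c; pose P (s : RR) : 'M[CC]_n.+1 := resolvent X s * K.
have lZ := lipM_resolvent aX.
have lP : lipM P by apply: lipMM lZ (lipM_cst K).
(* With Z the resolvent of X, the coefficients are the integrals of Z K Z and -s Z K Z K Z. The
   bound on the remainder counts three factors Z K and one perturbed resolvent, every resolvent
   being at most b. *)
exists (mint (fun s => P s * resolvent X s)),
  (mint (fun s => (-1) *: (s%:C *: (P s * P s * resolvent X s)))),
  (n.+1%:R ^+ 2 * (2 * (b * mnorm K * (b * mnorm K) * (b * mnorm K) * b))).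
move=> h hr; move: (aXh _ hr); move eX' : (X + h *: K) => X' aX'.
have eK : X' - X = h *: K by rewrite -eX' addrAC subrr add0r.
have lZ' := lipM_resolvent aX'.
have l1 : lipM (fun s => P s * resolvent X s) by exact: lipMM.
have l2 : lipM (fun s => (-1) *: (s%:C *: (P s * P s * resolvent X s))).
  exact: lipMZ (lipMZid (lipMM (lipMM lP lP) lZ)).
pose R s := s%:C *: (s%:C *: (P s * P s * P s * resolvent X' s)).
have l3 : lipM R by exact: lipMZid (lipMZid (lipMM (lipMM (lipMM lP lP) lP) lZ')).
have l4 := lipMZ h l2; have l5 := lipMZ (h ^+ 2) l3.
exists (mint R).
  apply: mint_norm => // s s01; rewrite /R !mnormZ.
  have s1 : normc s%:C <= 1 by move: s01 => /andP[s0 s1]; rewrite normc_real ger0_norm.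
  have step A B (p q : RR) : mnorm A <= p -> mnorm B <= q -> mnorm (A * B) <= p * q.
    by move=> Ap Bq; apply: le_trans (mnormM _ _) _; rewrite ler_pM ?mnorm_ge0.
  have bP : mnorm (P s) <= b * mnorm K by apply: step => //; exact: (resolvent_norm aX s01).
  apply: (@le_trans _ _ (mnorm (P s * P s * P s * resolvent X' s))).
    rewrite mulrA ler_piMl ?mnorm_ge0 // mulr_ile1 ?normc_ge0 //.
  exact: step (step _ _ _ _ (step _ _ _ _ bP bP) bP) (resolvent_norm aX' s01).
have -> : Log X' = Log X + mint (fun s => resolvent X s * (X' - X) * resolvent X' s).
  by rewrite -(Log_diff aX aX') addrC subrK.
rewrite -!addrA; congr (_ + _).
have e2 (A : 'M[CC]_n.+1) : h ^+ 2 *: A = h *: (h *: A) by rewrite scalerA.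
have e3 (A : 'M[CC]_n.+1) : h ^+ 3 *: A = h *: (h ^+ 2 *: A) by rewrite scalerA -exprS.
rewrite eK e2 e3 -!scalerDr.
rewrite -(mintZ h l2) -(mintZ (h ^+ 2) l3) -(mintD l4 l5) -(mintD l1 (lipMD l4 l5)).
rewrite -mintZ; last exact: lipMD l1 (lipMD l4 l5).
apply: mint_ext => s s01; rewrite -scalerAr -scalerAl -/(P s); congr (_ *: _).
have d : resolvent X' s = resolvent X s - (s%:C * h) *: (P s * resolvent X' s).
  rewrite {1}(resolvent_diff aX aX' s01) eK -scalerAr -scalerAl scalerA.
  by [].
exact: resolvent_taylor.
Qed.
End Logarithm.

(** * The points e^(it) of the unit circle *)

Section UnitCircle.
Implicit Types (t u : RR).

Definition cis t : CC := cos t +i* sin t.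

Lemma cisD t u : cis (t + u) = cis t * cis u.
Proof.
by apply: complex_ext; rewrite /= -?RplusE ?cos_plus ?sin_plus // ?RminusE ?RplusE ?RmultE // addrC.
Qed.
Lemma cis0 : cis 0 = 1.
Proof. by apply: complex_ext; rewrite /= -?R0E ?cos_0 ?sin_0. Qed.
Lemma cisBpi t : cis (t - PI) = - cis t.
Proof.
have e : cis (- PI) = -1.
  apply: complex_ext; rewrite /= -RoppE; first by rewrite cos_neg cos_PI.
  by rewrite sin_neg sin_PI.
by rewrite cisD e mulrN1.
Qed.
Lemma normc_cis t : normc (cis t) = 1.
Proof.
have h := sin2_cos2 t; rewrite /Rsqr !RmultE RplusE in h.
by apply/eqP; rewrite -sqrp_eq1 ?normc_ge0 // normc_sqr /= !expr2 addrC h.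
Qed.

Lemma mvt (f df : RR -> RR) t : (forall u, is_derive f u (df u)) ->
  exists2 c, `|c| <= `|t| & f t - f 0 = df c * t.
Proof.
move=> d; have [|c [c1 e]] := @MVT_gen f 0 t df (fun u _ => d u).
  by move=> u _; apply: derivable_continuous_pt; apply: ex_derive_Reals_0; exists (df u).
exists c; last by move: e; rewrite !RminusE RmultE => ->; rewrite subr0.
move: c1; rewrite RminE RmaxE => -[/RleP + /RleP].
by case: (leP 0 t) => t0 h1 h2; [rewrite !ger0_norm | rewrite !ler0_norm ?lerN2 // ltW].
Qed.

Lemma is_derive_sinE t : is_derive sin t (cos t).
Proof. by apply/is_derive_Reals; exact: derivable_pt_lim_sin. Qed.
Lemma is_derive_cosE t : is_derive cos t (- sin t).
Proof. by apply/is_derive_Reals; exact: derivable_pt_lim_cos. Qed.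

Lemma abs_sin_le t : `|sin t| <= `|t|.
Proof.
have [c _ e] := @mvt sin cos t is_derive_sinE.
have -> : sin t = cos c * t by rewrite -e -R0E sin_0 subr0.
rewrite normrM ler_piMl // ler_norml.
by have [/RleP h1 /RleP h2] := COS_bound c; apply/andP; split.
Qed.
Lemma abs_cos_le t : `|cos t - 1| <= t ^+ 2.
Proof.
have [c ct e] := @mvt cos (fun u => - sin u) t is_derive_cosE.
have -> : cos t - 1 = - sin c * t by rewrite -e -R0E cos_0.
rewrite normrM normrN -[t ^+ 2]real_normK ?num_real // expr2 ler_wpM2r //.
exact: le_trans (abs_sin_le c) ct.
Qed.
Lemma abs_cos_le1 t : `|cos t - 1| <= `|t|.
Proof.
have [c ct e] := @mvt cos (fun u => - sin u) t is_derive_cosE.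
have -> : cos t - 1 = - sin c * t by rewrite -e -R0E cos_0.
rewrite normrM normrN ler_piMl // ler_norml.
by have [/RleP h1 /RleP h2] := SIN_bound c; apply/andP; split.
Qed.
Lemma abs_sin_sub_le t : `|sin t - t| <= t ^+ 2.
Proof.
have d u : is_derive (fun t => sin t - t) u (cos u - 1).
  by apply: (@is_derive_minus _ R_NormedModule sin id) => //; [exact: is_derive_sinE | exact: is_derive_id].
have [c ct e] := mvt t d.
have -> : sin t - t = (cos c - 1) * t by rewrite -e -[sin 0]/(sin 0) -R0E sin_0 !subr0.
rewrite normrM -[t ^+ 2]real_normK ?num_real // expr2 ler_wpM2r //.
exact: le_trans (abs_cos_le1 c) ct.
Qed.

Lemma cis_lip t : normc (cis t - 1) <= 2 * `|t|.
Proof.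
apply: le_trans (normc_le _) _; rewrite mulr2n mulrDl mul1r; apply: lerD.
  exact: abs_cos_le1.
by rewrite Ic_add Ic_opp /= oppr0 addr0; exact: abs_sin_le.
Qed.
Lemma cis_taylor t : normc (cis t - 1 - 0 +i* t) <= 2 * t ^+ 2.
Proof.
apply: le_trans (normc_le _) _; rewrite mulr2n mulrDl mul1r; apply: lerD.
  by rewrite !ReImE /= subr0; exact: abs_cos_le.
by rewrite !ReImE /= oppr0 addr0; exact: abs_sin_sub_le.
Qed.

Lemma cos_le_cos t u : `|u| <= t -> t <= PI -> cos t <= cos u.
Proof.
move=> ut tp; have -> : cos u = cos `|u|.
  by case: (ger0P u) => // _; rewrite -RoppE cos_neg.
have u0 := normr_ge0 u.
apply/RleP; apply: cos_decr_1; apply/RleP => //; first exact: le_trans ut tp.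
exact: le_trans u0 ut.
Qed.

End UnitCircle.

(** * The logarithm of a rotated matrix *)

Section Rotation.
Variable n : nat.
Implicit Types (X C K : 'M[CC]_n.+1) (v : 'cV[CC]_n.+1).

(** A perturbation of norm at most c / 2 costs at most half of the constant and keeps the
    rotation. *)
Lemma accretive_perturb c w X K h : accretive c w X -> normc h * mnorm K <= c / 2 ->
  accretive (c / 2) w (X + h *: K).
Proof.
move=> [c0 w1 cw co] hK; split; [by rewrite divr_gt0|exact: w1|by apply: le_trans cw; lra|].
move=> v; rewrite qfD qfZ mulrDr Rc_add.
have := co v; have : `|Rc (w * (h * qf K v))| <= c / 2 * vnorm v.
  apply: le_trans (normr_Rc _) _; rewrite !normcM.
  apply: (@le_trans _ _ (1 * (normc h * (mnorm K * vnorm v)))).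
    apply: ler_pM; rewrite ?normc_ge0 ?mulr_ge0 ?normc_ge0 //.
    by rewrite ler_wpM2l ?normc_ge0 ?normc_qf.
  by rewrite mul1r mulrA ler_wpM2r ?vnorm_ge0.
rewrite ler_norml => /andP[]; lra.
Qed.

Lemma matrix_quadratic_constant (F : RR -> 'M[CC]_n.+1) (B : RR) :
  (forall s t, in01 s -> in01 t -> mnorm (F s - F t) <= B * (s - t) ^+ 2) -> F 1 = F 0.
Proof.
move=> quad; apply/matrixP => i j; apply: complex_ext.
  apply: (@quadratic_increment_constant (fun s => Rc (F s i j)) B) => s t s01 t01.
  apply: le_trans (quad _ _ s01 t01); rewrite -Rc_opp -Rc_add; apply: le_trans (normr_Rc _) _.
  by have := mnorm_entry (F s - F t) i j; rewrite !mxE.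
apply: (@quadratic_increment_constant (fun s => Ic (F s i j)) B) => s t s01 t01.
apply: le_trans (quad _ _ s01 t01); rewrite -Ic_opp -Ic_add; apply: le_trans (normr_Ic _) _.
by have := mnorm_entry (F s - F t) i j; rewrite !mxE.
Qed.

(** Along the path X_s = e^(-isφ) X, with φ = [phi], the derivative of [Log] is -iφ times the
    integral of [mint_resolvent_sandwich], that is -iφ. Hence Log X_s + isφ has quadratic increments
    and is constant. The constant c is common to the path, while the half-plane may turn with s. *)
Lemma Log_rotate X (phi c : RR) (w : RR -> CC) :
  (forall s, in01 s -> accretive c (w s) (cis (- (s * phi)) *: X)) ->
  Log (cis (- phi) *: X) = Log X - (0 +i* phi)%:M.
Proof.
move=> aX0.
have [Xs [aX X1 X0 nXs XsE]] : exists Xs : RR -> 'M[CC]_n.+1,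
  [/\ forall s, in01 s -> accretive c (w s) (Xs s), Xs 1 = cis (- phi) *: X, Xs 0 = X,
      forall s, mnorm (Xs s) = mnorm X
    & forall s t, Xs s = Xs t + (cis (- ((s - t) * phi)) - 1) *: Xs t].
  exists (fun s => cis (- (s * phi)) *: X); split=> //.
  - by rewrite mul1r.
  - by rewrite mul0r oppr0 cis0 scale1r.
  - by move=> s; rewrite mnormZ normc_cis mul1r.
  - move=> s t; rewrite scalerBl scale1r addrC subrK scalerA -cisD; congr (cis _ *: _); ring.
pose b : RR := n.+1%:R ^+ 2 / c.
pose M2 := n.+1%:R ^+ 2 * (2 * (b * mnorm X * b * mnorm X * b)) : RR.
pose F (s : RR) : 'M[CC]_n.+1 := Log (Xs s) + (0 +i* (s * phi))%:M.
have : F 1 = F 0.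
  apply: (@matrix_quadratic_constant F
    (2 * phi ^+ 2 * mnorm (1 : 'M[CC]_n.+1) + 4 * phi ^+ 2 * M2)) => s t s01 t01.
  (* [eta] = e^(-i(s - t)φ) - 1 is the relative increment of the path: it equals -i(s - t)φ up to a
     quadratic error, and its square is of second order. *)
  have [eta [eK eT eL]] : exists eta, [/\ Xs s - Xs t = eta *: Xs t,
      normc (eta + 0 +i* ((s - t) * phi)) <= 2 * phi ^+ 2 * (s - t) ^+ 2
    & normc eta ^+ 2 <= 4 * phi ^+ 2 * (s - t) ^+ 2].
    exists (cis (- ((s - t) * phi)) - 1); split.
    - by rewrite {1}(XsE s t) addrAC subrr add0r.
    - have := cis_taylor (- ((s - t) * phi)); rewrite sqrrN exprMn [X in _ <= 2 * X]mulrC mulrA.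
      apply: le_trans; rewrite le_eqVlt; apply/orP; left; apply/eqP; congr normc.
      by apply: complex_ext; rewrite !ReImE /=; ring.
    - have := cis_lip (- ((s - t) * phi)); rewrite normrN normrM => h.
      have <- : (2 * (`|s - t| * `|phi|)) ^+ 2 = 4 * phi ^+ 2 * (s - t) ^+ 2.
        rewrite -[phi ^+ 2]real_normK ?num_real // -[(s - t) ^+ 2]real_normK ?num_real //; ring.
      by rewrite ler_sqr ?nnegrE ?normc_ge0 ?mulr_ge0.
  have as_ := aX _ s01; have at_ := aX _ t01.
  have l1 := lipM_resolvent as_; have l2 := lipM_resolvent at_; have lX := lipM_cst (Xs t).
  have l3 : lipM (fun u => resolvent (Xs t) u * Xs t * resolvent (Xs t) u) := lipMM (lipMM l2 lX) l2.
  have l4 : lipM (fun u => u%:C *: (resolvent (Xs t) u * Xs t * resolvent (Xs t) u * Xs t * resolvent (Xs s) u)).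
    exact: lipMZid (lipMM (lipMM (lipMM (lipMM l2 lX) l2) lX) l1).
  (* One insertion of [resolvent_diff] into [Log_diff] isolates the linear term, whose integral is
     1. *)
  have d : Log (Xs s) - Log (Xs t) = eta *: 1 - eta ^+ 2 *:
      mint (fun u => u%:C *: (resolvent (Xs t) u * Xs t * resolvent (Xs t) u * Xs t * resolvent (Xs s) u)).
    rewrite (Log_diff at_ as_).
    have -> : eta *: 1 = mint (fun u => eta *: (resolvent (Xs t) u * Xs t * resolvent (Xs t) u)).
      by rewrite mintZ // (mint_resolvent_sandwich at_).
    rewrite -scaleNr -(mintZ _ l4) -mintD; [|exact: lipMZ|exact: lipMZ].
    apply: mint_ext => u u01; rewrite eK -scalerAr -scalerAl scaleNr.
    rewrite {1}(resolvent_diff at_ as_ u01) eK mulrBr scalerBr; congr (_ - _).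
    by rewrite -!(scalerAr, scalerAl) !scalerA !mulrA; congr (_ *: _); ring.
  have -> : F s - F t = (eta + 0 +i* ((s - t) * phi)) *: 1 - eta ^+ 2 *:
      mint (fun u => u%:C *: (resolvent (Xs t) u * Xs t * resolvent (Xs t) u * Xs t * resolvent (Xs s) u)).
    rewrite /F opprD addrACA d -[X in _ + (X - _)]scalemx1 -[X in _ + (_ - X)]scalemx1 -scalerBl.
    rewrite addrAC -scalerDl; congr (_ *: _ - _).
    by congr (_ + _); apply: complex_ext; rewrite !ReImE /=; ring.
  apply: le_trans (mnormD _ _) _; rewrite [leRHS]mulrDl; apply: lerD.
    by rewrite mnormZ [leRHS]mulrAC ler_wpM2r ?mnorm_ge0.
  rewrite mnormN mnormZ normcX [leRHS]mulrAC; apply: ler_pM; rewrite ?sqr_ge0 ?mnorm_ge0 //.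
  apply: mint_norm => // u u01; rewrite mnormZ.
  have u1 : normc u%:C <= 1 by move: u01 => /andP[s0 s1]; rewrite normc_real ger0_norm.
  have step A B (p q : RR) : mnorm A <= p -> mnorm B <= q -> mnorm (A * B : 'M[CC]_n.+1) <= p * q.
    by move=> Ap Bq; apply: le_trans (mnormM _ _) _; rewrite ler_pM ?mnorm_ge0.
  have bs := resolvent_norm as_ u01; have bt := resolvent_norm at_ u01.
  have bX : mnorm (Xs t) <= mnorm X by rewrite nXs.
  apply: le_trans (ler_wpM2r (mnorm_ge0 _) u1) _; rewrite mul1r.
  exact: step (step _ _ _ _ (step _ _ _ _ (step _ _ _ _ bt bX) bt) bX) bs.
have c0 : (0 +i* (0 * phi))%:M = 0 :> 'M[CC]_n.+1 by rewrite mul0r -scalemx1 scale0r.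
have c1 : 0 +i* (1 * phi) = 0 +i* phi :> CC by rewrite mul1r.
rewrite /F X1 X0 c0 c1; move: (Log _) (Log _) (_%:M) => l1 l2 m.
by rewrite addr0 => <-; rewrite addrK.
Qed.

End Rotation.

(** * Bounds for the logarithm on sectors *)

Section Sector.
Variable n : nat.
Implicit Types (X C K : 'M[CC]_n.+1) (v : 'cV[CC]_n.+1).

(** Over the complex numbers a real-valued form v^* C v characterises Hermitian matrices; in this
    shape the property combines directly with bounds on imaginary parts. *)
Definition herm C := forall v, Ic (qf C v) = 0.
Definition posdef (c : RR) C := 0 < c /\ forall v, c * vnorm v <= Rc (qf C v).
Definition possemidef C := forall v, 0 <= Rc (qf C v).

Variables (c0 r psi : RR) (C K : 'M[CC]_n.+1).
Hypotheses (hC : herm C) (pC : posdef c0 C) (hK : herm K) (pK : possemidef K).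
Hypotheses (r0 : 0 <= r) (psi_pi : `|psi| < PI).
Let X := C + (r%:C * cis psi) *: K.
Let c := cos (psi / 2) * Num.min 1 c0.

Lemma cos_half_gt0 : 0 < cos (psi / 2).
Proof.
move: psi_pi; rewrite ltr_norml => /andP[h1 h2].
have e : Rdiv PI (IZR 2) = PI / 2 by exact: RdivE.
by apply/RltP; apply: cos_gt_0; apply/RltP; rewrite ?RoppE e; lra.
Qed.

(** The two rotations multiply to e^(-iψ/2) for every s, with ψ = [psi]. This puts C at angle -ψ/2
    and K at ψ/2, both of cosine cos (ψ/2) > 0 since |ψ| < π. The identity is put at angle (s -
    1/2)ψ, which is no farther from 0. *)
Lemma accretive_sector s : in01 s ->
  accretive c (cis (s * psi - psi / 2)) (cis (- (s * psi)) *: X).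
Proof.
move=> /andP[s0 s1]; have [c00 co] := pC; have k0 := cos_half_gt0.
have m0 : 0 < Num.min 1 c0 by rewrite lt_min ltr01.
have m1 : Num.min 1 c0 <= 1 by rewrite ge_min lexx.
have mc : Num.min 1 c0 <= c0 by rewrite ge_min lexx orbT.
split; first by rewrite mulr_gt0.
- by rewrite normc_cis.
- apply: (@le_trans _ _ (cos (psi / 2))); first by rewrite /c ler_piMr // ltW.
  have -> : cos (psi / 2) = cos (`|psi| / 2).
    by case: (ger0P psi) => // _; rewrite mulNr -RoppE cos_neg.
  apply: cos_le_cos; last by have := normr_ge0 psi; move: psi_pi; lra.
  have -> : s * psi - psi / 2 = (s - 1 / 2) * psi by ring.
  by rewrite normrM mulrC ler_wpM2l // ler_norml; apply/andP; split; lra.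
move=> v; rewrite qfZ mulrA -cisD.
have -> : s * psi - psi / 2 + - (s * psi) = - (psi / 2) by ring.
rewrite qfD qfZ mulrDr mulrA [_ * (r%:C * _)]mulrCA -cisD.
have -> : - (psi / 2) + psi = psi / 2 by field.
rewrite -(mulrA r%:C) Rc_add (Rc_mul_real _ (hC v)) Rc_scale (Rc_mul_real _ (hK v)).
have -> : Rc (cis (- (psi / 2))) = cos (psi / 2) by exact: cos_neg.
rewrite /c -mulrA.
have h1 := co v; have h2 := pK v; have h3 := vnorm_ge0 v.
have h4 : Num.min 1 c0 * vnorm v <= Rc (qf C v) by apply: le_trans h1; rewrite ler_wpM2r.
have h5 : cos (psi / 2) * (Num.min 1 c0 * vnorm v) <= cos (psi / 2) * Rc (qf C v) by rewrite ler_wpM2l // ltW.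
apply: le_trans h5 _; rewrite lerDl; exact: mulr_ge0 r0 (mulr_ge0 (ltW k0) h2).
Qed.

Lemma accretive_sector0 : accretive c (cis (- (psi / 2))) X.
Proof.
by have := accretive_sector in010; rewrite !mul0r oppr0 cis0 scale1r add0r.
Qed.

(** The sign [sg] treats sectors above and below the real axis at once. For the second bound,
    e^(-iψ) X = e^(-iψ) C + r K has imaginary part -sin ψ C, of the opposite sign. *)
Lemma sector_Log (sg : RR) : 0 <= sg * sin psi -> forall v,
  0 <= sg * Ic (qf (Log X) v) <= sg * psi * vnorm v.
Proof.
move=> sgs v; have rot : Log (cis (- psi) *: X) = Log X - (0 +i* psi)%:M := Log_rotate accretive_sector.
apply/andP; split.
  apply: (Log_Im_ge0 accretive_sector0) => u; rewrite qfD qfZ Ic_add hC add0r -(mulrA r%:C) Ic_scale.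
  by rewrite Ic_mul hK mulr0 add0r mulrCA mulr_ge0 // mulrA mulr_ge0.
have a1 := accretive_sector in011; rewrite !mul1r in a1.
have : 0 <= - sg * Ic (qf (Log (cis (- psi) *: X)) v).
  apply: (Log_Im_ge0 a1) => u.
  rewrite qfZ qfD qfZ mulrDr mulrA [cis _ * (r%:C * _)]mulrCA -cisD addNr cis0 mulr1.
  rewrite Ic_add Ic_scale hK mulr0 addr0 Ic_mul hC mulr0 add0r /= -RoppE sin_neg RoppE.
  rewrite !mulNr mulrN opprK mulrA mulr_ge0 //.
  by have [c00 co] := pC; apply: le_trans (co u); rewrite mulr_ge0 ?vnorm_ge0 // ltW.
rewrite rot qfD qfN Ic_add Ic_opp.
rewrite -[(_)%:M]scalemx1 qfZ -[qf 1%:M v]/(qf 1 v) qf1 Ic_mul /= mul0r add0r.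
by rewrite mulNr mulrBr opprB subr_ge0 -mulrA.
Qed.

End Sector.

(** * Complex series and the scalar exponential *)

Section ComplexSeries.
Implicit Types (a b : nat -> CC) (x y : CC).

Definition ifact k : RR := (k`!%:R)^-1.

Lemma ifact_ge0 k : 0 <= ifact k. Proof. by rewrite invr_ge0 ler0n. Qed.
Lemma ifactS k : k.+1%:R * ifact k.+1 = ifact k.
Proof.
rewrite /ifact factS natrM invfM mulrA divff ?mul1r //.
by rewrite pnatr_eq0.
Qed.

Lemma ex_series_exp (B : RR) : ex_series (fun k => ifact k * B ^+ k : RR).
Proof.
exists (exp B); have := is_exp_Reals B; apply: is_series_ext => k.
by rewrite /scal /= pow_n_pow /mult /= RpowE INRE factE RinvE RmultE mulrC.
Qed.

Definition summable a := exists2 b : nat -> RR, (forall k, normc (a k) <= b k) & ex_series b.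
Definition csum a : CC := (Series (fun k => Rc (a k))) +i* (Series (fun k => Ic (a k))).

Lemma ex_series_cmp (u v : nat -> RR) : (forall k, `|u k| <= v k) -> ex_series v -> ex_series u.
Proof.
move=> uv; apply: (@ex_series_le _ R_CompleteNormedModule) => k; apply/RleP.
by rewrite /norm /= /abs /= RabsE.
Qed.
Lemma summable_Rc a : summable a -> ex_series (fun k => Rc (a k)).
Proof. by move=> [b ab]; apply: ex_series_cmp => k; apply: le_trans (normr_Rc _) (ab k). Qed.
Lemma summable_Ic a : summable a -> ex_series (fun k => Ic (a k)).
Proof. by move=> [b ab]; apply: ex_series_cmp => k; apply: le_trans (normr_Ic _) (ab k). Qed.

Lemma summable_lin a b x : summable a -> summable b -> summable (fun k => x * a k + b k).
Proof.
move=> [u au su] [v bv sv]; exists (fun k => normc x * u k + v k) => [k|].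
  apply: le_trans (le_normcD _ _) _; rewrite normcM lerD //.
  by rewrite ler_wpM2l ?normc_ge0.
exact: (ex_series_plus _ _ (ex_series_scal (normc x) _ su) sv).
Qed.

Lemma csum_ext a b : (forall k, a k = b k) -> csum a = csum b.
Proof. by move=> ab; congr Complex; apply: Series_ext => k; rewrite ab. Qed.

Lemma Series_lin (u v : nat -> RR) (p q : RR) : ex_series u -> ex_series v ->
  Series (fun k => p * u k + q * v k) = p * Series u + q * Series v.
Proof.
move=> su sv.
rewrite -[p * _](Series_scal_l p u) -[q * _](Series_scal_l q v).
exact: (Series_plus _ _ (ex_series_scal_l p _ su) (ex_series_scal_l q _ sv)).
Qed.
Lemma ex_series_lin (u v : nat -> RR) (p q : RR) : ex_series u -> ex_series v ->
  ex_series (fun k => p * u k + q * v k : RR).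
Proof.
move=> su sv.
exact: (ex_series_plus _ _ (ex_series_scal_l p _ su) (ex_series_scal_l q _ sv)).
Qed.

Lemma csum_lin a b x : summable a -> summable b ->
  csum (fun k => x * a k + b k) = x * csum a + csum b.
Proof.
move=> sa sb; have [a1 a2] := (summable_Rc sa, summable_Ic sa).
have [b1 b2] := (summable_Rc sb, summable_Ic sb).
apply: complex_ext; rewrite !ReImE /=.
- transitivity (Series (fun k => 1 * (Rc x * Rc (a k) + (- Ic x) * Ic (a k)) + 1 * Rc (b k))).
    by apply: Series_ext => k; rewrite !ReImE; ring.
  by rewrite Series_lin ?Series_lin ?mul1r ?mulNr //; exact: ex_series_lin.
- transitivity (Series (fun k => 1 * (Rc x * Ic (a k) + Ic x * Rc (a k)) + 1 * Ic (b k))).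
    by apply: Series_ext => k; rewrite !ReImE; ring.
  by rewrite Series_lin ?Series_lin ?mul1r //; exact: ex_series_lin.
Qed.

Lemma normc_csum a (b : nat -> RR) : (forall k, normc (a k) <= b k) -> ex_series b ->
  normc (csum a) <= 2 * Series b.
Proof.
move=> ab sb; apply: le_trans (normc_le _) _; rewrite /= mulr2n mulrDl mul1r.
have cmp (u : nat -> RR) : (forall k, `|u k| <= b k) -> `|Series u| <= Series b.
  move=> ub; have su : ex_series (fun k => Rabs (u k)).
    by apply: ex_series_cmp sb => k; rewrite RabsE normr_id.
  apply: (@le_trans _ _ (Series (fun k => Rabs (u k)))).
    by apply/RleP; rewrite -RabsE; exact: Series_Rabs.
  apply/RleP; apply: Series_le sb => k; split; first exact: Rabs_pos.
  by apply/RleP; rewrite RabsE.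
by apply: lerD; apply: cmp => k; [apply: le_trans (normr_Rc _) _ | apply: le_trans (normr_Ic _) _].
Qed.

Lemma csum_sum (I : Type) (r : seq I) (F : I -> nat -> CC) : (forall i, summable (F i)) ->
  csum (fun k => \sum_(i <- r) F i k) = \sum_(i <- r) csum (F i).
Proof.
move=> sF; have s0 : summable (fun _ => 0).
  exists (fun _ => 0) => [k|]; first by rewrite normc0.
  have h := ex_series_exp 0; apply: ex_series_ext (ex_series_lin 0 0 h h) => k.
  by rewrite !mul0r addr0.
have sr : summable (fun k => \sum_(i <- r) F i k) /\
    csum (fun k => \sum_(i <- r) F i k) = \sum_(i <- r) csum (F i).
  elim: r => [|i r [IH1 IH2]].
    split; first by have [b b1 b2] := s0; exists b => // k; rewrite big_nil; exact: b1.
    (* By linearity the sum S of the zero series satisfies S = -S + S, hence S = 0. *)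
    rewrite big_nil (@csum_ext _ (fun k => -1 * 0 + 0)) => [|k]; last by rewrite big_nil; ring.
    by rewrite csum_lin // mulN1r addNr.
  split.
    have [b b1 b2] := summable_lin 1 (sF i) IH1; exists b => // k.
    by rewrite big_cons; move: (b1 k); rewrite mul1r.
  rewrite big_cons -IH2 -[csum (F i)]mul1r -csum_lin //.
  by apply: csum_ext => k; rewrite big_cons mul1r.
by case: sr.
Qed.

Definition cexp x : CC := csum (fun k => (ifact k)%:C * x ^+ k).

Lemma normc_ifact k : normc (ifact k)%:C = ifact k.
Proof. by rewrite normc_real ger0_norm ?ifact_ge0. Qed.

Lemma summable_exp x : summable (fun k => (ifact k)%:C * x ^+ k).
Proof.
by exists (fun k => ifact k * normc x ^+ k) => [k|];
  [rewrite normcM normc_ifact normcX | exact: ex_series_exp].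
Qed.

(** Domination by an exponential series puts |t| + 1 in the disc of convergence, so t lies strictly
    inside. *)
Lemma PSeries_derivable (u : nat -> RR) (B t : RR) : (forall k, `|u k| <= ifact k * B ^+ k) ->
  is_derive (PSeries u) t (PSeries (PS_derive u) t).
Proof.
move=> uB; apply: is_derive_PSeries.
have [ub _] := Lub_Rbar_correct (CV_disk u).
apply: (@Rbar_lt_le_trans _ (Rbar.Finite (`|t| + 1))).
  by apply/RltP; rewrite RabsE ltrDl.
apply: ub; apply: ex_series_cmp (ex_series_exp (B * (`|t| + 1))) => k.
rewrite RabsE normr_id RmultE RpowE normrM exprMn mulrA normrX.
by rewrite (@ger0_norm _ (`|t| + 1)) ?ler_wpM2r ?exprn_ge0 ?addr_ge0.
Qed.

Section ExpSolution.
Variable x : CC.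
(** [p] and [q] are the real and imaginary parts of the exponential series at t x, as power series
    in the real variable t. *)
Let p t : RR := PSeries (fun k => ifact k * Rc (x ^+ k)) t.
Let q t : RR := PSeries (fun k => ifact k * Ic (x ^+ k)) t.

Lemma PSeries_lin (u v : nat -> RR) (B a b t : RR) :
  (forall k, `|u k| <= ifact k * B ^+ k) -> (forall k, `|v k| <= ifact k * B ^+ k) ->
  PSeries (fun k => a * u k + b * v k) t = a * PSeries u t + b * PSeries v t.
Proof.
move=> uB vB; have h (w : nat -> RR) : (forall k, `|w k| <= ifact k * B ^+ k) ->
    ex_series (fun k => w k * t ^+ k : RR).
  move=> wB; apply: ex_series_cmp (ex_series_exp (B * `|t|)) => k.
  by rewrite normrM exprMn mulrA normrX ler_wpM2r ?exprn_ge0.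
rewrite /PSeries -Series_lin; last 2 first.
- by apply: ex_series_ext (h _ uB) => k; rewrite RmultE RpowE.
- by apply: ex_series_ext (h _ vB) => k; rewrite RmultE RpowE.
by apply: Series_ext => k; rewrite !RmultE mulrDl !mulrA.
Qed.

Lemma bound_Rc k : `|ifact k * Rc (x ^+ k)| <= ifact k * normc x ^+ k.
Proof. by rewrite normrM ger0_norm ?ifact_ge0 // ler_wpM2l ?ifact_ge0 // -normcX normr_Rc. Qed.
Lemma bound_Ic k : `|ifact k * Ic (x ^+ k)| <= ifact k * normc x ^+ k.
Proof. by rewrite normrM ger0_norm ?ifact_ge0 // ler_wpM2l ?ifact_ge0 // -normcX normr_Ic. Qed.

Lemma derive_p t : is_derive p t (Rc x * p t - Ic x * q t).
Proof.
have := PSeries_derivable t bound_Rc; congr is_derive.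
rewrite -mulNr -(PSeries_lin _ _ _ bound_Rc bound_Ic); apply: PSeries_ext => k.
by rewrite /PS_derive RmultE INRE mulrA ifactS exprS Rc_mul; ring.
Qed.
Lemma derive_q t : is_derive q t (Rc x * q t + Ic x * p t).
Proof.
have := PSeries_derivable t bound_Ic; congr is_derive.
rewrite -(PSeries_lin _ _ _ bound_Ic bound_Rc); apply: PSeries_ext => k.
by rewrite /PS_derive RmultE INRE mulrA ifactS exprS Ic_mul; ring.
Qed.

Lemma cexpE : cexp x = (exp (Rc x))%:C * cis (Ic x).
Proof.
have pq : cexp x = p 1 +i* q 1.
  congr Complex; apply: Series_ext => k; rewrite ?Rc_scale ?Ic_scale RmultE RpowE expr1n mulr1 //.
have p0 : p 0 = 1.
  by rewrite /p PSeries_0 expr0 /ifact fact0 invr1 mul1r.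
have q0 : q 0 = 0.
  by rewrite /q PSeries_0 expr0 mulr0.
have [e1 e2] := linear_ode_spiral _ _ _ _ derive_p derive_q p0 q0.
by rewrite pq e1 e2; apply: complex_ext; rewrite !ReImE /= !mul0r ?subr0 ?addr0.
Qed.
End ExpSolution.
End ComplexSeries.

(** * The trace of the exponential and the eigenvalues *)

Section TraceExponential.
Variable n : nat.
Implicit Types (H P T : 'M[CC]_n.+1) (v : 'cV[CC]_n.+1).

(** The trace is taken term by term, which leaves a scalar series; [etrE] identifies it with the
    trace of the exponential matrix. *)
Definition etr H : CC := csum (fun k => (ifact k)%:C * \tr (H ^+ k)).

Lemma trig_exp T k : is_trig_mx T -> is_trig_mx (T ^+ k) /\ forall i, (T ^+ k) i i = T i i ^+ k.
Proof.
move=> /is_trig_mxP tT; elim: k => [|k [/is_trig_mxP IH1 IH2]].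
  by split=> [|i]; rewrite ?expr0 ?scalar_mx_is_trig // mxE eqxx.
split=> [|i].
  apply/is_trig_mxP => i j ij; rewrite exprS mxE big1 // => l _.
  have [il|li] := ltnP i l; first by rewrite tT // mul0r.
  by rewrite IH1 ?mulr0 // (leq_ltn_trans li).
rewrite exprS mxE (bigD1 i) //= big1 ?addr0 ?IH2 -?exprS // => l li.
have [il|il] := ltnP i l; first by rewrite tT // mul0r.
by rewrite IH1 ?mulr0 // ltn_neqAle il andbT.
Qed.

(** Schur triangularisation applies without normality: the diagonal of T^k holds the kth powers of
    the eigenvalues. A left eigenvector u of T gives v = (u P)^* with v^* H = lam v^*, which places
    the eigenvalue in the numerical range of H. *)
Lemma etr_eigen H : exists lam : 'I_n.+1 -> CC, etr H = \sum_i cexp (lam i) /\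
  forall i, exists2 v, 0 < vnorm v & qf H v = lam i * (vnorm v)%:C.
Proof.
have [P uP] := @Schur CC n.+1 H (ltn0Sn n); rewrite /similar_to conjymx // => tT.
set T := P *m H *m P^t* in tT.
have PP : P *m P^t* = 1%:M by apply/unitarymxP.
have PP' : P^t* *m P = 1%:M by apply: mulmx1C.
have Tk k : T ^+ k = P *m H ^+ k *m P^t*.
  elim: k => [|k IH]; first by rewrite !expr0 mulmx1.
  rewrite !exprS IH /T -[_ * _]/(_ *m _) -[H * _]/(_ *m _) !mulmxA.
  by rewrite -(mulmxA (P *m H)) PP' mulmx1.
exists (fun i => T i i); split.
  rewrite /etr /cexp -csum_sum; last by move=> i; exact: summable_exp.
  apply: csum_ext => k; rewrite -mulr_sumr; congr (_ * _).
  transitivity (\tr (T ^+ k)); first by rewrite Tk mxtrace_mulC mulmxA PP' mul1mx.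
  by apply: eq_bigr => i _; rewrite (trig_exp k tT).2.
move=> i; have : eigenvalue T (T i i).
  rewrite eigenvalue_root_char char_poly_trig // -(big_map (fun i => T i i) xpredT (fun x => 'X - x%:P)).
  by rewrite root_prod_XsubC; apply/mapP; exists i => //; rewrite mem_index_enum.
move=> /eigenvalueP [u uT u0]; exists ((u *m P)^t*).
  rewrite lt_neqAle vnorm_ge0 andbT eq_sym; apply: contraNneq u0 => v0.
  have : ((u *m P)^t*) = 0 by apply: vnorm_eq0; rewrite v0.
  move/(congr1 (fun M => M^t*)); rewrite trmxCK trmx0 map_mx0 => uP0.
  by rewrite -(mulmx1 u) -PP mulmxA uP0 mul0mx.
rewrite /qf -dot_self trmxCK.
have -> : u *m P *m H = T i i *: (u *m P).
  rewrite scalemxAl -uT /T -!mulmxA; congr (_ *m (_ *m _)).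
  by rewrite PP' mulmx1.
by rewrite -scalemxAl mxE.
Qed.

(** An eigenvalue x + iy with y in [θ - π, θ] contributes e^x sin (y - θ) <= 0. *)
Lemma etr_sector H (theta : RR) :
  (forall v, (theta - PI) * vnorm v <= Ic (qf H v) <= theta * vnorm v) ->
  Ic (cis (- theta) * etr H) <= 0.
Proof.
move=> sec; have [lam [-> ev]] := etr_eigen H.
rewrite mulr_sumr Ic_sum; apply: sumr_le0 => i _; have [v v0 e] := ev i.
have /andP[] := sec v; rewrite e [lam i * _]mulrC Ic_scale [_ * Ic _]mulrC !ler_pM2r // => lo hi.
rewrite cexpE mulrCA -cisD Ic_scale /=.
rewrite mulr_ge0_le0 //; first by apply/RleP/Rlt_le/exp_pos.
have sinN (y : RR) : - sin y = sin (- y) by exact: (esym (sin_neg y)).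
rewrite -oppr_ge0 sinN; apply/RleP; apply: sin_ge_0; apply/RleP; rewrite ?R0E; lra.
Qed.

Lemma etr_real H : (forall v, Ic (qf H v) = 0) -> Ic (etr H) = 0 /\ 0 <= Rc (etr H).
Proof.
move=> hH; have [lam [-> ev]] := etr_eigen H; rewrite Ic_sum Rc_sum.
have lamI i : Ic (lam i) = 0.
  have [v v0 e] := ev i; have := hH v; rewrite e [lam i * _]mulrC Ic_scale => /eqP.
  by rewrite mulf_eq0 gt_eqF //= => /eqP.
split; first by rewrite big1 // => i _; rewrite cexpE Ic_scale lamI /= -R0E sin_0 mulr0.
apply: sumr_ge0 => i _; rewrite cexpE Rc_scale lamI /= -R0E cos_0 mulr1.
by apply/RleP/Rlt_le/exp_pos.
Qed.

End TraceExponential.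

(** * Second order expansion of the trace of the exponential *)

Section Jets.
Variable n : nat.
Implicit Types (A H : 'M[CC]_n.+1) (h : CC).

Variables (A0 A1 A2 : 'M[CC]_n.+1) (M rho : RR) (H : CC -> 'M[CC]_n.+1).
Hypotheses (rho0 : 0 < rho) (M0 : 0 <= M).
Hypothesis taylorH : forall h, normc h <= rho -> exists2 R, mnorm R <= M &
  H h = A0 + h *: A1 + h ^+ 2 *: A2 + h ^+ 3 *: R.

(** The coefficients of 1, h and h^2 in (A0 + h A1 + h^2 A2)^k, the factors kept in order. *)
Fixpoint pow_jet k : 'M[CC]_n.+1 * 'M[CC]_n.+1 * 'M[CC]_n.+1 :=
  if k is k'.+1 then let: (J0, J1, J2) := pow_jet k' in
    (J0 * A0, J0 * A1 + J1 * A0, J0 * A2 + J1 * A1 + J2 * A0)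
  else (1, 0, 0).

Let B : RR := mnorm A0 + mnorm A1 * rho + mnorm A2 * rho ^+ 2 + M * rho ^+ 3.
Let N : RR := mnorm (1 : 'M[CC]_n.+1).

Lemma mnorm0 : mnorm (0 : 'M[CC]_n.+1) = 0.
Proof. by rewrite -(scale0r (0 : 'M[CC]_n.+1)) mnormZ normc0 mul0r. Qed.

(* The weighted sum of the norms of the coefficients and of the remainder is
   submultiplicative, so it is at most [N * B ^+ k] for the [k]th power. *)
Lemma pow_jetP k : let: (J0, J1, J2) := pow_jet k in exists r : RR, [/\ 0 <= r,
  forall h, normc h <= rho -> exists2 S, mnorm S <= r &
    H h ^+ k = J0 + h *: J1 + h ^+ 2 *: J2 + h ^+ 3 *: S
  & mnorm J0 + mnorm J1 * rho + mnorm J2 * rho ^+ 2 + r * rho ^+ 3 <= N * B ^+ k].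
Proof.
elim: k => [|k]; rewrite /=.
  exists 0; split=> // [h _|]; last by rewrite !mnorm0 !mul0r !addr0 expr0 mulr1.
  by exists 0; rewrite ?mnorm0 // !scaler0 !addr0.
case: (pow_jet k) => [[J0 J1] J2] [r [r0 IH le]].
have j0 := mnorm_ge0 J0; have j1 := mnorm_ge0 J1; have j2 := mnorm_ge0 J2.
have a0 := mnorm_ge0 A0; have a1 := mnorm_ge0 A1; have a2 := mnorm_ge0 A2.
have rhoP := ltW rho0.
exists ((mnorm J0 * M + mnorm J1 * mnorm A2 + mnorm J2 * mnorm A1 + r * mnorm A0)
  + rho * (mnorm J1 * M + mnorm J2 * mnorm A2 + r * mnorm A1)
  + rho ^+ 2 * (mnorm J2 * M + r * mnorm A2) + rho ^+ 3 * (r * M)); split.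
- by rewrite !addr_ge0 // !mulr_ge0 ?addr_ge0 ?exprn_ge0 // !mulr_ge0.
- move=> h hr; have [R RM eR] := taylorH hr; have [S Sr eS] := IH h hr.
  exists ((J0 * R + J1 * A2 + J2 * A1 + S * A0) + h *: (J1 * R + J2 * A2 + S * A1)
    + h ^+ 2 *: (J2 * R + S * A2) + h ^+ 3 *: (S * R)).
    have mM (P Q : 'M[CC]_n.+1) (p q : RR) : mnorm P <= p -> mnorm Q <= q -> mnorm (P * Q) <= p * q.
      by move=> Ap Bq; apply: le_trans (mnormM _ _) _; rewrite ler_pM ?mnorm_ge0.
    have mD (P Q : 'M[CC]_n.+1) (p q : RR) : mnorm P <= p -> mnorm Q <= q -> mnorm (P + Q) <= p + q.
      by move=> Ap Bq; apply: le_trans (mnormD _ _) _; rewrite lerD.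
    have mZ (x : CC) (P : 'M[CC]_n.+1) (p q : RR) : normc x <= p -> mnorm P <= q -> mnorm (x *: P) <= p * q.
      by move=> xp Pq; rewrite mnormZ ler_pM ?normc_ge0 ?mnorm_ge0.
    have hX i : normc (h ^+ i) <= rho ^+ i by rewrite normcX lerXn2r ?nnegrE ?normc_ge0.
    apply: (mD _ _ _ _ (mD _ _ _ _ (mD _ _ _ _ _ (mZ _ _ _ _ hr _)) (mZ _ _ _ _ (hX 2%N) _)) (mZ _ _ _ _ (hX 3%N) _)).
    - exact: (mD _ _ _ _ (mD _ _ _ _ (mD _ _ _ _ (mM _ _ _ _ (lexx _) RM) (mM _ _ _ _ (lexx _) (lexx _))) (mM _ _ _ _ (lexx _) (lexx _))) (mM _ _ _ _ Sr (lexx _))).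
    - exact: (mD _ _ _ _ (mD _ _ _ _ (mM _ _ _ _ (lexx _) RM) (mM _ _ _ _ (lexx _) (lexx _))) (mM _ _ _ _ Sr (lexx _))).
    - exact: (mD _ _ _ _ (mM _ _ _ _ (lexx _) RM) (mM _ _ _ _ Sr (lexx _))).
    - exact: (mM _ _ _ _ Sr RM).
  rewrite exprSr eS eR !(mulrDl, mulrDr) -!(scalerAl, scalerAr) !scalerDr !scalerA -!exprS -!exprSr -!exprD.
  move: (J0 * A0) (J0 * A1) (J0 * A2) (J0 * R) (J1 * A0) (J1 * A1) (J1 * A2) (J1 * R)
    (J2 * A0) (J2 * A1) (J2 * A2) (J2 * R) (S * A0) (S * A1) (S * A2) (S * R) => *.
  by apply/matrixP => i j; rewrite !mxE; ring.
- rewrite [B ^+ _]exprSr [N * _]mulrA.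
  have B0 : 0 <= B by rewrite !addr_ge0 // !mulr_ge0 ?exprn_ge0.
  apply: le_trans _ (ler_wpM2r B0 le).
  have l0 := mnormM J0 A0.
  have l1 : mnorm (J0 * A1 + J1 * A0) <= mnorm J0 * mnorm A1 + mnorm J1 * mnorm A0.
    by apply: le_trans (mnormD _ _) _; rewrite lerD ?mnormM.
  have l2 : mnorm (J0 * A2 + J1 * A1 + J2 * A0) <=
      mnorm J0 * mnorm A2 + mnorm J1 * mnorm A1 + mnorm J2 * mnorm A0.
    by do 2!(apply: le_trans (mnormD _ _) _; rewrite lerD ?mnormM //).
  have l1' := ler_wpM2r rhoP l1; have l2' := ler_wpM2r (exprn_ge0 2 rhoP) l2.
  have := lerD (lerD l0 l1') l2'; rewrite -(lerD2r (
   ((mnorm J0 * M + mnorm J1 * mnorm A2 + mnorm J2 * mnorm A1 + r * mnorm A0)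
  + rho * (mnorm J1 * M + mnorm J2 * mnorm A2 + r * mnorm A1)
  + rho ^+ 2 * (mnorm J2 * M + r * mnorm A2) + rho ^+ 3 * (r * M)) * rho ^+ 3)) => /le_trans; apply.
  by rewrite le_eqVlt; apply/orP; left; apply/eqP; rewrite /B; ring.
Qed.

(** The bounds N B^k on the weighted norms are summable against 1/k!, so the expansions of the
    powers are added coefficient by coefficient. Division by rho^i recovers the bound for the
    coefficient of h^i; [b] is the case i = 3, that of the remainder. *)
Lemma etr_jet : exists a1 a2 (M' : RR), forall h, normc h <= rho ->
  normc (etr (H h) - (etr A0 + h * a1 + h ^+ 2 * a2)) <= M' * normc h ^+ 3.
Proof.
pose J1 k := (pow_jet k).1.2; pose J2 k := (pow_jet k).2.
have J0E k : (pow_jet k).1.1 = A0 ^+ k.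
  elim: k => [|k IH] //=; case: (pow_jet k) IH => [[J0 J1'] J2'] /= ->.
  by rewrite exprSr.
pose b k : RR := N / rho ^+ 3 * (ifact k * B ^+ k).
have sb : ex_series b := ex_series_scal_l (N / rho ^+ 3) _ (ex_series_exp B).
have trb (c : RR) (G : nat -> 'M[CC]_n.+1) : (forall k, mnorm (G k) * c <= N * B ^+ k) -> 0 < c ->
    summable (fun k => (ifact k)%:C * \tr (G k)).
  move=> Gb c0; exists (fun k => N / c * (ifact k * B ^+ k)) => [k|]; last first.
    exact: ex_series_scal_l (N / c) _ (ex_series_exp B).
  rewrite normcM normc_ifact mulrCA ler_wpM2l ?ifact_ge0 // mulrAC ler_pdivlMr //.
  by apply: le_trans (Gb k); rewrite ler_wpM2r ?mnorm_tr // ltW.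
have bnd k : [/\ mnorm (A0 ^+ k) * 1 <= N * B ^+ k, mnorm (J1 k) * rho <= N * B ^+ k
    & mnorm (J2 k) * rho ^+ 2 <= N * B ^+ k].
  have := pow_jetP k; rewrite /J1 /J2 -J0E; case: (pow_jet k) => [[j0 j1] j2] [r [r0 _]] /=.
  have p0 := mnorm_ge0 j0; have p1 := mulr_ge0 (mnorm_ge0 j1) (ltW rho0).
  have p2 := mulr_ge0 (mnorm_ge0 j2) (exprn_ge0 2 (ltW rho0)).
  have p3 := mulr_ge0 r0 (exprn_ge0 3 (ltW rho0)).
  rewrite mulr1; split; lra.
have s0 := trb 1 _ (fun k => let: And3 x _ _ := bnd k in x) ltr01.
have s1 := trb rho _ (fun k => let: And3 _ x _ := bnd k in x) rho0.
have s2 := trb _ _ (fun k => let: And3 _ _ x := bnd k in x) (exprn_gt0 2 rho0).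
exists (csum (fun k => (ifact k)%:C * \tr (J1 k))), (csum (fun k => (ifact k)%:C * \tr (J2 k))),
  (2 * Series b) => h hr.
have key k : exists2 S, mnorm S * rho ^+ 3 <= N * B ^+ k &
    H h ^+ k = A0 ^+ k + h *: J1 k + h ^+ 2 *: J2 k + h ^+ 3 *: S.
  have := pow_jetP k; rewrite /J1 /J2 -J0E; case: (pow_jet k) => [[j0 j1] j2] [r [r0 e le]] /=.
  have [S Sr eS] := e h hr; exists S => //.
  have p0 := mnorm_ge0 j0; have p1 := mulr_ge0 (mnorm_ge0 j1) (ltW rho0).
  have p2 := mulr_ge0 (mnorm_ge0 j2) (exprn_ge0 2 (ltW rho0)).
  have : mnorm S * rho ^+ 3 <= r * rho ^+ 3 by rewrite ler_wpM2r ?exprn_ge0 // ltW.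
  lra.
pose T k := (ifact k)%:C * \tr (H h ^+ k - A0 ^+ k - h *: J1 k - h ^+ 2 *: J2 k).
have Tb k : normc (T k) <= normc h ^+ 3 * b k.
  rewrite /T; have [S Sb ->] := key k.
  have -> : A0 ^+ k + h *: J1 k + h ^+ 2 *: J2 k + h ^+ 3 *: S - A0 ^+ k - h *: J1 k - h ^+ 2 *: J2 k
    = h ^+ 3 *: S by apply/matrixP => i j; rewrite !mxE; ring.
  rewrite linearZ normcM normc_ifact /= normcM normcX /b mulrCA ler_wpM2l ?exprn_ge0 ?normc_ge0 //.
  rewrite mulrCA ler_wpM2l ?ifact_ge0 // mulrAC ler_pdivlMr ?exprn_gt0 //.
  by apply: le_trans Sb; rewrite ler_wpM2r ?mnorm_tr // exprn_ge0 // ltW.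
have sT : ex_series (fun k => normc h ^+ 3 * b k : RR) := ex_series_scal_l (normc h ^+ 3) _ sb.
have sumT : summable T by exists (fun k => normc h ^+ 3 * b k).
have <- : csum T = etr (H h) - (etr A0 + h * csum (fun k => (ifact k)%:C * \tr (J1 k)) +
    h ^+ 2 * csum (fun k => (ifact k)%:C * \tr (J2 k))).
  have sum01 := summable_lin h s1 s0; have sum012 := summable_lin (h ^+ 2) s2 sum01.
  have sum1T := summable_lin 1 sumT sum012.
  have : csum (fun k => 1 * T k + (h ^+ 2 * ((ifact k)%:C * \tr (J2 k)) +
      (h * ((ifact k)%:C * \tr (J1 k)) + (ifact k)%:C * \tr (A0 ^+ k)))) = etr (H h).
    by apply: csum_ext => k; rewrite /T !mxtraceD !raddfN /= !mxtraceZ; ring.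
  rewrite (csum_lin 1 sumT sum012) (csum_lin _ s2 sum01) (csum_lin _ s1 s0) => <-.
  by rewrite -/(etr A0); move: (csum T) (etr A0) (csum _) (csum _) => *; ring.
apply: le_trans (normc_csum Tb sT) _.
by rewrite (Series_scal_l (normc h ^+ 3) b) mulrCA mulrC.
Qed.

End Jets.

(** * The function of the theorem at complex arguments *)

Section LogExpJet.
Variables (n : nat) (L X1 X2 K1 K2 : 'M[CC]_n.+1).

(** Both terms carry + z, the minus sign of the theorem entering as [- K2] in the place of [K2]; a
    translation of z then changes only X1 and X2. *)
Definition logexp (z : CC) : CC := etr (L + Log (X1 + z *: K1) + Log (X2 + z *: K2)).

Lemma logexp_jet c1 w1 c2 w2 : accretive c1 w1 X1 -> accretive c2 w2 X2 ->
  exists rho : RR, 0 < rho /\ exists a1 a2 (M : RR), forall h, normc h <= rho ->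
    normc (logexp h - (logexp 0 + h * a1 + h ^+ 2 * a2)) <= M * normc h ^+ 3.
Proof.
move=> a1 a2; have c10 : 0 < c1 by case: a1. have c20 : 0 < c2 by case: a2.
(* The radius within which [accretive_perturb] applies; the added 1 avoids a division by zero when K
   = 0. *)
pose rad (c : RR) (K : 'M[CC]_n.+1) := c / 2 / (mnorm K + 1).
have radP c K : 0 < c -> 0 < rad c K.
  by move=> c0; rewrite divr_gt0 ?divr_gt0 // ltr_wpDl ?mnorm_ge0.
have perturb c w X K h : accretive c w X -> normc h <= rad c K -> accretive (c / 2) w (X + h *: K).
  move=> aX hr; have c0 : 0 < c by case: aX.
  apply: accretive_perturb aX _.
  apply: (@le_trans _ _ (normc h * (mnorm K + 1))); first by rewrite ler_wpM2l ?normc_ge0 // lerDl.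
  by rewrite -ler_pdivlMr // ltr_wpDl ?mnorm_ge0.
pose rho := Num.min (rad c1 K1) (rad c2 K2).
have rho0 : 0 < rho by rewrite lt_min !radP.
have [|A1 [A2 [M tA]]] := @Log_taylor _ (c1 / 2) w1 X1 K1 rho (ltW rho0).
  by move=> h hr; apply: perturb a1 _; apply: le_trans hr _; rewrite ge_min lexx.
have [|B1 [B2 [M' tB]]] := @Log_taylor _ (c2 / 2) w2 X2 K2 rho (ltW rho0).
  by move=> h hr; apply: perturb a2 _; apply: le_trans hr _; rewrite ge_min lexx orbT.
exists rho; split=> //.
have h0 : normc 0 <= rho by rewrite normc0 ltW.
have [R0 R0M _] := tA 0 h0; have [S0 S0M _] := tB 0 h0.
have M0 : 0 <= M + M' by rewrite addr_ge0 // ?(le_trans (mnorm_ge0 _) R0M) ?(le_trans (mnorm_ge0 _) S0M).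
have [|x1 [x2 [b jet]]] := @etr_jet n (L + Log X1 + Log X2) (A1 + B1) (A2 + B2) (M + M') rho
  (fun z => L + Log (X1 + z *: K1) + Log (X2 + z *: K2)) rho0 M0.
  move=> h hr; have [R RM ->] := tA h hr; have [S SM ->] := tB h hr; exists (R + S).
    by apply: le_trans (mnormD _ _) _; rewrite lerD.
  move: (Log X1) (Log X2) => *; by apply/matrixP => i j; rewrite !mxE; ring.
exists x1, x2, b => h hr; have := jet h hr.
by rewrite /logexp !scale0r !addr0.
Qed.

End LogExpJet.

From mathcomp Require Import boolp classical_sets set_interval reals topology normedtype derive.
From mathcomp Require Import Rstruct_topology.
Import numFieldNormedType.Exports.
Local Open Scope classical_set_scope.

(** * Minima on rectangles *)

Section BoxMin.
(** Degenerate rectangles are allowed, so that functions of one variable are covered as well. *)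
Lemma box_min (v : RR -> RR -> RR) (a b c d : RR) : a <= b -> c <= d ->
  (forall x y, a <= x <= b -> c <= y <= d -> forall e : RR, 0 < e -> exists2 eta : RR, 0 < eta &
    forall x' y', `|x - x'| < eta -> `|y - y'| < eta -> `|v x y - v x' y'| < e) ->
  exists x y, [/\ a <= x <= b, c <= y <= d &
    forall x' y', a <= x' <= b -> c <= y' <= d -> v x y <= v x' y'].
Proof.
move=> ab cd cont; pose A : set (RR * RR) := `[a, b]%classic `*` `[c, d]%classic.
have A0 : A !=set0 by exists (a, c); split; rewrite /= in_itv /= lexx.
have cA : compact A by apply: compact_setX; exact: segment_compact.
have [|[x y] xyA min] := @compact_EVT_min _ _ (fun p => v p.1 p.2) A A0 cA.
  apply: continuous_in_subspaceT => -[x y]; rewrite inE => -[/= xab ycd].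
  apply/cvgrPdist_lt => e e0; rewrite /= in_itv /= in xab; rewrite /= in_itv /= in ycd.
  have [eta eta0 H] := cont x y xab ycd e e0.
  exists (ball x eta, ball y eta) => [|[x' y'] [/= bx bY]].
    by split; exact: nbhsx_ballx.
  exact: H.
move: xyA; rewrite inE => -[/= xab ycd]; rewrite !in_itv /= in xab ycd.
exists x, y; split=> // => x' y' x'ab y'cd.
by apply: (min (x', y')); rewrite inE; split; rewrite /= in_itv.
Qed.
End BoxMin.

(** * The minimum principle on the upper half-plane *)

Section MinimumPrinciple.
Implicit Types (f g : CC -> CC) (z h : CC).

(** Stands for holomorphy at z: b1 and b2 do not depend on the direction of h, so the second order
    terms cancel over four directions. *)
Definition jet2 g z := exists rho : RR, 0 < rho /\ exists b1 b2 (M : RR), forall h, normc h <= rho ->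
  normc (g (z + h) - (g z + h * b1 + h ^+ 2 * b2)) <= M * normc h ^+ 3.

Lemma jet2_bounds g z : jet2 g z -> exists rho : RR, [/\ 0 < rho, rho <= 1 & exists b1 b2 (M : RR),
  0 <= M /\ forall h, normc h <= rho ->
  normc (g (z + h) - (g z + h * b1 + h ^+ 2 * b2)) <= M * normc h ^+ 3].
Proof.
move=> [rho [rho0 [b1 [b2 [M H]]]]]; exists (Num.min rho 1); split.
- by rewrite lt_min rho0 ltr01.
- by rewrite ge_min lexx orbT.
exists b1, b2, `|M|; split=> // h hr; apply: le_trans (H _ _) _.
  by apply: le_trans hr _; rewrite ge_min lexx.
by rewrite ler_wpM2r ?exprn_ge0 ?normc_ge0 // ler_norm.
Qed.

Lemma jet2_continuous g z : jet2 g z -> forall e : RR, 0 < e -> exists2 eta : RR, 0 < eta &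
  forall h, normc h < eta -> normc (g (z + h) - g z) < e.
Proof.
move=> /jet2_bounds [rho [rho0 rho1 [b1 [b2 [M [M0 H]]]]]] e e0.
pose c := normc b1 + normc b2 + M + 1.
have c0 : 0 < c by rewrite ltr_wpDl // !addr_ge0 ?normc_ge0.
exists (Num.min rho (e / c)) => [|h]; first by rewrite lt_min rho0 divr_gt0.
rewrite lt_min => /andP[/ltW hr he]; have h0 := normc_ge0 h.
have h1 : normc h <= 1 by exact: le_trans hr rho1.
have -> : g (z + h) - g z = (g (z + h) - (g z + h * b1 + h ^+ 2 * b2)) + (h * b1 + h ^+ 2 * b2) by ring.
apply: (@le_lt_trans _ _ (normc h * c)); last by rewrite -ltr_pdivlMr.
apply: le_trans (le_normcD _ _) _.
have n1 : normc (h * b1 + h ^+ 2 * b2) <= normc h * normc b1 + normc h * normc b2.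
  apply: le_trans (le_normcD _ _) _; rewrite !normcM lerD2l.
  by rewrite -mulrA ler_piMl // mulr_ge0 ?normc_ge0.
have n2 : M * normc h ^+ 3 <= normc h * M.
  by rewrite exprS mulrCA ler_wpM2l // ler_piMr // exprn_ile1.
apply: le_trans (lerD (le_trans (H _ hr) n2) n1) _.
by rewrite /c; nra.
Qed.

(** The remainder collects the terms of order 3 and 4 of the product of the two polynomials and the
    products with a remainder; |h| <= 1 absorbs the excess powers. *)
Lemma jet2_mul f g z : jet2 f z -> jet2 g z -> jet2 (fun x => f x * g x) z.
Proof.
move=> /jet2_bounds [r [r0 r1 [f1 [f2 [Mf [Mf0 Hf]]]]]] /jet2_bounds [s [s0 s1 [g1 [g2 [Mg [Mg0 Hg]]]]]].
exists (Num.min r s); rewrite lt_min r0 s0; split=> //.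
pose cf := normc (f z) + normc f1 + normc f2; pose cg := normc (g z) + normc g1 + normc g2.
exists (f z * g1 + f1 * g z), (f z * g2 + f1 * g1 + f2 * g z),
  (normc f1 * normc g2 + normc f2 * normc g1 + normc f2 * normc g2 + cf * Mg + Mf * cg + Mf * Mg) => h.
rewrite le_min => /andP[hr hs]; have h1 : normc h <= 1 := le_trans hr r1.
have h0 := normc_ge0 h.
set F := f z + h * f1 + h ^+ 2 * f2; set G := g z + h * g1 + h ^+ 2 * g2.
set rf := f (z + h) - F; set rg := g (z + h) - G.
have -> : f (z + h) * g (z + h) - (f z * g z + h * (f z * g1 + f1 * g z) +
    h ^+ 2 * (f z * g2 + f1 * g1 + f2 * g z)) =
  h ^+ 3 * (f1 * g2 + f2 * g1 + h * (f2 * g2)) + F * rg + rf * G + rf * rg.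
  by rewrite /rf /rg /F /G; ring.
have bd (a0 a1 a2 : CC) : normc (a0 + h * a1 + h ^+ 2 * a2) <= normc a0 + normc a1 + normc a2.
  apply: le_trans (le_normcD _ _) _; apply: lerD; last first.
    by rewrite normcM normcX ler_piMl ?normc_ge0 // exprn_ile1.
  by apply: le_trans (le_normcD _ _) _; rewrite lerD2l normcM ler_piMl ?normc_ge0.
have h3 : 0 <= normc h ^+ 3 by rewrite exprn_ge0.
have h31 : normc h ^+ 3 <= 1 by rewrite exprn_ile1.
have t1 : normc (h ^+ 3 * (f1 * g2 + f2 * g1 + h * (f2 * g2))) <=
    (normc f1 * normc g2 + normc f2 * normc g1 + normc f2 * normc g2) * normc h ^+ 3.
  rewrite normcM normcX mulrC ler_wpM2r //.
  apply: le_trans (le_normcD _ _) _; apply: lerD.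
    by apply: le_trans (le_normcD _ _) _; rewrite !normcM.
  by rewrite !normcM ler_piMl // mulr_ge0 ?normc_ge0.
have t2 : normc (F * rg) <= cf * Mg * normc h ^+ 3.
  by rewrite normcM -mulrA ler_pM ?normc_ge0 ?bd ?Hg.
have t3 : normc (rf * G) <= Mf * cg * normc h ^+ 3.
  by rewrite normcM mulrAC ler_pM ?normc_ge0 ?bd ?Hf.
have t4 : normc (rf * rg) <= Mf * Mg * normc h ^+ 3.
  rewrite normcM; apply: le_trans (ler_pM (normc_ge0 _) (normc_ge0 _) (Hf _ hr) (Hg _ hs)) _.
  by rewrite mulrACA ler_wpM2l ?mulr_ge0 // ler_piMl.
rewrite [leRHS]mulrDl [X in _ <= X + _]mulrDl [X in _ <= X + _ + _]mulrDl.
apply: le_trans (le_normcD _ _) _; apply: lerD t4.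
apply: le_trans (le_normcD _ _) _; apply: lerD t3.
by apply: le_trans (le_normcD _ _) _; apply: lerD t2.
Qed.

Lemma jet2_cst a z : jet2 (fun _ => a) z.
Proof.
exists 1; split=> //; exists 0, 0, 0 => h _.
by rewrite !mulr0 !addr0 subrr normc0 mul0r.
Qed.

Lemma jet2_inv z : z != 0 -> jet2 (fun x => x^-1) z.
Proof.
move=> z0; have nz : 0 < normc z by rewrite lt_neqAle eq_sym normc_eq0 z0 normc_ge0.
exists (normc z / 2); rewrite divr_gt0 //; split=> //.
(* The remainder is exactly -h^3 / (z^3 (z + h)), and |h| <= |z| / 2 gives |z + h| >= |z| / 2,
   whence the constant. *)
exists (- z ^- 2), (z ^- 3), (2 / normc z ^+ 4) => h hr.
have zh : normc z / 2 <= normc (z + h).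
  have : normc z <= normc (z + h) + normc h.
    by rewrite -[X in normc X](addrK h z) -(normcN h) le_normcD.
  by move: hr; lra.
have zh0 : 0 < normc (z + h) by apply: lt_le_trans zh; rewrite divr_gt0.
have nz0 : z + h != 0 by rewrite -normc_eq0 gt_eqF.
have -> : (z + h)^-1 - (z^-1 + h * - z ^- 2 + h ^+ 2 * z ^- 3) = - h ^+ 3 * (z ^- 3 * (z + h)^-1).
  by field; rewrite nz0 z0.
rewrite normcM normcN normcX normcM !normcV normcX mulrC ler_wpM2r ?exprn_ge0 ?normc_ge0 //.
have -> : 2 / normc z ^+ 4 = (normc z ^+ 3)^-1 * (normc z / 2)^-1 by field; rewrite gt_eqF.
by rewrite ler_wpM2l ?invr_ge0 ?exprn_ge0 ?normc_ge0 // lef_pV2 // posrE divr_gt0.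
Qed.

(* Summing over [h = t, -t, i t, -i t] cancels the terms of order 1 and 2 of the
   expansion of [g], which is the discrete form of the harmonicity of [Ic \o g]. *)
Lemma laplace_min g z (eps : RR) : jet2 g z -> 0 < eps ->
  ~ (exists t0 : RR, 0 < t0 /\ forall h, normc h <= t0 ->
      Ic (g z) - eps * Rc z ^+ 2 <= Ic (g (z + h)) - eps * Rc (z + h) ^+ 2).
Proof.
move=> /jet2_bounds [rho [rho0 _ [b1 [b2 [M [M0 H]]]]]] eps0 [t0 [t00 min]].
have d0 : 0 < eps / (2 * M + 1) by rewrite divr_gt0 // ltr_wpDl // mulr_ge0.
pose t := Num.min (Num.min rho t0) (eps / (2 * M + 1)).
have tp : 0 < t by rewrite !lt_min rho0 t00 d0.
have [tr tt te] : [/\ t <= rho, t <= t0 & t <= eps / (2 * M + 1)].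
  by rewrite /t !ge_min !lexx !orbT; split=> //; rewrite ge_min lexx ?orbT.
have bnd h : normc h = t -> Ic (g z) - eps * Rc z ^+ 2 <=
    Ic (g z) + Ic (h * b1 + h ^+ 2 * b2) + M * t ^+ 3 - eps * (Rc z + Rc h) ^+ 2.
  move=> ht; have := min h; rewrite ht => /(_ tt) => le; apply: le_trans le _.
  rewrite Rc_add lerD2r.
  have := H h; rewrite ht => /(_ tr) Hh; have := le_trans (Ic_le _) Hh.
  by rewrite !ReImE; lra.
have nr : normc t%:C = t by rewrite normc_real gtr0_norm.
have ni : normc (0 +i* t) = t by rewrite /= expr0n /= add0r sqrtr_sqr gtr0_norm.
have h1 := bnd _ nr; have h2 := bnd (- t%:C) (etrans (normcN _) nr).
have h3 := bnd _ ni; have h4 := bnd (- (0 +i* t)) (etrans (normcN _) ni).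
have te' : 2 * M * t < eps.
  rewrite ler_pdivlMr in te; last by rewrite ltr_wpDl // mulr_ge0.
  by apply: lt_le_trans te; rewrite mulrC ltr_pM2l // ltrDl.
have t2 : 0 < t ^+ 2 by rewrite exprn_gt0.
have key : 2 * eps * t ^+ 2 <= 4 * M * t ^+ 3.
  have := lerD (lerD h1 h2) (lerD h3 h4); rewrite !expr2 !ReImE /=.
  by lra.
have : eps * t ^+ 2 <= (2 * M * t) * t ^+ 2 by move: key; rewrite [t ^+ 3]exprS; lra.
by rewrite ler_pM2r // leNgt te'.
Qed.

(** The second hypothesis replaces boundary values: it confines the points where Im g <= -η to a
    bounded region away from the real axis. A negative value would give Im g - eps x^2 an interior
    minimum on a rectangle, against [laplace_min]. *)
Lemma min_principle g : (forall z, 0 < Ic z -> jet2 g z) ->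
  (forall eta : RR, 0 < eta -> exists R delta : RR, 0 < delta /\ forall z, 0 < Ic z -> Ic (g z) <= - eta ->
     [/\ `|Rc z| < R, delta < Ic z & Ic z < R]) ->
  forall z, 0 < Ic z -> 0 <= Ic (g z).
Proof.
move=> jets bdry z z0; rewrite leNgt; apply/negP => neg.
pose eta : RR := - Ic (g z) / 2; have eta0 : 0 < eta by rewrite divr_gt0 // oppr_gt0.
have etaE : Ic (g z) = - (2 * eta) by rewrite /eta; field.
have [R [delta [d0 box]]] := bdry _ eta0.
have [zR dz zR'] : [/\ `|Rc z| < R, delta < Ic z & Ic z < R].
  by apply: box => //; rewrite etaE; lra.
have R0 : 0 < R by apply: le_lt_trans zR.
(* On the rectangle eps x^2 is at most η, so Im g is still at most -η at a minimiser of the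
   perturbed function, whose minimum is at most -2η. *)
pose eps := eta / R ^+ 2; have eps0 : 0 < eps by rewrite divr_gt0 // exprn_gt0.
have epsR (x : RR) : `|x| <= R -> eps * x ^+ 2 <= eta.
  move=> xR; rewrite /eps mulrAC ler_pdivrMr ?exprn_gt0 // ler_wpM2l ?(ltW eta0) //.
  by rewrite -[x ^+ 2]real_normK ?num_real // lerXn2r ?nnegrE // ltW.
pose v (x y : RR) := Ic (g (x +i* y)) - eps * x ^+ 2.
have [||x y xR yd e e0|x [y [xR yd min]]] := @box_min v (- R) R delta R; try lra.
  have y0 : 0 < y by case/andP: yd => yd _; exact: lt_le_trans yd.
  have e2 : 0 < e / 2 by rewrite divr_gt0.
  have [r1 r10 H1] := jet2_continuous (jets (x +i* y) y0) e2.
  have c0 : 0 < eps * (2 * `|x| + 1) by rewrite mulr_gt0 // ltr_wpDl // mulr_ge0.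
  exists (Num.min (r1 / 2) (Num.min 1 (e / 2 / (eps * (2 * `|x| + 1))))).
    by rewrite !lt_min ltr01 !divr_gt0.
  move=> x' y'; rewrite !lt_min => /andP[x1 /andP[x2 x3]] /andP[y1 _].
  have -> : v x y - v x' y' = (Ic (g (x +i* y)) - Ic (g (x' +i* y'))) + eps * (x' ^+ 2 - x ^+ 2).
    by rewrite /v; ring.
  apply: le_lt_trans (ler_normD _ _) _; rewrite [e]splitr; apply: ltrD.
    have -> : x' +i* y' = x +i* y + (x' - x) +i* (y' - y) by apply: complex_ext; rewrite !ReImE /=; ring.
    rewrite distrC -Ic_opp -Ic_add; apply: le_lt_trans (normr_Ic _) _; apply: H1.
    apply: le_lt_trans (normc_le _) _; rewrite /= [`|x' - _|]distrC [`|y' - _|]distrC; lra.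
  rewrite normrM (gtr0_norm eps0) subr_sqr normrM distrC.
  have xx : `|x' + x| <= 2 * `|x| + 1.
    have -> : x' + x = 2 * x - (x - x') by ring.
    apply: le_trans (ler_normB _ _) _; rewrite normrM ger0_norm // lerD2l ltW //.
  rewrite ltr_pdivlMr // in x3; apply: le_lt_trans x3; rewrite mulrCA.
  by rewrite ler_wpM2l // ler_wpM2l // ltW.
have xz : - R <= Rc z <= R by move: zR; rewrite ltr_norml => /andP[? ?]; apply/andP; split; lra.
have yz : delta <= Ic z <= R by rewrite !ltW.
have y0 : 0 < y by case/andP: yd => yd _; exact: lt_le_trans yd.
have vz := min _ _ xz yz.
have low : Ic (g (x +i* y)) <= - eta.
  have zE : Rc z +i* Ic z = z by case: (z).
  move: vz; rewrite /v zE etaE.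
  have := epsR x; rewrite ler_norml xR => /(_ isT).
  have : 0 <= eps * Rc z ^+ 2 by rewrite mulr_ge0 ?sqr_ge0 // ltW.
  lra.
(* The confinement hypothesis, applied now at the minimiser, keeps it off the boundary of the
   rectangle. *)
have [bx by1 by2] := box (x +i* y) y0 low; rewrite /= in bx by1 by2.
have [bx1 bx2] : - R < x /\ x < R by move: bx; rewrite ltr_norml => /andP.
apply (@laplace_min g (x +i* y) eps (jets (x +i* y) y0) eps0).
exists (Num.min (Num.min (x + R) (R - x)) (Num.min (y - delta) (R - y))); split.
  by rewrite !lt_min; apply/andP; split; apply/andP; split; lra.
move=> h; rewrite !le_min => /andP[/andP[h1 h2] /andP[h3 h4]].
have := normr_Rc h; have := normr_Ic h; rewrite !ler_norml => /andP[i1 i2] /andP[r1 r2].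
have := min (x + Rc h) (y + Ic h); rewrite /v.
have -> : (x + Rc h) +i* (y + Ic h) = x +i* y + h by apply: complex_ext; rewrite !ReImE.
rewrite Rc_add /=; apply; apply/andP; split; lra.
Qed.

End MinimumPrinciple.

(** * The difference quotient at 0 on the upper half-plane *)

Lemma small_multiples_le0 (a b rho : RR) : 0 < rho -> (forall t, 0 < t <= rho -> a <= t * b) -> a <= 0.
Proof.
move=> rho0 H; rewrite leNgt; apply/negP => a0.
have b0 : 0 < b by rewrite -(pmulr_rgt0 b rho0); apply: lt_le_trans a0 (H _ _); rewrite rho0 lexx.
have := H (Num.min rho (a / (2 * b))); rewrite lt_min rho0 ge_min lexx divr_gt0 ?mulr_gt0 // => /(_ isT).
have : Num.min rho (a / (2 * b)) * b <= a / 2.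
  have -> : a / 2 = a / (2 * b) * b by field; rewrite gt_eqF.
  by rewrite ler_pM2r // ge_min lexx orbT.
lra.
Qed.

Lemma invc_conj (z : CC) : z != 0 -> z^-1 = ((normc z ^+ 2)^-1)%:C * z^*.
Proof.
move=> z0; have nz : normc z != 0 by rewrite normc_eq0.
apply: (mulIf z0); rewrite mulVf // -mulrA mulc_conj -rmorphM mulVf ?rmorph1 //.
by rewrite expf_neq0.
Qed.

Section Pick.
Variables (f : CC -> CC) (f0 M rho : RR) (a1 a2 : CC).
Hypotheses (f00 : 0 <= f0) (fE : f 0 = f0%:C) (rho0 : 0 < rho).
Hypothesis jets : forall z, 0 < Ic z -> jet2 f z.
Hypothesis sect : forall z, 0 < Ic z -> Ic (f z * z^*) <= 0.
Hypothesis jet0 : forall h, normc h <= rho ->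
  normc (f h - (f 0 + h * a1 + h ^+ 2 * a2)) <= M * normc h ^+ 3.
Hypothesis realf : forall x : RR, `|x| <= rho -> Ic (f x%:C) = 0.

Let g z := (f0%:C - f z) * z^-1.

Lemma Ic_gt0_neq0 (z : CC) : 0 < Ic z -> z != 0.
Proof. by apply: contraTneq => ->; rewrite ltxx. Qed.

Lemma pick_quotient_lower z : 0 < Ic z -> - (f0 * Ic z / normc z ^+ 2) <= Ic (g z).
Proof.
move=> z0; have zn := Ic_gt0_neq0 z0; rewrite /g (invc_conj zn) mulrCA Ic_scale.
rewrite [_ / _]mulrC -mulrN ler_wpM2l ?invr_ge0 ?sqr_ge0 // mulrBl Ic_add Ic_opp Ic_scale Ic_conj mulrN.
by rewrite lerDl oppr_ge0 sect.
Qed.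

(** At real t the imaginary part of the expansion is t Im a1 + O(t^2) and vanishes up to O(t^3). The
    limit -a1 of g at 0 is therefore real. *)
Lemma derivative_real : Ic a1 = 0.
Proof.
apply/eqP; rewrite -normr_le0; apply: (@small_multiples_le0 _ (normc a2 + `|M| * rho) rho rho0).
move=> t /andP[t0 tr]; have nt : normc t%:C = t by rewrite normc_real gtr0_norm.
have := jet0 (h := t%:C); rewrite nt => /(_ tr) H.
have := le_trans (normr_Ic _) H; rewrite Ic_add Ic_opp !Ic_add fE /= Ic_scale.
rewrite realf ?(gtr0_norm t0) // sub0r add0r normrN => H1.
have e : t * Ic a1 = (t * Ic a1 + Ic (t%:C ^+ 2 * a2)) - Ic (t%:C ^+ 2 * a2) by ring.
have H2 : `|t * Ic a1| <= M * t ^+ 3 + t ^+ 2 * normc a2.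
  rewrite e; apply: le_trans (ler_normB _ _) _; apply: lerD H1 _.
  by apply: le_trans (normr_Ic _) _; rewrite normcM normcX nt.
rewrite -(ler_pM2l t0) -{1}(gtr0_norm t0) -normrM; apply: le_trans H2 _.
have M1 : M * t ^+ 3 <= `|M| * rho * t ^+ 2.
  rewrite exprS mulrA ler_wpM2r ?exprn_ge0 ?(ltW t0) //.
  apply: le_trans (ler_wpM2r (ltW t0) (ler_norm M)) _.
  by rewrite ler_wpM2l.
have -> : t * (t * (normc a2 + `|M| * rho)) = `|M| * rho * t ^+ 2 + t ^+ 2 * normc a2 by ring.
by rewrite lerD2r.
Qed.

Lemma pick_quotient_near0 z : z != 0 -> normc z <= rho ->
  normc (g z + a1 + z * a2) <= `|M| * normc z ^+ 2.
Proof.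
move=> z0 zr; have nz : 0 < normc z by rewrite lt_neqAle eq_sym normc_eq0 z0 normc_ge0.
have := jet0 zr; rewrite fE => H.
have -> : g z + a1 + z * a2 = - (f z - (f0%:C + z * a1 + z ^+ 2 * a2)) * z^-1 by rewrite /g; field.
rewrite normcM normcN normcV ler_pdivrMr //.
have -> : `|M| * normc z ^+ 2 * normc z = `|M| * normc z ^+ 3 by ring.
apply: le_trans H _.
by rewrite ler_wpM2r ?exprn_ge0 ?normc_ge0 // ler_norm.
Qed.

Lemma pick_quotient_ge0 z : 0 < Ic z -> 0 <= Ic (g z).
Proof.
apply: min_principle => {z} [z z0|eta eta0].
  apply: jet2_mul (jet2_inv (Ic_gt0_neq0 z0)).
  have := jet2_mul (jet2_cst (-1) z) (jets z0).
  move=> [r [r0 [b1 [b2 [m H]]]]]; exists r; split=> //; exists b1, b2, m => h hr.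
  apply: le_trans (H h hr); rewrite le_eqVlt; apply/orP; left; apply/eqP; congr normc; ring.
(* Near 0 one has |Im g(z)| <= c |z|, so a value at most -η forces |z| >= [r0]. *)
pose c := normc a2 + `|M| * rho + 1.
have c0 : 0 < c by rewrite ltr_wpDl // addr_ge0 ?normc_ge0 // mulr_ge0 // ltW.
pose r0 := Num.min rho (eta / (2 * c)).
have r00 : 0 < r0 by rewrite lt_min rho0 divr_gt0 // mulr_gt0.
(* With [pick_quotient_lower], Im g <= -η becomes η |z|^2 <= f0 Im z. Together with |z| >= r0 this
   keeps Im z above [delta], and together with Im z <= |z| it gives |z| <= f0 / η. The added 1 and
   the factor 2 yield strict inequalities and avoid a division by f0. *)
pose delta := eta * r0 ^+ 2 / (2 * (f0 + 1)).
have f1 : 0 < f0 + 1 by rewrite ltr_wpDl.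
exists (f0 / eta + 1), delta; split; first by rewrite !divr_gt0 ?mulr_gt0 ?exprn_gt0.
move=> z z0 gz; have zn := Ic_gt0_neq0 z0.
have nz : 0 < normc z by rewrite lt_neqAle eq_sym normc_eq0 zn normc_ge0.
have low := le_trans (pick_quotient_lower z0) gz; rewrite lerN2 in low.
have zr0 : r0 <= normc z.
  rewrite leNgt; apply/negP; rewrite lt_min => /andP[/ltW zr zc].
  have near := le_trans (normr_Ic _) (pick_quotient_near0 zn zr).
  move: near; rewrite !Ic_add derivative_real addr0 ler_norml => /andP[n1 n2].
  have n3 : `|Ic (z * a2)| <= normc z * normc a2 by rewrite -normcM normr_Ic.
  move: n3; rewrite ler_norml => /andP[n3 n4].
  have n5 : `|M| * normc z ^+ 2 <= normc z * (`|M| * rho).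
    by rewrite expr2 mulrCA ler_wpM2l ?normc_ge0 // ler_wpM2l.
  have n6 : normc z * c < eta.
    rewrite ltr_pdivlMr ?mulr_gt0 // in zc.
    have := mulr_gt0 nz c0; lra.
  have : eta <= normc z * normc a2 + normc z * (`|M| * rho) by lra.
  by rewrite leNgt; move: n6; rewrite /c !mulrDr mulr1 => ?; apply/negP/negPn; lra.
have yz : Ic z <= normc z := Ic_le z.
rewrite ler_pdivlMr ?exprn_gt0 // in low.
have zR : normc z < f0 / eta + 1.
  have : eta * normc z <= f0.
    rewrite -(ler_pM2r nz) -mulrA -expr2; apply: le_trans low _.
    by rewrite ler_wpM2l.
  rewrite mulrC -ler_pdivlMr // => h; apply: le_lt_trans h _; rewrite ltrDl //.
split; first exact: le_lt_trans (normr_Rc z) zR.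
  rewrite /delta ltr_pdivrMr ?mulr_gt0 //.
  have : eta * r0 ^+ 2 <= f0 * Ic z.
    apply: le_trans low; rewrite ler_wpM2l ?(ltW eta0) // lerXn2r ?nnegrE ?(ltW r00) ?(ltW nz) //.
  have := mulr_ge0 f00 (ltW z0); lra.
exact: le_lt_trans yz zR.
Qed.

(** [a2] is half of f''(0). At z = it one has Im (z a2) = t Re a2, and Im g >= 0 leaves t Re a2 <=
    |M| t^2. *)
Lemma pick_second_order : Rc a2 <= 0.
Proof.
apply: (@small_multiples_le0 _ `|M| rho rho0) => t /andP[t0 tr].
pose z : CC := 0 +i* t; have z0 : 0 < Ic z by [].
have nz : normc z = t by rewrite /= expr0n /= add0r sqrtr_sqr gtr0_norm.
have := pick_quotient_near0 (Ic_gt0_neq0 z0); rewrite nz => /(_ tr) H.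
have := le_trans (Ic_le _) H; rewrite !Ic_add derivative_real addr0 (Ic_mul z a2) /= mul0r add0r.
have := pick_quotient_ge0 z0; move: (Ic (g z)) => u u0 le.
rewrite -(ler_pM2l t0); have -> : t * (t * `|M|) = `|M| * t ^+ 2 by ring.
by move: le; lra.
Qed.

End Pick.

(** * Application to the two pencils *)

Lemma sector_sum (i j v t : RR) : 0 <= i -> i <= t * v -> 0 <= -1 * j ->
  -1 * j <= -1 * (t - PI) * v -> (t - PI) * v <= i + j <= t * v.
Proof. by move=> *; apply/andP; split; lra. Qed.

Lemma taylor_upper (y y0 p q m : RR) : y - (y0 + p + q) <= m -> q <= 0 -> y <= y0 + p + m.
Proof. by move=> *; lra. Qed.

Section Pencil.
Variables (n : nat) (L C1 C2 K1 K2 : 'M[CC]_n.+1) (c1 c2 : RR).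
Hypotheses (hL : herm L) (hC1 : herm C1) (hC2 : herm C2) (hK1 : herm K1) (hK2 : herm K2).
Hypotheses (pC1 : posdef c1 C1) (pC2 : posdef c2 C2) (pK1 : possemidef K1) (pK2 : possemidef K2).

Let f := logexp L C1 C2 K1 (- K2).

Lemma posdef_accretive (c : RR) (C : 'M[CC]_n.+1) : posdef c C -> accretive (Num.min 1 c) 1 C.
Proof.
move=> [c0 co]; split; rewrite ?lt_min ?ltr01 ?normc1 //= ?ge_min ?lexx // => v.
by rewrite mul1r; apply: le_trans (co v); rewrite ler_wpM2r ?vnorm_ge0 // ge_min lexx orbT.
Qed.

Lemma herm_pencil (C K : 'M[CC]_n.+1) (x : RR) : herm C -> herm K -> herm (C + x%:C *: K).
Proof. by move=> hC hK v; rewrite qfD qfZ Ic_add Ic_scale hC hK mulr0 addr0. Qed.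

Lemma Log_herm c w (X : 'M[CC]_n.+1) : accretive c w X -> herm X -> herm (Log X).
Proof.
move=> aX hX v; apply/eqP; rewrite eq_le.
have := @Log_Im_ge0 _ _ _ _ aX 1; have := @Log_Im_ge0 _ _ _ _ aX (-1).
move=> H1 H2; have {}H1 : 0 <= -1 * Ic (qf (Log X) v) by apply: H1 => u; rewrite hX mulr0.
have {}H2 : 0 <= 1 * Ic (qf (Log X) v) by apply: H2 => u; rewrite hX mulr0.
by apply/andP; split; lra.
Qed.

Lemma upper_half_polar (z : CC) : 0 < Ic z -> exists r theta : RR,
  [/\ 0 < r, 0 < theta, theta < PI & z = r%:C * cis theta].
Proof.
move=> z0; have nz : 0 < normc z by rewrite lt_neqAle eq_sym normc_eq0 Ic_gt0_neq0 ?normc_ge0.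
pose u := Rc z / normc z; have u1 : `|u| <= 1.
  by rewrite normrM normfV (gtr0_norm nz) ler_pdivrMr // mul1r normr_Rc.
have [/RleP t0 /RleP tp] := acos_bound u.
have cu : cos (acos u) = u.
  by move: u1; rewrite ler_norml => /andP[/RleP h1 /RleP h2]; apply: cos_acos.
have s0 : 0 <= sin (acos u) by apply/RleP; apply: sin_ge_0; apply/RleP.
have su : sin (acos u) = Ic z / normc z.
  apply/eqP; rewrite -(@eqrXn2 _ 2) //; last by rewrite divr_ge0 // ltW.
  have := sin2_cos2 (acos u); rewrite /Rsqr RplusE !RmultE cu -!expr2 => /(canRL (addrK _)) ->.
  have -> : (Ic z / normc z) ^+ 2 = (normc z ^+ 2 - Rc z ^+ 2) / normc z ^+ 2.
    by rewrite normc_sqr [_ + Ic z ^+ 2 - _]addrAC subrr add0r -normc_sqr expr_div_n.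
  by rewrite /u expr_div_n mulrBl divff // expf_neq0 // gt_eqF.
have sp : 0 < sin (acos u) by rewrite su divr_gt0.
exists (normc z), (acos u); split=> //.
- rewrite lt_neqAle t0 andbT; apply: contraTneq sp => <-.
  by rewrite -R0E sin_0 ltxx.
- rewrite lt_neqAle tp andbT; apply: contraTneq sp => ->.
  by rewrite sin_PI ltxx.
by apply: complex_ext; rewrite ?Rc_scale ?Ic_scale /= ?cu ?su mulrC divfK // gt_eqF.
Qed.

Lemma logexp_upper z : 0 < Ic z ->
  [/\ jet2 f z & Ic (f z * z^*) <= 0].
Proof.
move=> z0; have [r [theta [r0 t0 tp zE]]] := upper_half_polar z0.
have at_ : `|theta| < PI by rewrite gtr0_norm.
have atp : `|theta - PI| < PI by rewrite ltr0_norm ?subr_lt0 //; lra.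
(* The minus sign becomes a rotation by -π: K2 stays semidefinite and the second matrix belongs to
   the sector of angle θ - π in (-π, 0). *)
have zN : z *: - K2 = (r%:C * cis (theta - PI)) *: K2.
  by rewrite cisBpi mulrN -zE scalerN scaleNr.
have a1 := accretive_sector0 hC1 pC1 hK1 pK1 (ltW r0) at_.
have a2 := accretive_sector0 hC2 pC2 hK2 pK2 (ltW r0) atp.
split.
  rewrite -zE in a1; rewrite -zN in a2.
  have [rho [rho0 [b1 [b2 [M H]]]]] := logexp_jet L K1 (- K2) a1 a2.
  exists rho; split=> //; exists b1, b2, M => h hr; move: (H h hr).
  by rewrite /f /logexp !scale0r !addr0 !scalerDl !addrA.
have s1 := sector_Log hC1 pC1 hK1 pK1 (ltW r0) at_ (sg := 1).
have s2 := sector_Log hC2 pC2 hK2 pK2 (ltW r0) atp (sg := -1).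
have sp : 0 <= sin theta by apply/RleP; apply: sin_ge_0; apply/RleP; rewrite ltW.
have := @etr_sector n (L + Log (C1 + z *: K1) + Log (C2 + z *: - K2)) theta.
rewrite -/(logexp L C1 C2 K1 (- K2) z) -/f.
(* Multiplication by the conjugate of z is a rotation by -θ up to the factor r > 0, the form treated
   by [etr_sector]. *)
have -> : f z * z^* = r%:C * (cis (- theta) * f z).
  rewrite zE mulrC rmorphM -mulrA; congr (_ * _); first by apply: complex_ext; rewrite /= ?oppr0.
  by congr (_ * _); apply: complex_ext; rewrite /= -RoppE ?cos_neg ?sin_neg.
rewrite Ic_scale => H; rewrite pmulr_rle0 //; apply: H => v.
rewrite zN zE !qfD !Ic_add hL add0r.
have {}s1 := s1 _ v; rewrite !mul1r in s1; have /andP[l1 u1] := s1 sp.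
have {}s2 := s2 _ v; have /andP[l2 u2] : 0 <= -1 * Ic (qf (Log (C2 + (r%:C * cis (theta - PI)) *: K2)) v)
    <= -1 * (theta - PI) * vnorm v.
  by apply: s2; rewrite (congr1 Ic (cisBpi theta) : sin _ = - sin _) mulN1r opprK.
exact: sector_sum l1 u1 l2 u2.
Qed.

Lemma logexp_real : exists2 rho : RR, 0 < rho & forall x : RR, `|x| <= rho ->
  Ic (f x%:C) = 0 /\ 0 <= Rc (f x%:C).
Proof.
pose rad (c : RR) (K : 'M[CC]_n.+1) := Num.min 1 c / 2 / (mnorm K + 1).
have k1 (K : 'M[CC]_n.+1) : 0 < mnorm K + 1 by rewrite ltr_wpDl ?mnorm_ge0.
have rad0 (c : RR) (C K : 'M[CC]_n.+1) : posdef c C -> 0 < rad c K.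
  move=> [c0 _]; rewrite /rad; apply: divr_gt0 (k1 K); apply: divr_gt0 => //.
  by rewrite lt_min ltr01.
have perturb (c : RR) (C K : 'M[CC]_n.+1) (x : RR) : posdef c C -> `|x| <= rad c K ->
    accretive (Num.min 1 c / 2) 1 (C + x%:C *: K).
  move=> pC xr; apply: accretive_perturb (posdef_accretive pC) _.
  rewrite normc_real; apply: (@le_trans _ _ (`|x| * (mnorm K + 1))).
    by rewrite ler_wpM2l // lerDl.
  by rewrite -ler_pdivlMr.
exists (Num.min (rad c1 K1) (rad c2 (- K2))).
  by rewrite lt_min; apply/andP; split; [exact: rad0 pC1 | exact: rad0 pC2].
move=> x; rewrite le_min => /andP[x1 x2]; apply: etr_real => v.
have hN : herm (- K2) by move=> u; rewrite qfN Ic_opp hK2 oppr0.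
have q1 := Log_herm (perturb c1 C1 K1 x pC1 x1) (herm_pencil x hC1 hK1).
have q2 := Log_herm (perturb c2 C2 (- K2) x pC2 x2) (herm_pencil x hC2 hN).
by rewrite qfD Ic_add q2 qfD Ic_add q1 hL !addr0.
Qed.

(** The quadratic term is dropped because Re a2 <= 0. The linear term that remains will cancel
    between h and -h. *)
Lemma logexp_second_difference : exists rho : RR, 0 < rho /\ exists M a : RR, forall x : RR, `|x| <= rho ->
  Rc (f x%:C) <= Rc (f 0) + x * a + M * `|x| ^+ 3.
Proof.
have [rho1 [rho10 [a1 [a2 [M H]]]]] := logexp_jet L K1 (- K2) (posdef_accretive pC1) (posdef_accretive pC2).
have [rho2 rho20 real] := logexp_real.
pose rho := Num.min rho1 rho2; have rho0 : 0 < rho by rewrite lt_min rho10.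
have h1 h : normc h <= rho -> normc (f h - (f 0 + h * a1 + h ^+ 2 * a2)) <= M * normc h ^+ 3.
  by move=> hr; apply: H; apply: le_trans hr _; rewrite ge_min lexx.
have h2 (x : RR) : `|x| <= rho -> Ic (f x%:C) = 0 /\ 0 <= Rc (f x%:C).
  by move=> xr; apply: real; apply: le_trans xr _; rewrite ge_min lexx orbT.
have [i0 r0] : Ic (f 0) = 0 /\ 0 <= Rc (f 0).
  by apply: (h2 0); rewrite normr0 ltW.
have fE : f 0 = (Rc (f 0))%:C by apply: complex_ext; [|exact: i0].
have fjet z (z0 : 0 < Ic z) : jet2 f z by case: (logexp_upper z0).
have fsect z (z0 : 0 < Ic z) : Ic (f z * z^*) <= 0 by case: (logexp_upper z0).
have freal (x : RR) (xr : `|x| <= rho) : Ic (f x%:C) = 0 by case: (h2 x xr).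
have a20 : Rc a2 <= 0 := @pick_second_order f (Rc (f 0)) M rho a1 a2 r0 fE rho0 fjet fsect h1 freal.
exists rho; split=> //; exists M, (Rc a1) => x xr.
have := h1 x%:C; rewrite normc_real => /(_ xr) Hx; have := le_trans (Rc_le _) Hx.
rewrite Rc_add Rc_opp !Rc_add Rc_scale -rmorphXn Rc_scale => le.
have le2 : x ^+ 2 * Rc a2 <= 0 by rewrite mulr_ge0_le0 ?sqr_ge0.
exact: taylor_upper le le2.
Qed.

End Pencil.

(** * Concavity from one-sided expansions *)

Section Concavity.
Variables (g : RR -> RR) (delta : RR).
Hypothesis cont : forall x : RR, `|x| < delta -> forall e : RR, 0 < e -> exists2 eta : RR, 0 < eta &
  forall h, `|h| < eta -> `|g (x + h) - g x| < e.
Hypothesis upper : forall x : RR, `|x| < delta -> exists rho : RR, 0 < rho /\ exists M a : RR,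
  forall h, `|h| <= rho -> g (x + h) <= g x + h * a + M * `|h| ^+ 3.

(** Adding the inequalities at h = t and h = -t cancels a and b and leaves eps t^2 <= M t^3, which
    fails for small t. *)
Lemma no_local_min (x eps b : RR) : `|x| < delta -> 0 < eps ->
  ~ (exists t0 : RR, 0 < t0 /\ forall h, `|h| <= t0 ->
       g x <= g (x + h) + h * b - eps * h ^+ 2).
Proof.
move=> xd e0 [t0 [t00 min]]; have [rho [rho0 [M [a up]]]] := upper xd.
pose t := Num.min (Num.min rho t0) (eps / (`|M| + 1)).
have M1 : 0 < `|M| + 1 by rewrite ltr_wpDl.
have tp : 0 < t by rewrite !lt_min rho0 t00 divr_gt0.
have [tr tt te] : [/\ t <= rho, t <= t0 & t <= eps / (`|M| + 1)].
  by split; rewrite /t !ge_min lexx ?orbT.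
have ta : `|t| = t by rewrite gtr0_norm.
have := min t; have := min (- t); have := up t; have := up (- t).
rewrite normrN ta !sqrrN => /(_ tr) u1 /(_ tr) u2 /(_ tt) m1 /(_ tt) m2.
rewrite ler_pdivlMr // in te.
have k : eps * t ^+ 2 <= M * t ^+ 3 by move: u1 u2 m1 m2; clear; rewrite !mulNr; lra.
have k2 : M * t ^+ 3 <= (t * `|M|) * t ^+ 2.
  by rewrite exprS mulrA ler_wpM2r ?sqr_ge0 // mulrC ler_wpM2l ?(ltW tp) // ler_norm.
have t2 : 0 < t ^+ 2 by rewrite exprn_gt0.
have := le_trans k k2; rewrite ler_pM2r // => k3.
by move: te tp k3; clear; rewrite mulrDr mulr1; lra.
Qed.

(** If g fell below its chord, the difference [D] plus the bump eps (s - x)(y - s) would have an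
    interior minimum; there the bump supplies the term -eps h^2 that [no_local_min] excludes. *)
Lemma chord_below (x y t : RR) : `|x| < delta -> `|y| < delta -> x < y -> 0 <= t <= 1 ->
  t * g x + (1 - t) * g y <= g (t * x + (1 - t) * y).
Proof.
move=> xd yd xy t01; rewrite leNgt; apply/negP => neg.
pose sl := (g y - g x) / (y - x); have yx : 0 < y - x by rewrite subr_gt0.
have slE : sl * (y - x) = g y - g x by rewrite /sl divfK // gt_eqF.
pose D s := g s - g x - sl * (s - x).
have between s : x <= s <= y -> `|s| < delta.
  move: xd yd; rewrite !ltr_norml => /andP[a1 a2] /andP[b1 b2] /andP[c1 c2].
  by apply/andP; split; [exact: lt_le_trans c1 | exact: le_lt_trans b2].
set w := t * x + (1 - t) * y in neg.
have Dw : D w < 0.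
  have -> : D w = g w - (t * g x + (1 - t) * g y).
    have -> : D w = g w - g x - (1 - t) * (sl * (y - x)) by rewrite /D /w; ring.
    by rewrite slE; ring.
  by rewrite subr_lt0.
have xw : x <= w <= y.
  by move: t01 xy; rewrite /w => /andP[? ?] ?; apply/andP; split; nra.
(* The bump is at most eps (y - x)^2 = -D w / 2, so the sum is still negative at w, while it
   vanishes at x and y. *)
pose eps := - D w / (2 * (y - x) ^+ 2).
have e0 : 0 < eps by rewrite divr_gt0 ?oppr_gt0 // mulr_gt0 ?exprn_gt0.
have epsE : eps * (y - x) ^+ 2 = - D w / 2.
  by rewrite /eps; field; rewrite gt_eqF.
pose E s (_ : RR) := D s + eps * ((s - x) * (y - s)).
(* The second variable is confined to the point 0, which turns the rectangle into [x, y]. *)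
have [|s ? sxy _ e ep|s [u0 [sxy _ min0]]] := @box_min E x y 0 0 (ltW xy); rewrite ?lexx //.
- pose c := `|sl| + eps * (2 * (y - x) + 1) + 1.
  have c0 : 0 < c.
    by rewrite ltr_wpDl // addr_ge0 // mulr_ge0 ?(ltW e0) // addr_ge0 // mulr_ge0 ?(ltW yx).
  have e2 : 0 < e / 2 by rewrite divr_gt0.
  have [eta eta0 H] := cont (between s sxy) e2.
  exists (Num.min eta (Num.min 1 (e / 2 / c))).
    by rewrite !lt_min eta0 ltr01 divr_gt0.
  move=> s' y'; rewrite !lt_min => /andP[h1 /andP[h2 h3]] _.
  change (`|E s 0 - E s' 0| < e).
  have -> : E s 0 - E s' 0 = - (g (s + (s' - s)) - g s) + ((s - s') * (- sl + eps * (x + y - s - s'))).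
    by rewrite /E /D addrCA subrr addr0; ring.
  apply: le_lt_trans (ler_normD _ _) _; rewrite normrN [e]splitr; apply: ltrD.
    by apply: H; rewrite distrC.
  rewrite normrM; rewrite ltr_pdivlMr // in h3; apply: le_lt_trans h3.
  rewrite ler_wpM2l //; apply: le_trans (ler_normD _ _) _; rewrite normrN.
  have -> : c = `|sl| + (eps * (2 * (y - x) + 1) + 1) by rewrite /c addrA.
  rewrite lerD2l.
  rewrite normrM (gtr0_norm e0); apply: (@le_trans _ _ (eps * (2 * (y - x) + 1))); last by rewrite lerDl.
  rewrite ler_wpM2l ?(ltW e0) //.
  move: h2 sxy; rewrite ltr_norml ler_norml; clear -xy => /andP[? ?] /andP[? ?].
  by apply/andP; split; lra.
have min s' : x <= s' <= y -> E s 0 <= E s' 0.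
  by move=> s'xy; apply: (min0 s' 0 s'xy); rewrite lexx.
have sd := between s sxy.
have Es : E s 0 < 0.
  apply: le_lt_trans (min w xw) _.
  have q : (w - x) * (y - w) <= (y - x) ^+ 2.
    by move: xw; clear => /andP[? ?]; nra.
  have := ler_wpM2l (ltW e0) q; rewrite epsE /E; move: Dw; clear; lra.
have E_end : E x 0 = 0 /\ E y 0 = 0.
  split; rewrite /E /D ?slE; ring.
have [sx sy] : x < s /\ s < y.
  move: sxy => /andP[xs ys]; split; rewrite lt_neqAle ?xs ?ys andbT; apply: contraTneq Es => es.
    by rewrite -es E_end.1 ltxx.
  by rewrite es E_end.2 ltxx.
apply (@no_local_min s eps (- sl + eps * (x + y - s - s)) sd e0).
exists (Num.min (s - x) (y - s)); split; first by rewrite lt_min !subr_gt0 sx.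
move=> h; rewrite le_min !ler_norml => /andP[/andP[h1 h2] /andP[h3 h4]].
have sh : x <= s + h <= y by move: h1 h4; clear => *; apply/andP; split; lra.
have := min (s + h) sh.
have -> : E (s + h) 0 = g (s + h) + h * (- sl + eps * (x + y - s - s)) - eps * h ^+ 2
   + (E s 0 - g s) by rewrite /E /D; ring.
by move: (E s 0); clear => u; lra.
Qed.

Lemma concave_of_local (x y t : RR) : `|x| < delta -> `|y| < delta -> 0 <= t <= 1 ->
  t * g x + (1 - t) * g y <= g (t * x + (1 - t) * y).
Proof.
move=> xd yd t01; case: (ltgtP x y) => [xy|yx|->]; first exact: chord_below.
  have t01' : 0 <= 1 - t <= 1 by move: t01 => /andP[? ?]; apply/andP; split; lra.
  have := chord_below yd xd yx t01'; have -> : 1 - (1 - t) = t by ring.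
  by rewrite addrC [(1 - t) * y + _]addrC.
by rewrite -!mulrDl addrC subrK !mul1r.
Qed.

End Concavity.

(** * Spectral calculus for Hermitian matrices *)

Lemma conj_mul (A : nzRingType) (p q a b : A) : p * q = 1 -> (q * a * p) * (q * b * p) = q * (a * b) * p.
Proof. by move=> pq; rewrite !mulrA -[q * a * p * q]mulrA pq mulr1. Qed.
Lemma conj_cancel (A : nzRingType) (p q a : A) : p * q = 1 -> p * (q * a * p) * q = a.
Proof. by move=> pq; rewrite !mulrA pq mul1r -mulrA pq mulr1. Qed.

Section Spectral.
Variable n : nat.
Implicit Types (A H X P : 'M[CC]_n.+1) (d e : 'I_n.+1 -> RR).

Definition real_diag d : 'M[CC]_n.+1 := diag_mx (\row_i (d i)%:C).
(** For a fixed unitary P these matrices form a commutative algebra on which [mexpC] acts by exp on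
    each d_i and, when all d_i > 0, [Log] acts by ln. *)
Definition unitary_diag P d : 'M[CC]_n.+1 := P^t* * real_diag d * P.
Definition mexpC A : 'M[CC]_n.+1 := \matrix_(i, j) csum (fun k => (ifact k)%:C * (A ^+ k) i j).

Lemma mnormX A k : mnorm (A ^+ k) <= mnorm (1 : 'M[CC]_n.+1) * mnorm A ^+ k.
Proof.
elim: k => [|k IH]; first by rewrite !expr0 mulr1.
rewrite [A ^+ _]exprSr [mnorm A ^+ _]exprSr mulrA; apply: le_trans (mnormM _ _) _.
by rewrite ler_wpM2r ?mnorm_ge0.
Qed.

Lemma summable_entry A i j : summable (fun k => (ifact k)%:C * (A ^+ k) i j).
Proof.
exists (fun k => mnorm (1 : 'M[CC]_n.+1) * (ifact k * mnorm A ^+ k)) => [k|]; last first.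
  exact: ex_series_scal_l _ _ (ex_series_exp (mnorm A)).
rewrite normcM normc_ifact mulrCA ler_wpM2l ?ifact_ge0 //.
exact: le_trans (mnorm_entry _ _ _) (mnormX A k).
Qed.

Lemma etrE A : etr A = \tr (mexpC A).
Proof.
rewrite /etr /mxtrace; under [RHS]eq_bigr do rewrite mxE.
rewrite -csum_sum; last by move=> i; exact: summable_entry.
by apply: csum_ext => k; rewrite mulr_sumr.
Qed.

Lemma hermitian_decomp H : H^t* = H -> exists P d, P \is unitarymx /\ H = unitary_diag P d.
Proof.
move=> hH; have hs : H \is hermsymmx.
  by apply/is_hermitianmxP; rewrite expr0 scale1r hH.
have /orthomx_spectralP e := hermitian_normalmx hs.
have /mxOverP r := hermitian_spectral_diag_real hs.
exists (spectralmx H), (fun i => Rc (spectral_diag H 0 i)); split; first exact: spectral_unitarymx.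
apply: etrans e _; rewrite invmx_unitary; last exact: spectral_unitarymx.
rewrite /unitary_diag /real_diag; congr (_ *m diag_mx _ *m _).
apply/rowP => i; rewrite mxE; have /complex_realP[x ->] := r 0 i.
by [].
Qed.

Section Unitary.
Variable P : 'M[CC]_n.+1.
Hypothesis uP : P \is unitarymx.

Lemma unitary_PP : P * P^t* = 1.
Proof. exact/unitarymxP. Qed.
Lemma unitary_PP' : P^t* * P = 1.
Proof. by apply: mulmx1C; exact/unitarymxP. Qed.

Lemma real_diagM d e : real_diag d * real_diag e = real_diag (fun i => d i * e i).
Proof.
rewrite /real_diag -[_ * _]/(_ *m _) mulmx_diag; congr diag_mx; apply/rowP => i.
by rewrite !mxE rmorphM.
Qed.
Lemma unitary_diagM d e : unitary_diag P d * unitary_diag P e = unitary_diag P (fun i => d i * e i).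
Proof.
by rewrite /unitary_diag -real_diagM; exact: conj_mul unitary_PP.
Qed.
Lemma unitary_diag1 : unitary_diag P (fun _ => 1) = 1.
Proof.
rewrite /unitary_diag -[RHS]unitary_PP'; congr (_ * _); rewrite -[RHS]mulr1; congr (_ * _).
by apply/matrixP => i j; rewrite !mxE.
Qed.
Lemma unitary_diagD d e : unitary_diag P (fun i => d i + e i) = unitary_diag P d + unitary_diag P e.
Proof.
rewrite /unitary_diag -mulrDl -mulrDr; congr (_ * _ * _).
apply/matrixP => i j; rewrite !mxE; case: (i == j); rewrite ?mulr1n ?mulr0n ?addr0 //.
by rewrite rmorphD.
Qed.
Lemma unitary_diagZ (a : RR) d : unitary_diag P (fun i => a * d i) = a%:C *: unitary_diag P d.
Proof.
rewrite /unitary_diag scalerAl scalerAr; congr (_ * _ * _).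
apply/matrixP => i j; rewrite !mxE; case: (i == j); rewrite ?mulr1n ?mulr0n ?mulr0 //.
by rewrite rmorphM.
Qed.
Lemma unitary_diag_ext d e : d =1 e -> unitary_diag P d = unitary_diag P e.
Proof.
by move=> de; rewrite /unitary_diag /real_diag; congr (_ * diag_mx _ * _); apply/rowP => i; rewrite !mxE de.
Qed.
Lemma unitary_diagX d k : unitary_diag P d ^+ k = unitary_diag P (fun i => d i ^+ k).
Proof.
elim: k => [|k IH]; first by rewrite expr0 -unitary_diag1; apply: unitary_diag_ext => i; rewrite expr0.
by rewrite exprS IH unitary_diagM; apply: unitary_diag_ext => i; rewrite exprS.
Qed.

Lemma unitary_diag_entry d i j : unitary_diag P d i j = \sum_l (P l i)^* * P l j * (d l)%:C.
Proof.
rewrite /unitary_diag mxE; apply: eq_bigr => l _; rewrite /real_diag -[_ * diag_mx _]/(_ *m _) mul_mx_diag !mxE.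
by rewrite mulrAC.
Qed.

Lemma mexp_unitary_diag d : mexpC (unitary_diag P d) = unitary_diag P (fun i => exp (d i)).
Proof.
apply/matrixP => i j; rewrite mxE unitary_diag_entry.
transitivity (csum (fun k => \sum_l ((P l i)^* * P l j) * ((ifact k)%:C * (d l)%:C ^+ k))).
  apply: csum_ext => k; rewrite unitary_diagX unitary_diag_entry mulr_sumr; apply: eq_bigr => l _.
  by rewrite rmorphXn mulrCA.
have sl (a : CC) l : summable (fun k => a * ((ifact k)%:C * (d l)%:C ^+ k)).
  exists (fun k => normc a * (ifact k * normc (d l)%:C ^+ k)) => [k|].
    by rewrite !normcM normc_ifact normcX.
  exact: ex_series_scal_l _ _ (ex_series_exp _).
rewrite csum_sum; last by move=> l; exact: sl.
apply: eq_bigr => l _; set a := _ * P l j.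
have s0 : summable (fun _ => 0 : CC).
  by exists (fun k => ifact k * 1 ^+ k) => [k|]; [rewrite normc0 mulr_ge0 ?ifact_ge0 ?exprn_ge0 | exact: ex_series_exp].
have c0 : csum (fun _ => 0 : CC) = 0.
  rewrite (@csum_ext _ (fun k => -1 * 0 + 0)) => [|k]; last by rewrite mulr0 addr0.
  by rewrite csum_lin // mulN1r addNr.
have e : cexp (d l)%:C = (exp (d l))%:C by rewrite cexpE /= cis0 mulr1.
rewrite -e /cexp -[RHS]addr0 -c0 -(csum_lin a (summable_exp (d l)%:C) s0).
by apply: csum_ext => k; rewrite addr0.
Qed.

Lemma qf_unitary_diag d v : qf (unitary_diag P d) v = (\sum_i d i * normc ((P *m v) i 0) ^+ 2)%:C.
Proof.
have -> : qf (unitary_diag P d) v = qf (real_diag d) (P *m v).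
  by rewrite /qf trmx_mul map_mxM /unitary_diag -[P^t* * _ * P]/(P^t* *m real_diag d *m P) !mulmxA.
rewrite qfE rmorph_sum; apply: eq_bigr => i _; rewrite (bigD1 i) //= big1 => [|j ji].
  by rewrite !mxE eqxx mulr1n addr0 -mulrA mulrCA mulc_conj -rmorphM.
by rewrite !mxE eq_sym (negPf ji) mulr0n mulr0 mul0r.
Qed.
Lemma vnorm_unitary v : vnorm (P *m v) = vnorm v.
Proof.
apply: (@complexI RR); rewrite -[RHS]qf1 -unitary_diag1 qf_unitary_diag; congr (_%:C).
by apply: eq_bigr => i _; rewrite mul1r.
Qed.

Lemma posdef_unitary_diag d : (forall i, 0 < d i) -> exists c, posdef c (unitary_diag P d).
Proof.
(* The inverse of the sum of the 1/d_i is a positive lower bound for every d_i. *)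
move=> d0; pose S := \sum_i (d i)^-1.
have le i : (d i)^-1 <= S.
  by rewrite /S (bigD1 i) //= lerDl sumr_ge0 // => j _; rewrite invr_ge0 ltW.
have S0 : 0 < S by apply: lt_le_trans (le 0); rewrite invr_gt0.
exists S^-1; split; first by rewrite invr_gt0.
move=> v; rewrite qf_unitary_diag -(vnorm_unitary v) /vnorm mulr_sumr /=.
apply: ler_sum => i _; rewrite ler_wpM2r ?sqr_ge0 //.
by rewrite -[leRHS]invrK lef_pV2 // posrE invr_gt0.
Qed.

Lemma Log_unitary_diag d : (forall i, 0 < d i) -> Log (unitary_diag P d) = unitary_diag P (fun i => ln (d i)).
Proof.
move=> d0; have [c pc] := posdef_unitary_diag d0; have aX := posdef_accretive pc.
set X := unitary_diag P d in pc aX *.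
pose q s i : RR := (d i - 1) / (1 + s * (d i - 1)).
have den s i : in01 s -> 0 < 1 + s * (d i - 1).
  by move=> /andP[s0 s1]; have := d0 i; nra.
have XE : X - 1 = unitary_diag P (fun i => d i - 1).
  have Xd : X = unitary_diag P (fun i => d i - 1) + 1.
    by rewrite -unitary_diag1 -unitary_diagD; apply: unitary_diag_ext => i; rewrite subrK.
  by rewrite Xd addrK.
have segE s : segment X s = unitary_diag P (fun i => 1 + s * (d i - 1)).
  by rewrite segmentE XE -unitary_diag1 -unitary_diagZ -unitary_diagD.
have resE s : in01 s -> (X - 1) * resolvent X s = unitary_diag P (q s).
  move=> s01; have u := segment_unit aX s01.
  apply: (mulIr u); rewrite -mulrA mulVr // mulr1 segE unitary_diagM XE; apply: unitary_diag_ext => i.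
  by rewrite /q divfK // gt_eqF ?den.
have lq : lipM (fun s => P * ((X - 1) * resolvent X s) * P^t*).
  by apply: lipMM (lipM_cst _); apply: lipMM (lipM_cst _) (lipM_Log aX).
(* Conjugation by P makes the integrand diagonal; its entries then integrate to ln (d_i) or 0. *)
have -> : Log X = P^t* * mint (fun s => P * ((X - 1) * resolvent X s) * P^t*) * P.
  rewrite -mintMl // -mintMr; last by apply: lipMM lq; exact: lipM_cst.
  by apply: mint_ext => s _; rewrite (conj_cancel _ unitary_PP').
rewrite /unitary_diag; congr (_ * _ * _).
have dgE s : in01 s -> P * ((X - 1) * resolvent X s) * P^t* = real_diag (q s).
  by move=> s01; rewrite resE //; exact: conj_cancel unitary_PP.
rewrite (mint_ext dgE); apply/matrixP => i j; rewrite !mxE.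
have cstI : rint (fun _ => 0) = 0.
  by rewrite /rint RInt_const; exact: mulr0.
have [->|ij] := eqVneq i j.
  rewrite (@cint_ext _ (fun s => (q s j)%:C)) => [|s _]; last by rewrite !mxE eqxx mulr1n.
  have /RltP dj := d0 j; rewrite mulr1n; apply: complex_ext; last by rewrite /= cstI.
  by rewrite /= -(RInt_ln (d j) dj).
rewrite mulr0n (@cint_ext _ (fun s => 0)) => [|s _]; last by rewrite !mxE (negPf ij) mulr0n.
exact: cint0.
Qed.

End Unitary.

(** Makes the exponential injective on Hermitian matrices, hence the matrix chosen by [mlog]
    unique. *)
Lemma Log_mexp H : H^t* = H -> Log (mexpC H) = H.
Proof.
move=> hH; have [P [d [uP e]]] := hermitian_decomp hH.
have pos i : 0 < exp (d i) by apply/RltP/exp_pos.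
rewrite [in LHS]e (mexp_unitary_diag uP) (Log_unitary_diag uP pos) e.
by apply: unitary_diag_ext => i; exact: ln_exp.
Qed.

Lemma mexp_Log X : X^t* = X -> (forall v, 0 < vnorm v -> 0 < Rc (qf X v)) ->
  [/\ mexpC (Log X) = X, (Log X)^t* = Log X & exists c, posdef c X].
Proof.
move=> /hermitian_decomp [P [d [uP XE]]] pos.
(* P^* e_i is a unit eigenvector of X for d_i, and the form is positive there. *)
have d0 i : 0 < d i.
  pose v : 'cV[CC]_n.+1 := P^t* *m delta_mx i 0.
  have Pv : P *m v = delta_mx i 0 by rewrite mulmxA -[P *m P^t*]/(P * P^t*) (unitary_PP uP) mul1mx.
  have v1 : vnorm v = 1.
    rewrite -(vnorm_unitary uP) Pv /vnorm (bigD1 i) //= big1 => [|j ji].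
      by rewrite mxE !eqxx normc1 expr1n addr0.
    by rewrite mxE (negPf ji) normc0 expr0n.
  have := pos v; rewrite v1 ltr01 XE qf_unitary_diag Pv (bigD1 i) //= big1 => [|j ji].
    by rewrite mxE !eqxx normc1 expr1n mulr1 addr0; apply.
  by rewrite mxE (negPf ji) normc0 expr0n mulr0.
rewrite XE (Log_unitary_diag uP d0) (mexp_unitary_diag uP); split.
- by apply: unitary_diag_ext => i; apply: exp_ln; exact/RltP.
- apply/matrixP => i j; rewrite 2!mxE !unitary_diag_entry rmorph_sum.
  have conjE (a b : CC) (r : RR) : (a^* * b * r%:C)^* = b^* * a * r%:C.
    by apply: complex_ext; rewrite !ReImE /=; ring.
  by apply: eq_bigr => l _; exact: conjE.
- exact: posdef_unitary_diag.
Qed.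

End Spectral.

Require Import Defs.
Local Open Scope ring_scope.

(** * Real matrices as complex matrices *)

Lemma herm_of_adj n (H : 'M[CC]_n.+1) : H^t* = H -> herm H.
Proof.
move=> hH v; have e : (qf H v)^* = qf H v.
  rewrite /qf -[RHS]/((v^t* *m H *m v) 0 0).
  transitivity (((v^t* *m H *m v)^t*) 0 0); first by rewrite [RHS]mxE [X in _ = X^*]mxE.
  by rewrite !trmx_mul !map_mxM hH trmxCK mulmxA.
by move/(congr1 Ic): e; rewrite Ic_conj; lra.
Qed.

(** [mlog] selects among real matrices, so [Log] of a real matrix must be real: its integrand is
    fixed by conjugation of the entries. *)
Lemma Log_real n (X : 'M[CC]_n.+1) c w : accretive c w X -> (forall i j, Ic (X i j) = 0) ->
  forall i j, Ic (Log X i j) = 0.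
Proof.
move=> aX rX i j; rewrite mxE /=.
have rE (A : 'M[CC]_n.+1) : (forall i j, Ic (A i j) = 0) -> map_mx Num.conj A = A.
  by move=> rA; apply/matrixP => k l; rewrite mxE; apply: complex_ext; rewrite ?Ic_conj ?Rc_conj ?rA ?oppr0.
have X1 : map_mx Num.conj (X - 1) = X - 1.
  by rewrite map_mxB map_mx1 rE.
have sE s : map_mx Num.conj (segment X s) = segment X s.
  by rewrite segmentE map_mxD map_mx1 map_mxZ X1; congr (_ + _ *: _); apply: complex_ext; rewrite ?Rc_conj ?Ic_conj //= oppr0.
rewrite (@rint_ext _ (fun _ => 0)) => [|s _]; first by rewrite /rint RInt_const; exact: mulr0.
have e : map_mx Num.conj ((X - 1) * resolvent X s) = (X - 1) * resolvent X s.
  rewrite -[_ * _]/((X - 1) *m invmx (segment X s)) map_mxM X1 map_invmx.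
  by congr (_ *m invmx _); exact: sE.
by move/matrixP/(_ i j): e; rewrite mxE => /(congr1 Ic); rewrite Ic_conj; lra.
Qed.

Section Bridge.
Variable n : nat.
Local Notation N := n.+1.
Implicit Types (A B C H K L : Mat) (v : 'cV[CC]_N).

Definition toM A : 'M[CC]_N := \matrix_(i, j) (A i j)%:C.

Lemma fsumE m (f : nat -> RR) : fsum m f = \sum_(i < m) f i.
Proof. by elim: m => [|m IH]; rewrite ?big_ord0 // big_ord_recr /= IH. Qed.

Lemma toM_ext A B : meq N A B -> toM A = toM B.
Proof. by move=> AB; apply/matrixP => i j; rewrite !mxE AB //; apply/ssrnat.ltP. Qed.
Lemma toM_inj A B : toM A = toM B -> meq N A B.
Proof.
move=> /matrixP e i j /ssrnat.ltP iN /ssrnat.ltP jN.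
by have := e (Ordinal iN) (Ordinal jN); rewrite !mxE /= => -[].
Qed.
Lemma toM_add A B : toM (madd A B) = toM A + toM B.
Proof. by apply/matrixP => i j; rewrite !mxE /madd RplusE rmorphD. Qed.
Lemma toM_scale c A : toM (mscale c A) = c%:C *: toM A.
Proof. by apply/matrixP => i j; rewrite !mxE /mscale RmultE rmorphM. Qed.
Lemma toM_pow A k : toM (mpow N A k) = toM A ^+ k.
Proof.
elim: k => [|k IH]; apply/matrixP => i j.
  rewrite expr0 !mxE /= /mid; case: Nat.eq_dec => [/val_inj ->|ij]; first by rewrite eqxx.
  by case: eqVneq => // e; case: ij; rewrite e.
rewrite exprSr -IH !mxE /= /mmul fsumE rmorph_sum; apply: eq_bigr => l _.
by rewrite !mxE RmultE rmorphM.
Qed.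

Lemma toM_mexp A : toM (mexp N A) = mexpC (toM A).
Proof.
apply/matrixP => i j; rewrite !mxE.
pose a k : RR := ifact k * mpow N A k i j.
have aE k : (ifact k)%:C * (toM A ^+ k) i j = (a k)%:C.
  by rewrite -toM_pow mxE -rmorphM.
have sa : ex_series a.
  by have := summable_Rc (summable_entry (toM A) i j); apply: ex_series_ext => k; rewrite aE.
have cv : Un_cv (exp_partial N A i j) (Series a).
  have /is_series_Reals := Series_correct _ sa; apply: Un_cv_ext => m.
  apply: PartSum.sum_eq => k _.
  by rewrite /a /ifact mulrC RdivE INRE factE.
(* Convergence makes the choice by [epsilon] a limit, and limits are unique. *)
have -> : mexp N A i j = Series a.
  exact: (UL_sequence _ _ _ (ClassicalEpsilon.epsilon_spec _ _ (ex_intro _ _ cv)) cv).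
apply: complex_ext => /=; first by apply: Series_ext => k; rewrite aE.
rewrite (Series_ext _ (fun _ => 0 * a 0%N)); first by rewrite Series_scal_l; exact: (esym (mul0r _)).
by move=> k; rewrite aE /= mul0r.
Qed.

Lemma toM_sym A : symmetric N A -> (toM A)^t* = toM A.
Proof.
move=> sA; apply/matrixP => i j; rewrite !mxE (sA j i); [exact: conjc_real| |]; exact/ssrnat.ltP.
Qed.

Lemma qformE A (x : nat -> RR) : qform N A x = \sum_(i < N) \sum_(j < N) x i * A i j * x j.
Proof. by rewrite /qform fsumE; apply: eq_bigr => i _; rewrite fsumE. Qed.

(** For a real matrix the mixed products of real and imaginary coordinates contribute only to the
    imaginary part, so complex positivity reduces to two real vectors. *)
Lemma qf_toM A v : Rc (qf (toM A) v) =
  qform N A (fun i => Rc (v (inord i) 0)) + qform N A (fun i => Ic (v (inord i) 0)).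
Proof.
rewrite qfE !qformE -big_split Rc_sum; apply: eq_bigr => i _; rewrite -big_split Rc_sum.
by apply: eq_bigr => j _; rewrite /= !inord_val mxE !ReImE /=; ring.
Qed.

Lemma qform_ge0 A x : pos_def N A -> 0 <= qform N A x.
Proof.
move=> [_ pA]; case: (Classical_Prop.classic (nonzero_vec N x)) => [nz|z].
  by apply/RleP/Rlt_le/pA.
have x0 (i : 'I_N) : x i = 0.
  apply: Classical_Prop.NNPP => xi; apply: z; exists i; split=> //; exact/ssrnat.ltP.
by rewrite qformE big1 // => i _; rewrite big1 // => j _; rewrite (x0 i) !mul0r.
Qed.

Lemma pos_def_qf A : pos_def N A -> forall v, 0 < vnorm v -> 0 < Rc (qf (toM A) v).
Proof.
move=> pA v v0; rewrite qf_toM.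
have [i vi] : exists i, v i 0 != 0.
  apply/existsP; apply: contraLR v0; rewrite negb_exists => /forallP z.
  rewrite -leNgt /vnorm big1 // => i _; have := z i; rewrite negbK => /eqP ->.
  by rewrite normc0 expr0n.
have iN : (i < N)%coq_nat by apply/ssrnat.ltP.
have [re|im] : Rc (v i 0) != 0 \/ Ic (v i 0) != 0.
  have [r0|] := eqVneq (Rc (v i 0)) 0; last by left.
  right; apply: contraNneq vi => i0; apply/eqP; exact: complex_ext.
- apply: ltr_pwDl; last exact: qform_ge0.
  by apply/RltP; case: pA => _; apply; exists i; rewrite inord_val; split=> //; exact/eqP.
- apply: ltr_wpDl; first exact: qform_ge0.
  by apply/RltP; case: pA => _; apply; exists i; rewrite inord_val; split=> //; exact/eqP.
Qed.

Lemma pos_def_of_posdef A c : symmetric N A -> posdef c (toM A) -> pos_def N A.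
Proof.
move=> sA [c0 co]; split=> // x [i [/ssrnat.ltP iN xi]]; apply/RltP.
pose v : 'cV[CC]_N := \col_i (x i)%:C.
have -> : qform N A x = Rc (qf (toM A) v).
  rewrite qfE qformE Rc_sum; apply: eq_bigr => k _; rewrite Rc_sum; apply: eq_bigr => l _.
  by rewrite !mxE !ReImE /=; ring.
apply: lt_le_trans (co v); rewrite mulr_gt0 // lt_neqAle vnorm_ge0 andbT eq_sym.
apply/eqP => v0; have := vnorm_entry v (Ordinal iN); rewrite v0 mxE normc_real.
by rewrite real_normK ?num_real // leNgt lt_neqAle sqr_ge0 andbT eq_sym sqrf_eq0; move/eqP: xi => ->.
Qed.

(** The real matrix [H0] shows that a symmetric logarithm exists; whichever one [epsilon] selects
    has exponential C, and [Log_mexp] recovers it from C. *)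
Lemma toM_mlog C : pos_def N C -> toM (mlog N C) = Log (toM C).
Proof.
move=> pC; have sC : symmetric N C by case: pC.
have [e hL [c pc]] := mexp_Log (toM_sym sC) (pos_def_qf pC).
have rL := Log_real (posdef_accretive pc) (fun i j => congr1 Ic (mxE _ _ i j)).
pose H0 : Mat := fun i j => Rc (Log (toM C) (inord i) (inord j)).
have H0E : toM H0 = Log (toM C).
  by apply/matrixP => i j; rewrite mxE /H0 !inord_val; apply: complex_ext; rewrite ?rL.
have ex : exists H, symmetric N H /\ meq N (mexp N H) C.
  exists H0; split; last by apply: toM_inj; rewrite toM_mexp H0E.
  move=> i j _ _; rewrite /H0 -[in LHS]hL; set l := Log _; rewrite [in LHS]mxE [in LHS]mxE.
  by rewrite Rc_conj.
have [sH eH] := ClassicalEpsilon.epsilon_spec (inhabits mid) (fun H => symmetric N H /\ meq N (mexp N H) C) ex.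
rewrite -/(mlog N C) in sH eH.
by rewrite -(toM_ext eH) toM_mexp Log_mexp // toM_sym.
Qed.

Lemma trexp_funE L C1 C2 K1 K2 z :
  pos_def N (madd C1 (mscale z K1)) -> pos_def N (madd C2 (mscale (- z) K2)) ->
  trexp_fun N L C1 C2 K1 K2 z = Rc (logexp (toM L) (toM C1) (toM C2) (toM K1) (- toM K2) z%:C).
Proof.
move=> p1 p2; rewrite /logexp etrE.
have e1 : toM C1 + z%:C *: toM K1 = toM (madd C1 (mscale z K1)) by rewrite toM_add toM_scale.
have e2 : toM C2 + z%:C *: - toM K2 = toM (madd C2 (mscale (- z) K2)).
  by rewrite toM_add toM_scale scalerN rmorphN scaleNr.
rewrite e1 e2 -(toM_mlog p1) -(toM_mlog p2) -addrA -!toM_add -toM_mexp.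
rewrite /trexp_fun /mtrace fsumE /mxtrace Rc_sum; apply: eq_bigr => i _.
by rewrite mxE.
Qed.

End Bridge.

(** * Concavity on an interval around 0 *)

Lemma posdef_perturb n c (C K : 'M[CC]_n.+1) (x : RR) : posdef c C ->
  `|x| < c / 2 / (mnorm K + 1) -> posdef (c / 2) (C + x%:C *: K).
Proof.
move=> [c0 co] hx; split; first by rewrite divr_gt0.
have k0 : 0 < mnorm K + 1 by rewrite ltr_wpDl ?mnorm_ge0.
have {}hx : `|x| * (mnorm K + 1) < c / 2 by rewrite -ltr_pdivlMr.
move=> v; rewrite qfD qfZ Rc_add Rc_scale.
have h1 := co v; have v0 := vnorm_ge0 v.
have h2 : `|x * Rc (qf K v)| <= c / 2 * vnorm v.
  rewrite normrM; apply: (@le_trans _ _ (`|x| * (mnorm K * vnorm v))).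
    by rewrite ler_wpM2l // (le_trans (normr_Rc _)) ?normc_qf.
  rewrite mulrA ler_wpM2r //; apply: le_trans (ltW hx).
  by rewrite ler_wpM2l // lerDl.
by move: h1 h2; rewrite ler_norml; clear => h1 /andP[h2 h3]; lra.
Qed.

Lemma logexp_shift n (L C1 C2 K1 K2 : 'M[CC]_n.+1) (x z : CC) :
  logexp L C1 C2 K1 K2 (x + z) = logexp L (C1 + x *: K1) (C2 + x *: K2) K1 K2 z.
Proof. by rewrite /logexp !scalerDl !addrA. Qed.

Lemma logexp_concave n (L C1 C2 K1 K2 : 'M[CC]_n.+1) (c1 c2 delta : RR) :
  herm L -> herm C1 -> herm C2 -> herm K1 -> herm K2 ->
  (forall x : RR, `|x| < delta -> posdef c1 (C1 + x%:C *: K1)) ->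
  (forall x : RR, `|x| < delta -> posdef c2 (C2 + x%:C *: - K2)) ->
  possemidef K1 -> possemidef K2 ->
  forall x y t : RR, `|x| < delta -> `|y| < delta -> 0 <= t <= 1 ->
  t * Rc (logexp L C1 C2 K1 (- K2) x%:C) + (1 - t) * Rc (logexp L C1 C2 K1 (- K2) y%:C)
    <= Rc (logexp L C1 C2 K1 (- K2) (t * x + (1 - t) * y)%:C).
Proof.
move=> hL hC1 hC2 hK1 hK2 p1 p2 pK1 pK2 x y t xd yd t01.
pose g (s : RR) : RR := Rc (logexp L C1 C2 K1 (- K2) s%:C).
have hN : herm (- K2) by move=> u; rewrite qfN Ic_opp hK2 oppr0.
have gE (s h : RR) : g (s + h) = Rc (logexp L (C1 + s%:C *: K1) (C2 + s%:C *: - K2) K1 (- K2) h%:C).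
  by rewrite /g rmorphD logexp_shift.
have gE0 (s : RR) : g s = Rc (logexp L (C1 + s%:C *: K1) (C2 + s%:C *: - K2) K1 (- K2) 0).
  by rewrite -[LHS]/(g s) -{1}[s]addr0 gE.
have cont (s : RR) : `|s| < delta -> forall e : RR, 0 < e -> exists2 eta : RR, 0 < eta &
    forall h, `|h| < eta -> `|g (s + h) - g s| < e.
  move=> sd e e0.
  have a1 := posdef_accretive (p1 s sd); have a2 := posdef_accretive (p2 s sd).
  have jet : jet2 (logexp L (C1 + s%:C *: K1) (C2 + s%:C *: - K2) K1 (- K2)) 0.
    have [rho [rho0 [b1 [b2 [M H]]]]] := logexp_jet L K1 (- K2) a1 a2.
    by exists rho; split=> //; exists b1, b2, M => h hr; rewrite add0r; exact: H.
  have [eta eta0 H] := jet2_continuous jet e0; exists eta => // h hh.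
  have := H h%:C; rewrite normc_real add0r => /(_ hh); apply: le_lt_trans.
  by rewrite gE gE0 -Rc_opp -Rc_add normr_Rc.
have upper (s : RR) : `|s| < delta -> exists rho : RR, 0 < rho /\ exists M a : RR,
    forall h, `|h| <= rho -> g (s + h) <= g s + h * a + M * `|h| ^+ 3.
  move=> sd.
  have [rho [rho0 [M [a H]]]] := logexp_second_difference hL (herm_pencil s hC1 hK1)
    (herm_pencil s hC2 hN) hK1 hK2 (p1 s sd) (p2 s sd) pK1 pK2.
  by exists rho; split=> //; exists M, a => h hr; rewrite gE gE0; exact: H.
exact: (@concave_of_local g delta cont upper x y t xd yd t01).
Qed.

Lemma symmetric_pencil n A B (z : RR) : symmetric n A -> symmetric n B -> symmetric n (madd A (mscale z B)).
Proof. by move=> sA sB i j iN jN; rewrite /madd /mscale (sA i j) // (sB i j). Qed.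

Lemma pos_semidef_qf n A : pos_semidef n.+1 A -> possemidef (toM n A).
Proof. by move=> [_ pA] v; rewrite qf_toM addr_ge0 //; apply/RleP/pA. Qed.

Lemma convex_combination_lt (x y t delta : RR) : `|x| < delta -> `|y| < delta -> 0 <= t <= 1 ->
  `|t * x + (1 - t) * y| < delta.
Proof.
move=> xd yd /andP[t0 t1]; pose m := Num.max `|x| `|y|.
apply: (@le_lt_trans _ _ m); last by rewrite /m gt_max xd.
have -> : m = t * m + (1 - t) * m by ring.
have s0 : 0 <= 1 - t by rewrite subr_ge0.
apply: le_trans (ler_normD _ _) _; rewrite !normrM (ger0_norm t0) (ger0_norm s0).
by rewrite lerD // ler_wpM2l // /m le_max lexx ?orbT.
Qed.

Lemma trexp_concave n L C1 C2 K1 K2 : symmetric n.+1 L -> pos_def n.+1 C1 -> pos_def n.+1 C2 ->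
  pos_semidef n.+1 K1 -> pos_semidef n.+1 K2 -> exists delta : RR, [/\ 0 < delta,
    forall z, `|z| < delta -> pos_def n.+1 (madd C1 (mscale z K1)) /\ pos_def n.+1 (madd C2 (mscale (- z) K2))
  & forall x y t, `|x| < delta -> `|y| < delta -> 0 <= t <= 1 ->
      t * trexp_fun n.+1 L C1 C2 K1 K2 x + (1 - t) * trexp_fun n.+1 L C1 C2 K1 K2 y
      <= trexp_fun n.+1 L C1 C2 K1 K2 (t * x + (1 - t) * y)].
Proof.
move=> sL pC1 pC2 pK1 pK2.
have [sC1 sC2] : symmetric n.+1 C1 /\ symmetric n.+1 C2 by split; [case: pC1 | case: pC2].
have [sK1 sK2] : symmetric n.+1 K1 /\ symmetric n.+1 K2 by split; [case: pK1 | case: pK2].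
have [_ _ [c1 q1]] := mexp_Log (toM_sym sC1) (pos_def_qf pC1).
have [_ _ [c2 q2]] := mexp_Log (toM_sym sC2) (pos_def_qf pC2).
(* Below this radius half of the lower bound c survives, so one constant serves for all the
   translated pencils. *)
pose d (c : RR) (K : 'M[CC]_n.+1) := c / 2 / (mnorm K + 1).
have d0 (c : RR) C (K : 'M[CC]_n.+1) : posdef c C -> 0 < d c K.
  move=> [c0 _]; rewrite /d; apply: divr_gt0; first by rewrite divr_gt0.
  by rewrite ltr_wpDl ?mnorm_ge0.
pose delta := Num.min (d c1 (toM n K1)) (d c2 (- toM n K2)).
have delta0 : 0 < delta.
  by rewrite /delta lt_min; apply/andP; split; [exact: d0 q1 | exact: d0 q2].
have r1 (z : RR) : `|z| < delta -> posdef (c1 / 2) (toM n C1 + z%:C *: toM n K1).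
  by rewrite lt_min => /andP[zd _]; exact: posdef_perturb.
have r2 (z : RR) : `|z| < delta -> posdef (c2 / 2) (toM n C2 + z%:C *: - toM n K2).
  by rewrite lt_min => /andP[_ zd]; exact: posdef_perturb.
have pd (z : RR) : `|z| < delta ->
    pos_def n.+1 (madd C1 (mscale z K1)) /\ pos_def n.+1 (madd C2 (mscale (- z) K2)).
  move=> zd; split.
    apply: (@pos_def_of_posdef _ _ (c1 / 2)); first exact: symmetric_pencil.
    by rewrite toM_add toM_scale; exact: r1.
  apply: (@pos_def_of_posdef _ _ (c2 / 2)); first exact: symmetric_pencil.
  by rewrite toM_add toM_scale rmorphN scaleNr -scalerN; exact: r2.
have fE (z : RR) : `|z| < delta -> trexp_fun n.+1 L C1 C2 K1 K2 z =
    Rc (logexp (toM n L) (toM n C1) (toM n C2) (toM n K1) (- toM n K2) z%:C).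
  by move=> /pd[p1 p2]; exact: trexp_funE.
exists delta; split=> // x y t xd yd t01.
have td : `|t * x + (1 - t) * y| < delta.
  exact: convex_combination_lt.
rewrite !fE //.
exact: (logexp_concave (herm_of_adj (toM_sym sL)) (herm_of_adj (toM_sym sC1))
  (herm_of_adj (toM_sym sC2)) (herm_of_adj (toM_sym sK1)) (herm_of_adj (toM_sym sK2))
  r1 r2 (pos_semidef_qf pK1) (pos_semidef_qf pK2) xd yd t01).
Qed.

(* ssrnat rebinds [<=] in [nat_scope] to the boolean order. *)
Notation "m <= n" := (le m n) : nat_scope.
Open Scope R_scope.

Theorem theorem3p5 (n : nat) (L C1 C2 K1 K2 : Mat) :
  (1 <= n)%nat ->
  symmetric n L ->
  pos_def n C1 -> pos_def n C2 ->
  pos_semidef n K1 -> pos_semidef n K2 ->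
  exists delta : R, 0 < delta /\
    (forall z, Rabs z < delta ->
       pos_def n (madd C1 (mscale z K1)) /\ pos_def n (madd C2 (mscale (- z) K2))) /\
    (forall x y t, Rabs x < delta -> Rabs y < delta -> 0 <= t <= 1 ->
       t * trexp_fun n L C1 C2 K1 K2 x + (1 - t) * trexp_fun n L C1 C2 K1 K2 y
       <= trexp_fun n L C1 C2 K1 K2 (t * x + (1 - t) * y)).
Proof.
(* The complex matrices have size [n.+1], where they form a nonzero ring. *)
case: n => [|n] n1 sL pC1 pC2 pK1 pK2; first by inversion n1.
have [delta [/RltP d0 pd conc]] := trexp_concave sL pC1 pC2 pK1 pK2.
exists delta; split; first exact: d0.
split=> [z /RltP|x y t /RltP xd /RltP yd [/RleP t0 /RleP t1]].
  by rewrite RabsE; exact: pd.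
rewrite RabsE in xd; rewrite RabsE in yd.
by apply/RleP; apply: (conc x y t xd yd); rewrite t0 t1.
Qed.
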